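(* There exist an integer $N_0$ and positive constants $K_1,K_2$ and $K_3$ depending only on $\lambda,p$ and $r_+$ such that the partition $(\widehat{\mathcal P}^{\rm sp}_+,\widehat{\mathcal P}^{\rm sp}_-)$ returned by the spectral method satisfies $$\mathbb P\left(\mathrm{MR}(\widehat{\mathcal P}^{\rm sp}_+,\widehat{\mathcal P}^{\rm sp}_-)\ge K_1\left(\frac{N\log(T)\log(N\log(T))}{T}+\frac{\log(N)}{N}\right)\right)\le K_2\left(\sqrt{\frac NT}+\frac1N\right)$$ for all pairs $(T,N)$ for which $N\ge N_0$ and $T\ge\big(K_3N\log(T)\log(N\log(T))\big)\vee2$.
   Context: Model. Fix $0<\lambda<1$, $0<\mu\le\lambda$, $0<p\le 1$ and $r_+,r_-\in(0,1)$ with $r_++r_-=1$. For each $N$, $[N]=\{1,\dots,N\}$ is partitioned into two deterministic sets $\mathcal P_+,\mathcal P_-$; with $r^N_a=|\mathcal P_a|/N$ ($a\in\{-,+\}$) it is assumed that $|r^N_+-r_+|\vee|r^N_--r_-|\le K_0N^{-1}$ for a fixed constant $K_0$ (regarded as absolute). Let $\theta=(\theta_{ij})_{i,j\in[N]}$ be i.i.d. $\mathrm{Ber}(p)$. Conditionally on $\theta$, $X=(X_t)_{t\in\mathbb Z}$, $X_t=(X_{1,t},\dots,X_{N,t})\in\{0,1\}^N$, is the (unique in law) stationary Markov chain such that, given $X_{t-1}=x$, the coordinates of $X_t$ are independent with $X_{i,t}\sim\mathrm{Ber}(p_{\theta,i}(x))$, where $$p_{\theta,i}(x)=\mu+(1-\lambda)\Big(\frac1N\sum_{j\in\mathcal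 P_+}\theta_{ij}x_j+\frac1N\sum_{j\in\mathcal P_-}\theta_{ij}(1-x_j)\Big).$$ $\mathbb P$ refers to the joint law of $(\theta,X)$. Spectral method. The sample is $X_1,\dots,X_{T+1}$, $T\ge1$ an integer. $1_N\in\mathbb R^N$ is the all-ones vector. $\widehat m=\frac1T\sum_{t=1}^TX_t$, $\widehat\Sigma^{(1)}=\frac1T\sum_{t=1}^T(X_{t+1}-\widehat m)(X_t-\widehat m)^\top$, $\widehat\sigma^{\rm ag}=(\widehat\Sigma^{(1)})^\top1_N$. Let $\check v$ be any (unit-norm) leading right singular vector of $\widehat\Sigma^{(1)}$, i.e. associated with its largest singular value, and $\check{\mathcal P}=\{i\in[N]:\check v_i\ge N^{-1}\sum_{j=1}^N\check v_j\}$. Put $\widehat\sigma^{\rm sp}=\check v$ if $|\check{\mathcal P}|^{-1}\sum_{i\in\check{\mathcal P}}\widehat\sigma^{\rm ag}_i\ge|[N]\setminus\check{\mathcal P}|^{-1}\sum_{i\in[N]\setminus\check{\mathcal P}}\widehat\sigma^{\rm ag}_i$, and $\widehat\sigma^{\rm sp}=-\check v$ otherwise. Finally $\widehat{\mathcal P}^{\rm sp}_+=\{i\in[N]:\widehat\sigma^{\rm sp}_i\ge N^{-1}\sum_{j=1}^N\widehat\sigma^{\rm sp}_j\}$ and $\widehat{\mathcal P}^{\rm sp}_-=[N]\setminus\widehat{\mathcal P}^{\rm sp}_+$. Misclassification rate of a partition $(\widehat{\mathcal P}_+,\widehat{\mathcal P}_-)$ of $[N]$: $\mathrm{MR}(\widehat{\mathcal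 P}_+,\widehat{\mathcal P}_-)=N^{-1}\big(|\widehat{\mathcal P}_+\cap\mathcal P_-|+|\widehat{\mathcal P}_-\cap\mathcal P_+|\big)$. *)

(* Defs.v *)
From mathcomp Require Import all_boot all_order all_algebra.
From mathcomp Require Import all_classical all_reals all_analysis.

Set Implicit Arguments.
Unset Strict Implicit.
Unset Printing Implicit Defensive.

Import Order.TTheory GRing.Theory Num.Theory.

Local Open Scope classical_set_scope.
Local Open Scope ring_scope.

(* [N] is 'I_N.  A community structure is given by Pp : {set 'I_N}, the set
   P_+; the set P_- is its complement ~: Pp. *)

Section Model.
Context {R : realType}.
Variables (lambda mu p : R) (N : nat) (Pp : {set 'I_N}).

Definition act_prob (A : 'M[bool]_N) (x : {ffun 'I_N -> bool}) (i : 'I_N) : R :=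
  mu + (1 - lambda) *
    (N%:R^-1 * (\sum_(j in Pp) (A i j : nat)%:R * (x j : nat)%:R)
     + N%:R^-1 *
       (\sum_(j in ~: Pp) (A i j : nat)%:R * (1 - (x j : nat)%:R))).

Definition trans_prob (A : 'M[bool]_N) (x y : {ffun 'I_N -> bool}) : R :=
  \prod_(i < N) bernoulli_pmf (act_prob A x i) (y i).

Context {d : measure_display} {Omega : measurableType d}
  {P : probability Omega R}.
Variables (theta : 'I_N -> 'I_N -> {RV P >-> bool})
  (X : int -> 'I_N -> {RV P >-> bool}).

Definition graph (w : Omega) : 'M[bool]_N := \matrix_(i, j) theta i j w.

Definition config (t : int) (w : Omega) : {ffun 'I_N -> bool} :=
  [ffun i => X t i w].

(* {theta = A, X_s = x_0, ..., X_(s+n) = x_n}; x is only read up to index n *)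
Definition path_event (A : 'M[bool]_N) (s : int) (n : nat)
    (x : nat -> {ffun 'I_N -> bool}) : set Omega :=
  [set w | graph w = A /\
     forall k : nat, (k <= n)%N -> config (s + k%:Z) w = x k].

(* Conditional statements given theta = A are multiplied out by P(theta = A),
   and thus carry no content for the A with P(theta = A) = 0. *)
Record community_chain : Prop := {
  graph_iid_bernoulli : forall A : 'M[bool]_N,
    P [set w | graph w = A]
    = (\prod_(i < N) \prod_(j < N) bernoulli_pmf p (A i j))%:E;
  chain_markov : forall A s n x,
    P (path_event A s n.+1 x)
    = (P (path_event A s n x) * (trans_prob A (x n) (x n.+1))%:E)%E;
  chain_stationary : forall A s n x,
    P (path_event A (s + 1) n x) = P (path_event A s n x)
}.

(* X_t as a real column vector, for t a natural number *)
Definition sample (w : Omega) (t : nat) : 'cV[R]_N :=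
  \col_i (X t%:Z i w : nat)%:R.

End Model.

Section SpectralMethod.
Context {R : realType} {N : nat}.

Section Statistics.
Variables (T : nat) (x : nat -> 'cV[R]_N).

Definition mhat : 'cV[R]_N := T%:R^-1 *: \sum_(1 <= t < T.+1) x t.

Definition Sigmahat : 'M[R]_N :=
  T%:R^-1 *: \sum_(1 <= t < T.+1) ((x t.+1 - mhat) *m (x t - mhat)^T).

Definition sigma_ag : 'cV[R]_N := Sigmahat^T *m const_mx 1.
End Statistics.

(* Euclidean norm 1 (the library norm on matrices is the max norm) *)
Definition unit_vector (v : 'cV[R]_N) : Prop := \sum_(i < N) v i 0 ^+ 2 = 1.

Definition singular_triple (A : 'M[R]_N) (s : R) (u v : 'cV[R]_N) : Prop :=
  [/\ 0 <= s, unit_vector u, unit_vector v, A *m v = s *: u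
    & A^T *m u = s *: v].

Definition leading_right_singular_vector (A : 'M[R]_N) (v : 'cV[R]_N) : Prop :=
  exists (s : R) (u : 'cV[R]_N), singular_triple A s u v /\
    forall s' u' v', singular_triple A s' u' v' -> s' <= s.

Definition above_mean (v : 'cV[R]_N) : {set 'I_N} :=
  [set i | N%:R^-1 * (\sum_(j < N) v j 0) <= v i 0]%SET.

Definition average (S : {set 'I_N}) (v : 'cV[R]_N) : R :=
  #|S|%:R^-1 * (\sum_(i in S) v i 0).

(* The set above_mean v is nonempty for N > 0, but its complement is empty when
   v is constant.  The average over it then has the value 0, and this choice is
   immaterial: both v and - v are constant and give the same partition. *)
Definition sigma_sp (ag v : 'cV[R]_N) : 'cV[R]_N :=
  if average (~: above_mean v)%SET ag <= average (above_mean v) ag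
  then v else - v.

Definition spectral_plus (T : nat) (x : nat -> 'cV[R]_N) (v : 'cV[R]_N)
    : {set 'I_N} :=
  above_mean (sigma_sp (sigma_ag T x) v).

Definition spectral_minus (T : nat) (x : nat -> 'cV[R]_N) (v : 'cV[R]_N)
    : {set 'I_N} :=
  (~: spectral_plus T x v)%SET.

Definition misclassification_rate (Pp Qp Qm : {set 'I_N}) : R :=
  N%:R^-1 * (#|Qp :&: ~: Pp| + #|Qm :&: Pp|)%N%:R.

End SpectralMethod.

(* Main.v *)
Require Import Defs.
From mathcomp Require Import all_boot all_order all_algebra.
From mathcomp Require Import all_classical all_reals all_analysis.
From mathcomp Require Import measurable_realfun ring lra.

Set Implicit Arguments.
Unset Strict Implicit.
Unset Printing Implicit Defensive.

Import Order.TTheory GRing.Theory Num.Theory.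
Import numFieldNormedType.Exports.

Local Open Scope classical_set_scope.
Local Open Scope ring_scope.

(* Write Z_t = X_t - m for the mean-field fixed point m.  Given theta the chain is
   a linear autoregression Z_(t+1) = A Z_t + rho + xi_(t+1) with operator norm
   |A| <= 1 - lambda, a bounded residual rho and conditionally independent
   centred noise xi.  Here A is (1 - lambda) p / N times the rank-one matrix
   1 sigma^T, sigma the +-1 vector of the communities, up to an error of operator
   norm O(N^(-1/2)).  Chernoff bounds over a lattice net of the unit ball control,
   outside an event of probability 4 exp(-N), the operator norms of theta - p,
   of the empirical noise covariance minus its compensator, of the empirical
   cross covariance of xi_(t+1) and Z_t, and the norm of the mean noise.  Since
   the chain contracts, the empirical covariance of Z is then bounded, and
   expanding the recursion gives

     Sigmahat = (1 - lambda) p / N * 1 h^T + E,   h = beta 1 + m (1 - m) sigma,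

   with |E| = O(sqrt (N / T) + N^(-1/2)).  If (s, u, v) is the leading singular
   triple, s v = Sigmahat^T u is a multiple of h up to an error vector of norm at
   most |E|.  A misclassified vertex forces a coordinate of order N^(-1/2) in that
   error vector, so the rate is O(|E|^2) = O(N / T + 1 / N). *)

(** * Euclidean norm and operator norm *)

(** The quadratic variation that governs the empirical cross covariance of noise and state is itself
    an empirical covariance of the state. This circle is broken as follows: the covariance bound is
    a deterministic consequence of the noise covariance event and the contraction, and the cross
    covariance is estimated only on outcomes where that bound holds. Exponential moments are summed
    over finite paths, one transition at a time. The coefficient beta is random and only its size is
    controlled. This suffices because comparison with the mean ignores multiples of the all-ones
    vector, while h has norm of order sqrt N whatever beta is. The constants must be uniform in mu,
    hence a lower bound on m (1 - m) in terms of lambda, p and the community proportions. The net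
    has at most exp(18 N) points, so deviations of order sqrt N in the normalized bilinear forms
    already have probability exp(-N) after a union bound. No logarithm arises; the logarithmic
    factors of the theorem enter only as quantities that are at least 1. *)

Section Dot.
Context {R : rcfType} {n : nat}.
Implicit Types (x y z : 'cV[R]_n) (M : 'M[R]_n).

Lemma colDE x y i : (x + y) i 0 = x i 0 + y i 0. Proof. by rewrite mxE. Qed.

Lemma colZE (a : R) x i : (a *: x) i 0 = a * x i 0. Proof. by rewrite mxE. Qed.

Lemma colBE x y i : (x - y) i 0 = x i 0 - y i 0. Proof. by rewrite !mxE. Qed.

Definition dot x y : R := \sum_i x i 0 * y i 0.
Definition nrm x : R := Num.sqrt (dot x x).

Lemma dotC x y : dot x y = dot y x.
Proof. by apply: eq_bigr => i _; rewrite mulrC. Qed.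

Lemma dotDl x y z : dot (x + y) z = dot x z + dot y z.
Proof. by rewrite -big_split; apply: eq_bigr => i _; rewrite mxE mulrDl. Qed.

Lemma dotZl (a : R) x y : dot (a *: x) y = a * dot x y.
Proof. by rewrite mulr_sumr; apply: eq_bigr => i _; rewrite mxE mulrA. Qed.

Lemma dotDr x y z : dot x (y + z) = dot x y + dot x z.
Proof. by rewrite dotC dotDl !(dotC x). Qed.

Lemma dotZr (a : R) x y : dot x (a *: y) = a * dot x y.
Proof. by rewrite dotC dotZl dotC. Qed.

Lemma dotNl x y : dot (- x) y = - dot x y.
Proof. by rewrite -scaleN1r dotZl mulN1r. Qed.

Lemma dotNr x y : dot x (- y) = - dot x y.
Proof. by rewrite -scaleN1r dotZr mulN1r. Qed.

Lemma dotBl x y z : dot (x - y) z = dot x z - dot y z.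
Proof. by rewrite dotDl dotNl. Qed.

Lemma dotBr x y z : dot x (y - z) = dot x y - dot x z.
Proof. by rewrite dotDr dotNr. Qed.

Lemma dot0l x : dot 0 x = 0.
Proof. by rewrite -(scale0r 0) dotZl mul0r. Qed.

Lemma dot0r x : dot x 0 = 0.
Proof. by rewrite dotC dot0l. Qed.

Lemma dot_sumr (I : Type) (r : seq I) (P : pred I) (F : I -> 'cV[R]_n) x :
  dot x (\sum_(i <- r | P i) F i) = \sum_(i <- r | P i) dot x (F i).
Proof.
by elim/big_rec2: _ => [|i u v _ <-]; [exact: dot0r | rewrite dotDr].
Qed.

Lemma dot_mx x y : x^T *m y = (dot x y)%:M.
Proof.
apply/matrixP => i j; rewrite !ord1 !mxE eqxx mulr1n.
by apply: eq_bigr => k _; rewrite mxE.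
Qed.

Lemma dot_mulmx M x y : dot x (M *m y) = dot (M^T *m x) y.
Proof.
have h : (dot x (M *m y))%:M = (dot (M^T *m x) y)%:M :> 'M[R]_1.
  by rewrite -!dot_mx trmx_mul trmxK mulmxA.
by move/matrixP/(_ 0 0): h; rewrite !mxE eqxx !mulr1n.
Qed.

Lemma mulmx_outer x y z : (x *m y^T) *m z = dot y z *: x.
Proof. by rewrite -mulmxA dot_mx mul_mx_scalar. Qed.

Lemma dot_ge0 x : 0 <= dot x x.
Proof. by apply: sumr_ge0 => i _; rewrite -expr2 sqr_ge0. Qed.

Lemma dot_eq0 x : dot x x = 0 -> x = 0.
Proof.
move=> /eqP; rewrite psumr_eq0; last by move=> i _; rewrite -expr2 sqr_ge0.
move=> /allP h; apply/colP => i; rewrite mxE.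
by have := h i; rewrite mem_index_enum => /(_ isT); rewrite mulf_eq0 orbb => /eqP.
Qed.

Lemma nrm_ge0 x : 0 <= nrm x. Proof. exact: sqrtr_ge0. Qed.

Lemma nrm_sqr x : nrm x ^+ 2 = dot x x.
Proof. by rewrite sqr_sqrtr // dot_ge0. Qed.

Lemma nrm0 : nrm 0 = 0. Proof. by rewrite /nrm dot0l sqrtr0. Qed.

Lemma nrmZ (a : R) x : nrm (a *: x) = `|a| * nrm x.
Proof.
by rewrite /nrm dotZl dotZr mulrA -expr2 sqrtrM ?sqr_ge0 // sqrtr_sqr.
Qed.

Lemma nrmN x : nrm (- x) = nrm x.
Proof. by rewrite -scaleN1r nrmZ normrN1 mul1r. Qed.

Lemma nrm_le x (c : R) : 0 <= c -> dot x x <= c ^+ 2 -> nrm x <= c.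
Proof. by move=> c0 h; rewrite -(ler_sqr (nrm_ge0 _) c0) nrm_sqr. Qed.

Lemma nrm_eq0 x : nrm x = 0 -> x = 0.
Proof. by move=> h; apply: dot_eq0; rewrite -nrm_sqr h expr0n. Qed.

Lemma dot_le x y : dot x y <= nrm x * nrm y.
Proof.
have [->|x0] := eqVneq x 0; first by rewrite dot0l nrm0 mul0r.
have [->|y0] := eqVneq y 0; first by rewrite dot0r nrm0 mulr0.
have px : 0 < nrm x.
  by rewrite lt_neqAle nrm_ge0 andbT eq_sym; apply: contra_neq x0; exact: nrm_eq0.
have py : 0 < nrm y.
  by rewrite lt_neqAle nrm_ge0 andbT eq_sym; apply: contra_neq y0; exact: nrm_eq0.
have := dot_ge0 (nrm y *: x - nrm x *: y).
rewrite dotBl !dotBr !dotZl !dotZr (dotC y x) -!nrm_sqr.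
have pxy := mulr_gt0 px py => h.
have {}h : 0 <= nrm x * nrm y * (nrm x * nrm y - dot x y) by nra.
by rewrite -subr_ge0 -(pmulr_rge0 _ pxy).
Qed.

Lemma dot_abs x y : `|dot x y| <= nrm x * nrm y.
Proof.
rewrite ler_norml dot_le andbT lerNl -dotNl.
by rewrite -[in leRHS](nrmN x) dot_le.
Qed.

Lemma dot_sqr_le x y : dot x y ^+ 2 <= dot x x * dot y y.
Proof.
by rewrite -!nrm_sqr -exprMn -real_normK ?num_real // ler_sqr ?nnegrE
  ?mulr_ge0 ?nrm_ge0 // dot_abs.
Qed.

Lemma nrmD x y : nrm (x + y) <= nrm x + nrm y.
Proof.
apply: nrm_le; first by rewrite addr_ge0 ?nrm_ge0.
rewrite dotDl !dotDr (dotC y x) -!nrm_sqr.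
by have := dot_le x y; nra.
Qed.

Lemma nrmB x y : nrm (x - y) <= nrm x + nrm y.
Proof. by rewrite -(nrmN y) nrmD. Qed.

Lemma dot_delta (i : 'I_n) x : dot (delta_mx i 0) x = x i 0.
Proof.
rewrite /dot (bigD1 i) //= big1 => [|j ji]; rewrite !mxE ?eqxx ?mul1r ?addr0 //.
by rewrite (negPf ji) mul0r.
Qed.

(* The norm carried by the library on matrices is the max norm. *)
Definition opnorm_le M (b : R) := forall x y, dot x (M *m y) <= b * (nrm x * nrm y).

Lemma opnorm_leW M b c : b <= c -> opnorm_le M b -> opnorm_le M c.
Proof.
by move=> bc h x y; apply: le_trans (h x y) _; rewrite ler_wpM2r ?mulr_ge0 ?nrm_ge0.
Qed.

Lemma opnorm_leD M M' b b' : opnorm_le M b -> opnorm_le M' b' ->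
  opnorm_le (M + M') (b + b').
Proof. by move=> h h' x y; rewrite mulmxDl dotDr mulrDl lerD. Qed.

Lemma opnorm_leN M b : opnorm_le M b -> opnorm_le (- M) b.
Proof. by move=> h x y; rewrite mulNmx dotNr -dotNl -(nrmN x). Qed.

Lemma opnorm_leB M M' b b' : opnorm_le M b -> opnorm_le M' b' ->
  opnorm_le (M - M') (b + b').
Proof. by move=> h /opnorm_leN; exact: opnorm_leD. Qed.

Lemma opnorm_leZ M b (a : R) : 0 <= a -> opnorm_le M b -> opnorm_le (a *: M) (a * b).
Proof. by move=> a0 h x y; rewrite -scalemxAl dotZr -mulrA ler_wpM2l. Qed.

Lemma opnorm_le_ball M b :
  (forall x y, dot x x <= 1 -> dot y y <= 1 -> dot x (M *m y) <= b) -> opnorm_le M b.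
Proof.
move=> M_le x y.
have [/nrm_eq0 ->|x0] := eqVneq (nrm x) 0; first by rewrite dot0l nrm0 mul0r mulr0.
have [/nrm_eq0 ->|y0] := eqVneq (nrm y) 0; first by rewrite mulmx0 dot0r nrm0 !mulr0.
have unit z : nrm z != 0 -> dot ((nrm z)^-1 *: z) ((nrm z)^-1 *: z) <= 1.
  by move=> z0; rewrite dotZl dotZr -nrm_sqr mulrA -expr2 -exprMn mulVf ?expr1n.
have := M_le _ _ (unit x x0) (unit y y0).
rewrite dotZl -scalemxAr dotZr mulrA -invfM mulrC ler_pdivrMr //.
by rewrite lt_neqAle mulr_ge0 ?nrm_ge0 // eq_sym mulf_neq0.
Qed.

Lemma opnorm_leT M b : opnorm_le M b -> opnorm_le M^T b.
Proof. by move=> h x y; rewrite dot_mulmx trmxK dotC [_ * nrm y]mulrC. Qed.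

Lemma opnorm_le_nrm M b x : 0 <= b -> opnorm_le M b -> nrm (M *m x) <= b * nrm x.
Proof.
move=> b0 h; have [e|ne] := eqVneq (nrm (M *m x)) 0.
  by rewrite e mulr_ge0 ?nrm_ge0.
have := h (M *m x) x; rewrite -nrm_sqr expr2 mulrCA ler_pM2l //.
by rewrite lt_neqAle nrm_ge0 eq_sym ne.
Qed.

Lemma opnorm_leM M M' b b' : 0 <= b -> 0 <= b' ->
  opnorm_le M b -> opnorm_le M' b' -> opnorm_le (M *m M') (b * b').
Proof.
move=> b0 b0' h h' x y; rewrite -mulmxA dot_mulmx.
apply: le_trans (dot_le _ _) _; rewrite mulrACA.
by rewrite ler_pM ?nrm_ge0 ?opnorm_le_nrm //; exact: opnorm_leT.
Qed.

Lemma opnorm_le_outer x y (a b : R) : nrm x <= a -> nrm y <= b ->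
  opnorm_le (x *m y^T) (a * b).
Proof.
move=> xa yb z t; rewrite mulmx_outer dotZr.
apply: le_trans (ler_norm _) _; rewrite normrM.
apply: le_trans (ler_pM (normr_ge0 _) (normr_ge0 _) (dot_abs _ _) (dot_abs _ _)) _.
have -> : nrm y * nrm t * (nrm z * nrm x) = (nrm x * nrm y) * (nrm z * nrm t).
  by ring.
by rewrite ler_wpM2r ?mulr_ge0 ?nrm_ge0 // ler_pM ?nrm_ge0.
Qed.

Lemma dot_row M y (i : 'I_n) : (M *m y) i 0 = dot (row i M)^T y.
Proof. by rewrite mxE; apply: eq_bigr => j _; rewrite !mxE. Qed.

Lemma opnorm_le_frob M (b : R) : 0 <= b ->
  \sum_i dot (row i M)^T (row i M)^T <= b ^+ 2 -> opnorm_le M b.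
Proof.
move=> b0 h x y; apply: le_trans (dot_le _ _) _.
rewrite mulrCA ler_wpM2l ?nrm_ge0 //; apply: nrm_le.
  by rewrite mulr_ge0 ?nrm_ge0.
rewrite exprMn nrm_sqr; apply: le_trans (ler_wpM2r (dot_ge0 _) h).
rewrite mulr_suml; apply: ler_sum => i _.
by rewrite -expr2 dot_row dot_sqr_le.
Qed.

Lemma opnorm_le_entries M (b : R) : (forall i j, `|M i j| <= b / n%:R) -> opnorm_le M b.
Proof.
move=> h.
have [n0|n0] := posnP n.
  have e (F : 'I_n -> R) : \sum_i F i = 0.
    by apply: big1 => i; have := ltn_ord i; rewrite [X in (_ < X)%N]n0.
  by move=> x y; rewrite /nrm /dot !e sqrtr0 !mulr0.
have n0R : 0 < n%:R :> R by rewrite ltr0n.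
have b0 : 0 <= b.
  have := le_trans (normr_ge0 _) (h (Ordinal n0) (Ordinal n0)).
  by rewrite pmulr_lge0 // invr_gt0.
apply: opnorm_le_frob => //.
have -> : b ^+ 2 = \sum_(i < n) \sum_(j < n) (b / n%:R) ^+ 2.
  rewrite !sumr_const !card_ord -[X in X *+ n]mulr_natr -mulr_natr.
  by field; rewrite gt_eqF.
apply: ler_sum => i _; apply: ler_sum => j _; rewrite !mxE -expr2.
by rewrite -real_normK ?num_real // ler_sqr // nnegrE ?divr_ge0 // ler0n.
Qed.

Lemma opnorm_le_diag (v : 'rV[R]_n) (b : R) : (forall i, `|v 0 i| <= b) -> 0 <= b ->
  opnorm_le (diag_mx v) b.
Proof.
move=> h b0 x y; apply: le_trans (dot_le _ _) _.
rewrite mulrCA ler_wpM2l ?nrm_ge0 //; apply: nrm_le.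
  by rewrite mulr_ge0 ?nrm_ge0.
rewrite exprMn nrm_sqr mulr_sumr; apply: ler_sum => i _.
rewrite mul_diag_mx !mxE -!expr2 exprMn ler_wpM2r ?sqr_ge0 //.
by rewrite -real_normK ?num_real // ler_sqr // nnegrE.
Qed.

End Dot.

(** The supremum of [f] satisfies [sup <= q * sup + K]. The a priori bound [S0] only makes this
    supremum finite, so it may depend on the dimension without entering the conclusion. *)
Lemma self_improving_bound (R : realType) (I : Type) (D : I -> Prop) (f : I -> R)
    (q K S0 : R) : q < 1 ->
  (forall i, D i -> f i <= S0) ->
  (forall S, (forall i, D i -> f i <= S) -> forall i, D i -> f i <= q * S + K) ->
  forall i, D i -> f i <= K / (1 - q).
Proof.
move=> q1 f_le step i Di.
pose V := [set f j | j in [set j | D j]]%classic.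
have Vub : has_ubound V by exists S0 => _ [j Dj <-]; exact: f_le.
have V0 : (V !=set0)%classic by exists (f i); exists i.
have f_sup j : D j -> f j <= sup V by move=> Dj; apply: ub_le_sup => //; exists j.
have sup_le : sup V <= q * sup V + K.
  by apply: ge_sup => // _ [j Dj <-]; exact: step f_sup j Dj.
apply: le_trans (f_sup i Di) _.
by rewrite ler_pdivlMr; lra.
Qed.

(** * A lattice net of the unit ball *)

Section Net.
Context {R : realType} {n : nat}.

(* sign and modulus of each coordinate; zero is represented twice *)
Definition lattice_index := {ffun 'I_n -> bool * 'I_(4 * n).+1}.

Definition lattice_point (k : lattice_index) : 'cV[R]_n :=
  \col_i ((-1) ^+ (k i).1 * ((k i).2 : nat)%:R / (4 * Num.sqrt n%:R)).

Definition in_net (k : lattice_index) : bool :=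
  dot (lattice_point k) (lattice_point k) <= 1.

Hypothesis n0 : (0 < n)%N.

Let nR : 1 <= n%:R :> R. Proof. by rewrite ler1n. Qed.
Let s0 : 0 < Num.sqrt n%:R :> R.
Proof. by rewrite sqrtr_gt0; apply: lt_le_trans nR. Qed.
Let s2 : Num.sqrt n%:R ^+ 2 = n%:R :> R.
Proof. by rewrite sqr_sqrtr // (le_trans _ nR). Qed.
Let sn : Num.sqrt n%:R <= n%:R :> R.
Proof. by have := s2; have := s0; have := nR; nra. Qed.

(** Coordinates are rounded towards zero, so the lattice point stays in the unit ball. Each
    coordinate moves by at most 1 / (4 sqrt n), hence the vector by at most 1/4. *)
Lemma lattice_rounding (x : 'cV[R]_n) : dot x x <= 1 ->
  exists2 k, in_net k & dot (4 *: (x - lattice_point k)) (4 *: (x - lattice_point k))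
    <= 1.
Proof.
move=> x1.
have xi i : `|x i 0| <= 1.
  rewrite -(@expr_le1 _ 2) // real_normK ?num_real //; apply: le_trans x1.
  rewrite /dot (bigD1 i) //= -expr2 lerDl sumr_ge0 // => j _.
  by rewrite -expr2 sqr_ge0.
pose m i := Num.truncn (4 * Num.sqrt n%:R * `|x i 0|).
have mP i : (m i)%:R <= 4 * Num.sqrt n%:R * `|x i 0| < (m i).+1%:R.
  by apply: truncn_itv; rewrite !mulr_ge0 // ltW.
have m_lt i : (m i < (4 * n).+1)%N.
  rewrite ltnS -(ler_nat R) natrM; apply: le_trans (andP (mP i)).1 _.
  have := xi i; have := normr_ge0 (x i 0); have := s0; have := sn; nra.
pose k : lattice_index := [ffun i => (x i 0 < 0, Ordinal (m_lt i))].
have key i : `|lattice_point k i 0| <= `|x i 0| /\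
   `|4 * (x i 0 - lattice_point k i 0)| <= (Num.sqrt n%:R)^-1.
  rewrite mxE ffunE /=.
  have sgx : x i 0 = (-1) ^+ (x i 0 < 0)%R * `|x i 0|.
    case: ltP => h; last by rewrite expr0 mul1r ger0_norm.
    by rewrite expr1 ltr0_norm // mulN1r opprK.
  have p4 : 0 < 4 * Num.sqrt n%:R :> R by rewrite mulr_gt0.
  have c4 := ltW p4; have c0 := ltW s0.
  have [h1 h2] := andP (mP i).
  split.
    rewrite -mulrA normrM normr_sign mul1r ger0_norm ?divr_ge0 //.
    by rewrite ler_pdivrMr // mulrC.
  rewrite {1}sgx -mulrA -mulrBr normrM normrM normr_sign mul1r ger0_norm //.
  rewrite ger0_norm; last by rewrite subr_ge0 ler_pdivrMr // mulrC.
  rewrite -[leRHS]mul1r ler_pdivlMr //.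
  rewrite mulrBr mulrBl.
  have -> : 4 * ((m i)%:R / (4 * Num.sqrt n%:R)) * Num.sqrt n%:R = (m i)%:R :> R.
    by field; rewrite gt_eqF.
  move: h2; rewrite -natr1; lra.
exists k.
  apply: le_trans x1; apply: ler_sum => i _; rewrite -!expr2.
  have [h _] := key i.
  rewrite -[leLHS]real_normK ?num_real // -[leRHS]real_normK ?num_real //.
  by rewrite ler_sqr ?nnegrE.
have e1 : 1 = \sum_(i < n) (n%:R)^-1 :> R.
  by rewrite sumr_const card_ord -[_ *+ n]mulr_natr mulVf // gt_eqF // (lt_le_trans _ nR).
rewrite [leRHS]e1; apply: ler_sum => i _; rewrite -expr2.
have [_ h] := key i.
rewrite -[leLHS]real_normK ?num_real // -s2 -exprVn ler_sqr ?nnegrE //.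
by move: h; rewrite !mxE.
Qed.

(** Rounding both arguments leaves two remainders of norm at most 1/4, so the supremum S of the
    bilinear form on the ball satisfies S <= S/4 + S/4 + a. *)
Lemma net_opnorm_le (M : 'M[R]_n) (a : R) :
  (forall k l, in_net k -> in_net l ->
     dot (lattice_point k) (M *m lattice_point l) <= a) ->
  opnorm_le M (2 * a).
Proof.
move=> M_le.
pose f (z : 'cV[R]_n * 'cV[R]_n) := dot z.1 (M *m z.2).
pose D (z : 'cV[R]_n * 'cV[R]_n) := dot z.1 z.1 <= 1 /\ dot z.2 z.2 <= 1.
have ball (z : 'cV[R]_n) : dot z z <= 1 -> nrm z <= 1.
  by move=> h; apply: nrm_le; rewrite // expr1n.
have f_le z : D z -> f z <= n%:R * \sum_i \sum_j `|M i j|.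
  move=> [z1 z2].
  have MB : opnorm_le M (n%:R * \sum_i \sum_j `|M i j|).
    apply: opnorm_le_entries => i j; rewrite mulrAC divff ?mul1r; last first.
      by rewrite gt_eqF // (lt_le_trans _ nR).
    rewrite (bigD1 i) //= (bigD1 j) //= -addrA lerDl addr_ge0 //.
      by apply: sumr_ge0.
    by apply: sumr_ge0 => ? _; apply: sumr_ge0.
  apply: le_trans (MB _ _) _; rewrite -[leRHS]mulr1 ler_wpM2l //.
    by rewrite mulr_ge0 // sumr_ge0 // => ? _; rewrite sumr_ge0.
  by rewrite mulr_ile1 ?nrm_ge0 ?ball.
have step S : (forall z, D z -> f z <= S) -> forall z, D z -> f z <= 2^-1 * S + a.
  move=> fS [x y] [/= x1 y1]; rewrite /f /=.
  have [k ck kx] := lattice_rounding x1.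
  have [l cl ly] := lattice_rounding y1.
  have h1 := fS (4 *: (x - lattice_point k), y) (conj kx y1).
  have h2 := fS (lattice_point k, 4 *: (y - lattice_point l)) (conj ck ly).
  have h3 := M_le _ _ ck cl.
  move: h1 h2; rewrite /f /= dotZl -scalemxAr dotZr dotBl mulmxBr dotBr.
  lra.
have f_le2 z (Dz : D z) : f z <= 2 * a.
  have q1 : 2^-1 < 1 :> R by rewrite invf_lt1 // ltr1n.
  have := self_improving_bound q1 f_le step Dz.
  by have -> : a / (1 - 2^-1) = 2 * a by field.
by apply: opnorm_le_ball => x y x1 y1; exact: (f_le2 (x, y)).
Qed.

Lemma expR1_ge2 : 2 <= expR 1 :> R.
Proof. by have := @expR_ge1Dx R 1; lra. Qed.

(** Counting by an exponential weight: the moduli m_i of a net point satisfy sum m_i <= sum m_i^2 <=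
    16 n, so the count is at most exp(16 n) times the sum of exp(- sum m_i) over all lattice points.
    The latter factorizes, and one coordinate contributes at most 2 * 2 <= exp 2, the first 2 being
    for the sign. *)
Lemma card_net : #|[set k | in_net k]%SET|%:R <= expR (18 * n%:R) :> R.
Proof.
have in_net_sum k : in_net k -> \sum_i ((k i).2 : nat)%:R ^+ 2 <= 16 * n%:R :> R.
  rewrite /in_net /dot => h.
  have -> : \sum_i ((k i).2 : nat)%:R ^+ 2 =
      16 * n%:R * \sum_i lattice_point k i 0 * lattice_point k i 0.
    rewrite mulr_sumr; apply: eq_bigr => i _; rewrite mxE.
    have alg (u v s m : R) : u ^+ 2 = 1 -> s != 0 -> s ^+ 2 = m ->
        v ^+ 2 = 16 * m * (u * v / (4 * s) * (u * v / (4 * s))).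
      by move=> u1 ? <-; transitivity (u ^+ 2 * v ^+ 2); [by rewrite u1 mul1r | field].
    by apply: alg; rewrite ?sqrr_sign // gt_eqF.
  by rewrite -[leRHS]mulr1 ler_wpM2l // mulr_ge0 // (le_trans _ nR).
pose g (b : bool * 'I_(4 * n).+1) : R := expR (- ((b.2 : nat)%:R)).
have sum_g : \sum_b g b <= expR 2.
  have e1 : expR (-1) <= 2^-1 :> R.
    by rewrite expRN lef_pV2 ?posrE ?expR_gt0 // expR1_ge2.
  have -> : \sum_b g b = 2 * \sum_(j < (4 * n).+1) expR (-1) ^+ j.
    rewrite (eq_bigr (fun b => g (b.1, b.2))) => [|[] //].
    rewrite -(pair_bigA _ (fun a j => g (a, j))) /= big_bool /= -mulr2n mulr_natl.
    by congr (_ *+ 2); apply: eq_bigr => j _; rewrite /g /= -expRM_natl mulrN1.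
  have geo m (q : R) : 0 <= q <= 2^-1 -> \sum_(j < m) q ^+ j <= 2.
    move=> /andP[q0 q2].
    have := subrX1 q m; have := exprn_ge0 m q0.
    set S := \sum_(j < m) _; nra.
  have h2 : 4 <= expR 2 :> R.
    have -> : expR 2 = expR 1 ^+ 2 :> R by rewrite -expRM_natl mulr1.
    by have := expR1_ge2; nra.
  have := geo (4 * n).+1 (expR (-1)); rewrite expR_ge0 e1 => /(_ isT); lra.
rewrite -sum1_card natr_sum.
apply: (@le_trans _ _ (\sum_(k : lattice_index) expR (16 * n%:R) * \prod_i g (k i))).
  rewrite [leLHS]big_mkcond; apply: ler_sum => k _.
  case: ifP => [|_]; last first.
    by rewrite mulr_ge0 ?expR_ge0 // prodr_ge0 // => i _; rewrite expR_ge0.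
  rewrite inE => /in_net_sum h.
  rewrite -expR_sum -expRD -[leLHS]expR0 ler_expR sumrN subr_ge0.
  apply: le_trans h; apply: ler_sum => i _.
  by rewrite -natrX ler_nat -mulnn; case: (nat_of_ord _) => // j; rewrite leq_pmulr.
rewrite -mulr_sumr -(bigA_distr_bigA (fun (_ : 'I_n) b => g b)) /=.
rewrite prodr_const card_ord.
have -> : 18 * n%:R = 16 * n%:R + n%:R * 2 :> R by ring.
rewrite expRD ler_wpM2l ?expR_ge0 // expRM_natl.
by apply: lerXn2r => //; rewrite nnegrE ?expR_ge0 // sumr_ge0 // => b _; rewrite expR_ge0.
Qed.

End Net.

(* The exponent [37] is twice the [18] of [card_net], plus one. *)
Lemma net_union_bound (R : realType) (n : nat) (I : finType) (w : I -> R)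
    (M : I -> 'M[R]_n) (G : pred I) (K : R) : (0 < n)%N ->
  (forall i, 0 <= w i) ->
  (forall x y : 'cV[R]_n, dot x x <= 1 -> dot y y <= 1 ->
    \sum_(i | G i) w i * expR (Num.sqrt n%:R * dot x (M i *m y)) <= expR (K * n%:R)) ->
  \sum_(i | G i && ~~ `[< opnorm_le (M i) (2 * ((K + 37) * Num.sqrt n%:R)) >]) w i
    <= expR (- n%:R).
Proof.
move=> n0 w0 chernoff.
pose e i (k l : @lattice_index n) :=
  expR (Num.sqrt n%:R * dot (lattice_point k) (M i *m lattice_point l)).
have s2 : Num.sqrt n%:R * Num.sqrt n%:R = n%:R :> R by rewrite -expr2 sqr_sqrtr.
have s0 : 0 <= Num.sqrt n%:R :> R by exact: sqrtr_ge0.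
(* Markov's inequality with tilt sqrt n: a bad outcome violates the threshold at some pair of net
   points, and the term of that pair alone dominates its weight. *)
apply: (@le_trans _ _ (\sum_(k | in_net (R := R) k) \sum_(l | in_net (R := R) l)
   \sum_(i | G i) expR (- ((K + 37) * n%:R)) * (w i * e i k l))).
  under [leRHS]eq_bigr do rewrite exchange_big.
  rewrite exchange_big /= big_mkcondr /=; apply: ler_sum => i Gi.
  case: ifPn => [bad|_]; last first.
    by do 2!(apply: sumr_ge0 => ? _); rewrite !mulr_ge0 ?expR_ge0.
  have [k [l [ck cl kl]]] : exists k l, [/\ in_net (R := R) k, in_net (R := R) l &
      (K + 37) * Num.sqrt n%:R < dot (lattice_point k) (M i *m lattice_point l)].
    apply: contrapT => no; move/asboolPn: bad; apply;
      apply: net_opnorm_le => // k l ck cl.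
    by rewrite leNgt; apply/negP => kl; apply: no; exists k, l.
  rewrite (bigD1 k) //= (bigD1 l) //= -addrA.
  apply: (@le_trans _ _ (expR (- ((K + 37) * n%:R)) * (w i * e i k l))).
    rewrite mulrCA -[leLHS]mulr1 ler_wpM2l // -expRD -[leLHS]expR0 ler_expR.
    by have := ler_wpM2l s0 (ltW kl); rewrite mulrCA s2; lra.
  rewrite lerDl addr_ge0 //; last first.
    by do 2!(apply: sumr_ge0 => ? _); rewrite !mulr_ge0 ?expR_ge0.
  by apply: sumr_ge0 => ? _; rewrite !mulr_ge0 ?expR_ge0.
apply: (@le_trans _ _ (\sum_(k | in_net (R := R) k)
    \sum_(l | in_net (R := R) l) expR (- (37 * n%:R)))).
  apply: ler_sum => k ck; apply: ler_sum => l cl.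
  rewrite -mulr_sumr.
  have -> : - (37 * n%:R) = - ((K + 37) * n%:R) + K * n%:R :> R by ring.
  by rewrite expRD ler_wpM2l ?expR_ge0 // chernoff.
under eq_bigr do rewrite sumr_const.
rewrite sumr_const -mulrnA -[leLHS]mulr_natr natrM.
have := card_net (R := R) n0; rewrite cardsE => h.
apply: (@le_trans _ _ (expR (- (37 * n%:R)) * (expR (18 * n%:R) * expR (18 * n%:R)))).
  rewrite ler_wpM2l ?expR_ge0 // ler_pM //.
rewrite -!expRD ler_expR; lra.
Qed.

(** * Leading singular vectors *)

Lemma continuous_big_sum (R : realType) (T : topologicalType) (I : Type)
    (r : seq I) (F : I -> T -> R) :
  (forall i, continuous (F i)) -> continuous (fun t => \sum_(i <- r) F i t).
Proof.
move=> cF; elim: r => [|i r IH].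
  under [X in continuous X]eq_fun do rewrite big_nil; exact: cst_continuous.
under [X in continuous X]eq_fun do rewrite big_cons.
by move=> t; apply: continuousD; [exact: cF|exact: IH].
Qed.

(** Variational construction: the vector maximizes |S x|^2 over the compact unit sphere, and the
    eigenvector equation is the first-order condition at the maximum. *)
Lemma top_singular_vector (R : realType) (n : nat) (S : 'M[R]_n) : (0 < n)%N ->
  exists x, [/\ dot x x = 1,
    forall y, dot (S *m y) (S *m y) <= dot (S *m x) (S *m x) * dot y y
    & S^T *m (S *m x) = dot (S *m x) (S *m x) *: x].
Proof.
move=> n0.
have cc (j : 'I_n) : continuous (fun v : 'rV[R]_n => v 0 j).
  exact: coord_continuous.
pose q (v : 'rV[R]_n) : R := \sum_j v 0 j * v 0 j.
have cq : continuous q.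
  by apply: continuous_big_sum => j v; apply: continuousM; exact: cc.
pose f (v : 'rV[R]_n) := dot (S *m v^T) (S *m v^T).
have cf : continuous f.
  apply: continuous_big_sum => i.
  have ci : continuous (fun v : 'rV[R]_n => (S *m v^T) i 0).
    under [X in continuous X]eq_fun do rewrite mxE.
    apply: continuous_big_sum => j v; under eq_fun do rewrite mxE.
    by apply: continuousM; [exact: cst_continuous|exact: cc].
  by move=> v; apply: continuousM; exact: ci.
pose A := [set v : 'rV[R]_n | q v = 1].
have qdot (v : 'rV[R]_n) : q v = dot v^T v^T.
  by apply: eq_bigr => i _; rewrite !mxE.
have A0 : A !=set0.
  exists (delta_mx 0 (Ordinal n0)); rewrite /A /= /q (bigD1 (Ordinal n0)) //=.
  rewrite big1 => [|j j0]; rewrite !mxE !eqxx /= ?mulr1 ?addr0 //.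
  by rewrite (negPf j0) mulr0.
have cA : compact A.
  apply: bounded_closed_compact; last first.
    exact: (@preimage_closed _ _ q [set 1] (fun x _ => cq x) (@closed_eq _ 1)).
  exists 1; split; first exact: num_real.
  move=> M M1 v /= Av; rewrite [leLHS]/Num.norm /= mx_normrE.
  apply: bigmax_le => [|[i j] _ /=]; first by rewrite (le_trans _ (ltW M1)).
  apply: le_trans (ltW M1); rewrite ord1.
  rewrite -(@expr_le1 _ 2) // real_normK ?num_real // -Av /q (bigD1 j) //= -expr2.
  by rewrite lerDl sumr_ge0 // => k _; rewrite -expr2 sqr_ge0.
have [c cA1 cmax] := EVT_max_rV A0 cA (continuous_subspaceT cf).
have c1 : dot c^T c^T = 1 by rewrite -qdot; move: cA1; rewrite inE.
set x := c^T in c1; set L := dot (S *m x) (S *m x).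
have maxL y : dot (S *m y) (S *m y) <= L * dot y y.
  have [y0|y0] := eqVneq (dot y y) 0.
    by rewrite (dot_eq0 y0) mulmx0 !dot0r mulr0.
  have y1 : 0 < dot y y by rewrite lt_neqAle eq_sym y0 dot_ge0.
  have := cmax ((nrm y)^-1 *: y)^T; rewrite inE /A /= qdot trmxK.
  have ny : nrm y != 0 by apply: contra_neq y0 => h; rewrite -nrm_sqr h expr0n.
  rewrite dotZl dotZr -nrm_sqr mulrA -expr2 -exprMn mulVf // expr1n => /(_ erefl).
  rewrite /f trmxK -scalemxAr dotZl dotZr mulrA -expr2 exprVn mulrC ler_pdivrMr.
    by rewrite nrm_sqr.
  by rewrite nrm_sqr.
exists x; split => //.
apply/eqP; rewrite -subr_eq0; apply/eqP.
have [z zE] : exists z, z = S^T *m (S *m x) - L *: x by eexists.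
rewrite -/L -zE.
(* The maximizer is compared with its perturbation in the direction of the residual [z]; the linear
   coefficient is then |z|^2 up to a factor. *)
have tq t : 2 * t * dot z z + t ^+ 2 * (dot (S *m z) (S *m z) - L * dot z z) <= 0.
  have := maxL (x + t *: z).
  rewrite mulmxDr -scalemxAr !(dotDl, dotDr, dotZl, dotZr) c1 -/L.
  have zz : dot z z = dot (S *m z) (S *m x) - L * dot z x.
    by rewrite {2}zE dotBr dotZr dot_mulmx trmxK //.
  rewrite (dotC (S *m x)) (dotC x) => h.
  move: h; nra.
apply: dot_eq0; apply/eqP; rewrite eq_le dot_ge0 andbT leNgt; apply/negP => b0.
set b := dot z z in b0 tq; set e := (_ - _) in tq.
have k0 : 0 < `|e| + 1 by rewrite ltr_pwDr.
(* A step this small lets the linear term beat the quadratic one, whatever the sign of [e]. *)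
have := tq (b / (`|e| + 1)).
have -> : 2 * (b / (`|e| + 1)) * b + (b / (`|e| + 1)) ^+ 2 * e
   = (b / (`|e| + 1)) ^+ 2 * (2 * (`|e| + 1) + e).
  by field; rewrite gt_eqF.
apply/negP; rewrite -ltNge mulr_gt0 ?exprn_gt0 ?divr_gt0 //.
by have := ler_norm (- e); rewrite normrN; have := normr_ge0 e; lra.
Qed.

(** The definition of a leading vector compares singular triples only. The maximizer of the previous
    lemma completes to a triple whose value is the operator norm, so the leading value dominates
    it. *)
Lemma leading_singular_value (R : realType) (n : nat) (S : 'M[R]_n) v :
  (0 < n)%N -> leading_right_singular_vector S v ->
  exists s u, singular_triple S s u v /\ forall y, nrm (S *m y) <= s * nrm y.
Proof.
move=> n0 [s [u [[s0 u1 v1 e1 e2] s_max]]]; exists s, u; split => // y.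
have [x [x1 xmax xeig]] := top_singular_vector S n0.
set L := dot _ _ in xmax xeig.
have L0 : 0 <= L by exact: dot_ge0.
have dotE (z : 'cV[R]_n) : dot z z = \sum_i z i 0 ^+ 2.
  by apply: eq_bigr => i _; rewrite expr2.
suff h : Num.sqrt L <= s.
  apply: le_trans (ler_wpM2r (nrm_ge0 _) h).
  apply: nrm_le; first by rewrite mulr_ge0 ?sqrtr_ge0 ?nrm_ge0.
  by rewrite exprMn (sqr_sqrtr L0) nrm_sqr.
have [->|Ln] := eqVneq L 0; first by rewrite sqrtr0.
have Lp : 0 < Num.sqrt L by rewrite sqrtr_gt0 lt_neqAle eq_sym Ln.
have sL := sqr_sqrtr L0.
apply: (s_max _ ((Num.sqrt L)^-1 *: (S *m x)) x); split.
- exact: sqrtr_ge0.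
- by rewrite /unit_vector -dotE dotZl dotZr -/L mulrA -expr2 exprVn sL mulVf.
- rewrite /unit_vector -dotE; exact: x1.
- by rewrite scalerA mulfV ?scale1r // gt_eqF.
- rewrite -scalemxAr xeig scalerA -[in X in _ * X]sL expr2 mulrA mulVf ?mul1r //.
  by rewrite gt_eqF.
Qed.

(** * Recovering communities from a perturbed signal *)

Section Clustering.
Context {R : realType} {n : nat}.
Implicit Types (Q : {set 'I_n}) (v r : 'cV[R]_n).

Definition sgn_mx Q : 'cV[R]_n := \col_i (-1) ^+ (i \notin Q).

Lemma sgn_mx_in Q i : i \in Q -> sgn_mx Q i 0 = 1.
Proof. by move=> iQ; rewrite mxE iQ expr0. Qed.

Lemma sgn_mx_out Q i : i \notin Q -> sgn_mx Q i 0 = -1.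
Proof. by move=> iQ; rewrite mxE iQ expr1. Qed.

Lemma sgn_mx_setC Q : sgn_mx (~: Q) = - sgn_mx Q.
Proof.
apply/colP => i; rewrite !mxE inE negbK.
by case: (i \in Q); rewrite /= expr0 expr1 ?opprK.
Qed.

Definition mis (Q Q' : {set 'I_n}) : nat := #|Q' :&: ~: Q| + #|~: Q' :&: Q|.

Lemma mis_setC Q Q' : mis (~: Q) (~: Q') = mis Q Q'.
Proof. by rewrite /mis !finset.setCK addnC. Qed.

Hypothesis n0 : (0 < n)%N.
Let nR : 0 < n%:R :> R. Proof. by rewrite ltr0n. Qed.

Lemma card_setCR Q : #|~: Q|%:R = n%:R - #|Q|%:R :> R.
Proof.
have -> : n%:R = (#|Q| + #|~: Q|)%:R :> R by rewrite cardsC card_ord.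
by rewrite natrD addrAC subrr add0r.
Qed.

Lemma sum_sgn_mx Q : \sum_i sgn_mx Q i 0 = #|Q|%:R - #|~: Q|%:R.
Proof.
rewrite (bigID (mem Q)) /= (eq_bigr (fun=> 1)) => [|i /sgn_mx_in //].
rewrite [X in _ + X](eq_bigr (fun=> -1)) => [|i /sgn_mx_out //].
rewrite !sumr_const mulNrn; congr (_%:R - _%:R).
by apply: eq_card => i; rewrite !inE.
Qed.

Lemma above_meanZ (c : R) v : 0 < c -> above_mean (c *: v) = above_mean v.
Proof.
move=> c0; apply/setP => i; rewrite !inE !mxE.
under eq_bigr do rewrite mxE.
by rewrite -mulr_sumr mulrCA ler_pM2l.
Qed.

(** Subtracting the mean removes [c]. Since the mean of the signs lies in [-(1 - k), 1 - k], a
    misclassified coordinate forces the centred [r] to be at least g k there; a Chebyshev count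
    finishes, as centring does not increase the norm of [r]. *)
Lemma mis_above_mean Q (g c k : R) v r :
  0 < g -> 0 <= k -> k / 2 * n%:R <= #|Q|%:R -> k / 2 * n%:R <= #|~: Q|%:R ->
  v = g *: sgn_mx Q + const_mx c + r ->
  (mis Q (above_mean v))%:R * (g * k) ^+ 2 <= dot r r.
Proof.
move=> g0 k0 hQ hQc vE.
pose m := n%:R^-1 * \sum_j r j 0.
pose s := n%:R^-1 * \sum_j sgn_mx Q j 0.
have card_Q := card_setCR Q.
have s1 : s <= 1 - k.
  rewrite /s mulrC ler_pdivrMr // sum_sgn_mx; lra.
have s2 : - (1 - k) <= s.
  rewrite /s mulrC ler_pdivlMr // sum_sgn_mx; lra.
have vi i : v i 0 = g * sgn_mx Q i 0 + c + r i 0.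
  by rewrite vE !colDE colZE [const_mx c i 0]mxE.
have meanE : n%:R^-1 * \sum_j v j 0 = g * s + c + m.
  rewrite /s /m; under eq_bigr do rewrite vi.
  rewrite !big_split /= -mulr_sumr sumr_const card_ord -[_ *+ n]mulr_natr.
  by field; rewrite gt_eqF.
have bad i : i \in (above_mean v :&: ~: Q) :|: (~: above_mean v :&: Q) ->
    (g * k) ^+ 2 <= (r i 0 - m) ^+ 2.
  rewrite !inE meanE vi => /orP[/andP[h iQ]|/andP[h iQ]].
    rewrite sgn_mx_out // in h.
    have h2 : g * k <= r i 0 - m by nra.
    by rewrite ler_sqr // nnegrE; nra.
  rewrite -ltNge sgn_mx_in // in h.
  have h2 : g * k <= m - r i 0 by nra.
  by rewrite -[leRHS]sqrrN opprB ler_sqr // nnegrE; nra.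
have misE : mis Q (above_mean v) = #|(above_mean v :&: ~: Q) :|: (~: above_mean v :&: Q)|.
  have e0 : above_mean v :&: ~: Q :&: (~: above_mean v :&: Q) = finset.set0.
    by apply/setP => i; rewrite !inE; case: (i \in Q); rewrite ?andbF.
  by rewrite cardsU e0 cards0 subn0.
rewrite misE -sum1_card natr_sum mulr_suml.
apply: (@le_trans _ _ (\sum_i (r i 0 - m) ^+ 2)).
  rewrite big_mkcond /=; apply: ler_sum => i _; case: ifP => [/bad|_].
    by rewrite mul1r.
  exact: sqr_ge0.
have -> : \sum_i (r i 0 - m) ^+ 2 = dot r r - n%:R * m ^+ 2.
  have rm : \sum_j r j 0 = n%:R * m by rewrite /m mulrA mulfV ?mul1r // gt_eqF.
  rewrite (eq_bigr (fun i => r i 0 * r i 0 + (- (2 * m)) * r i 0 + m ^+ 2)) => [|i _];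
    last by ring.
  by rewrite !big_split /= -mulr_sumr sumr_const card_ord rm -mulr_natl /dot; ring.
by rewrite gerBl mulr_ge0 ?sqr_ge0 // ltW.
Qed.

(** The misclassified part of [Q'] is at most a quarter of it, since [Q'] has at least k n / 4
    elements; each such element lowers the signal from g to - g, which costs g / 2 on average. The
    term 2 e / k is Cauchy-Schwarz for [r] against the indicator of [Q']. *)
Lemma average_ge (Q Q' : {set 'I_n}) (g c k e : R) v r :
  0 <= g -> 0 < k <= 1 -> 0 <= e ->
  k / 2 * n%:R <= #|Q|%:R -> (mis Q Q')%:R <= k / 16 * n%:R ->
  nrm r <= e * Num.sqrt n%:R ->
  v = g *: sgn_mx Q + const_mx c + r ->
  g / 2 + c - 2 * e / k <= average Q' v.
Proof.
move=> g0 /andP[k0 k1] e0 hQ hmis hr vE.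
have hM : #|Q' :&: ~: Q|%:R <= k / 16 * n%:R :> R.
  by apply: le_trans hmis; rewrite ler_nat leq_addr.
have hQ' : k / 4 * n%:R <= #|Q'|%:R.
  have h1 : (#|Q| <= #|Q'| + mis Q Q')%N.
    rewrite -(cardsID Q' Q) leq_add ?subset_leq_card ?finset.subsetIr //.
    by rewrite (leq_trans _ (leq_addl _ _)) // finset.setDE finset.setIC.
  have := mulr_gt0 k0 nR; move: h1; rewrite -(ler_nat R) natrD; lra.
have q0 : 0 < #|Q'|%:R :> R by apply: lt_le_trans hQ'; rewrite !mulr_gt0 // invr_gt0.
rewrite /average ler_pdivlMl // [leLHS]mulrC.
have -> : \sum_(i in Q') v i 0 = (g + c) * #|Q'|%:R - 2 * g * #|Q' :&: ~: Q|%:R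
    + \sum_(i in Q') r i 0.
  have -> : \sum_(i in Q') v i 0 = \sum_(i in Q') (g * sgn_mx Q i 0 + c)
     + \sum_(i in Q') r i 0.
    rewrite -big_split; apply: eq_bigr => i _.
    by rewrite vE !colDE colZE [const_mx c i 0]mxE.
  congr (_ + _).
  rewrite (bigID (mem Q)) /= (eq_bigr (fun=> g + c)); last first.
    by move=> i /andP[_ iQ]; rewrite sgn_mx_in // mulr1.
  rewrite [X in _ + X](eq_bigr (fun=> - g + c)); last first.
    by move=> i /andP[_ iQ]; rewrite sgn_mx_out // mulrN1.
  have -> : #|Q'|%:R = #|Q' :&: Q|%:R + #|Q' :&: ~: Q|%:R :> R.
    by rewrite -(cardsID Q Q') natrD finset.setDE.
  rewrite !sumr_const.
  have -> : #|[pred i | (i \in Q') && (i \in Q)]| = #|Q' :&: Q|.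
    by apply: eq_card => i; rewrite !inE.
  have -> : #|[pred i | (i \in Q') && (i \notin Q)]| = #|Q' :&: ~: Q|.
    by apply: eq_card => i; rewrite !inE.
  rewrite -[_ *+ #|_ :&: Q|]mulr_natr -[_ *+ #|_ :&: ~: Q|]mulr_natr.
  ring.
have hr2 : - (2 * e / k * #|Q'|%:R) <= \sum_(i in Q') r i 0.
  pose d : 'cV[R]_n := \col_i ((i \in Q')%:R).
  have dr : \sum_(i in Q') r i 0 = dot d r.
    rewrite /dot big_mkcond; apply: eq_bigr => i _; rewrite mxE.
    by case: (i \in Q'); rewrite ?mul1r ?mul0r.
  have dd : dot d d = #|Q'|%:R.
    rewrite /dot -sum1_card natr_sum [RHS]big_mkcond; apply: eq_bigr => i _; rewrite mxE.
    by case: (i \in Q'); rewrite ?mul1r ?mul0r.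
  have := dot_abs d r; rewrite -dr ler_norml => /andP[+ _]; apply: le_trans.
  rewrite lerN2; apply: le_trans (ler_wpM2l (nrm_ge0 _) hr) _.
  have sq : Num.sqrt n%:R <= 2 / k * nrm d.
    rewrite -ler_sqr ?nnegrE ?mulr_ge0 ?sqrtr_ge0 ?nrm_ge0 ?invr_ge0 ?(ltW k0) //.
    rewrite exprMn nrm_sqr dd sqr_sqrtr ?(ltW nR) // expr_div_n.
    rewrite mulrAC ler_pdivlMr ?exprn_gt0 //; nra.
  rewrite mulrCA -dd -nrm_sqr.
  have -> : 2 * e / k * nrm d ^+ 2 = e * (nrm d * (2 / k * nrm d)) by ring.
  by rewrite ler_wpM2l // ler_wpM2l ?nrm_ge0.
have hM2 : 2 * g * #|Q' :&: ~: Q|%:R <= g / 2 * #|Q'|%:R.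
  by have : #|Q' :&: ~: Q|%:R <= #|Q'|%:R / 4 :> R by [lra]; nra.
lra.
Qed.

(** [average_ge] is applied to [v] on [Q'] and to [- v] on the complement; the constants [c] cancel
    in the sum and g - 4 e / k > 0 remains. *)
Lemma average_sign (Q Q' : {set 'I_n}) (g c k e : R) v r :
  0 < k <= 1 -> 0 <= e -> 4 * e / k < g ->
  k / 2 * n%:R <= #|Q|%:R -> k / 2 * n%:R <= #|~: Q|%:R ->
  (mis Q Q')%:R <= k / 16 * n%:R ->
  nrm r <= e * Num.sqrt n%:R ->
  v = g *: sgn_mx Q + const_mx c + r ->
  average (~: Q') v < average Q' v.
Proof.
move=> k01 e0 ge hQ hQc hmis hr vE.
have g0 : 0 <= g.
  by apply: le_trans (ltW ge); rewrite divr_ge0 ?mulr_ge0 //; case/andP: k01 => /ltW.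
have h1 := average_ge g0 k01 e0 hQ hmis hr vE.
have hmisC : (mis (~: Q) (~: Q'))%:R <= k / 16 * n%:R by rewrite mis_setC.
have hrN : nrm (- r) <= e * Num.sqrt n%:R by rewrite nrmN.
have vN : - v = g *: sgn_mx (~: Q) + const_mx (- c) - r.
  by rewrite sgn_mx_setC scalerN vE !opprD raddfN.
have h2 := average_ge g0 k01 e0 hQc hmisC hrN vN.
have avN : average (~: Q') (- v) = - average (~: Q') v.
  by rewrite /average -mulrN -sumrN; congr (_ * _); apply: eq_bigr => i _; rewrite mxE.
rewrite avN in h2; lra.
Qed.

End Clustering.

(** * Recovery from the leading right singular vector *)

Section Recovery.
Context {R : realType} {n : nat}.

Definition ones : 'cV[R]_n := const_mx 1.

Definition signal (P : {set 'I_n}) (b d : R) : 'cV[R]_n := b *: ones + d *: sgn_mx P.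

Hypothesis n0 : (0 < n)%N.
Let nR : 0 < n%:R :> R. Proof. by rewrite ltr0n. Qed.

Lemma nrm_ones : nrm ones = Num.sqrt n%:R.
Proof.
by rewrite /nrm /dot; congr Num.sqrt; rewrite (eq_bigr (fun=> 1)) ?sumr_const
  ?card_ord // => i _; rewrite !mxE mulr1.
Qed.

Lemma nrm_sgn (P : {set 'I_n}) : nrm (sgn_mx P) = Num.sqrt n%:R :> R.
Proof.
rewrite /nrm /dot; congr Num.sqrt; rewrite (eq_bigr (fun=> 1)) ?sumr_const ?card_ord //.
by move=> i _; rewrite !mxE -expr2 sqrr_sign.
Qed.

Lemma signalZ (P : {set 'I_n}) (c b d : R) : c *: signal P b d = (c * d) *: sgn_mx P
  + const_mx (c * b).
Proof. by apply/colP => i; rewrite !mxE; ring. Qed.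

Lemma nrm_signal_le (P : {set 'I_n}) (b d C : R) : 0 <= d <= 1 -> `|b| <= C ->
  nrm (signal P b d) <= (C + 1) * Num.sqrt n%:R.
Proof.
move=> /andP[d0 d1] bC; apply: le_trans (nrmD _ _) _.
rewrite !nrmZ nrm_ones nrm_sgn -mulrDl ler_wpM2r ?sqrtr_ge0 // lerD //.
by rewrite ger0_norm.
Qed.

(** The signal takes the values b + d and b - d on the two communities, each of size at least k n /
    2. They cannot both be small, so the bound does not depend on b. *)
Lemma nrm_signal_ge (P : {set 'I_n}) (b d k : R) : 0 <= d -> 0 <= k <= 1 ->
  k / 2 * n%:R <= #|P|%:R -> k / 2 * n%:R <= #|~: P|%:R ->
  d * k * Num.sqrt n%:R <= nrm (signal P b d).
Proof.
move=> d0 /andP[k0 k1] hP hPc.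
rewrite -ler_sqr ?nnegrE ?mulr_ge0 ?sqrtr_ge0 ?nrm_ge0 //.
rewrite nrm_sqr exprMn sqr_sqrtr ?(ltW nR) //.
have -> : dot (signal P b d) (signal P b d) =
   (b ^+ 2 + d ^+ 2) * n%:R + 2 * b * d * (#|P|%:R - #|~: P|%:R).
  have -> : n%:R = \sum_(i < n) 1 :> R by rewrite sumr_const card_ord.
  rewrite -sum_sgn_mx /dot !mulr_sumr -big_split; apply: eq_bigr => i _ /=.
  rewrite /signal colDE !colZE /ones [const_mx 1 i 0]mxE.
  have : sgn_mx P i 0 ^+ 2 = 1 :> R by rewrite mxE sqrr_sign.
  set s := sgn_mx _ _ _ => s2; ring: s2.
have cE := card_setCR (R := R) P.
have e1 : (b ^+ 2 + d ^+ 2) * n%:R + 2 * b * d * (#|P|%:R - #|~: P|%:R) =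
   (b + d) ^+ 2 * #|P|%:R + (b - d) ^+ 2 * #|~: P|%:R :> R by rewrite cE; ring.
rewrite e1.
have h1 := ler_wpM2l (sqr_ge0 (b + d)) hP.
have h2 := ler_wpM2l (sqr_ge0 (b - d)) hPc.
have h3 : (d * k) ^+ 2 * n%:R <= (b ^+ 2 + d ^+ 2) * (k * n%:R).
  rewrite mulrA ler_wpM2r ?(ltW nR) // exprMn.
  have kk : k ^+ 2 <= k by rewrite expr2 ler_piMl.
  have := mulr_ge0 (sqr_ge0 b) k0; have := ler_wpM2l (sqr_ge0 d) kk; lra.
lra.
Qed.

(** For the leading triple, s v is g times the signal plus an error of norm at most e. The lower
    bound on s forces |g| to be of order 1 / sqrt n, and [mis_above_mean] counts the errors. The
    sign of g is unknown: the last hypothesis keeps the count small enough for [average_sign], by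
    which the comparison of averages restores the orientation. *)
Lemma spectral_recovery (P : {set 'I_n}) (T : nat) (x : nat -> 'cV[R]_n)
    (v : 'cV[R]_n) (a b d k e C : R) (E : 'M[R]_n) :
  0 < a <= 1 -> 0 < d <= 1 -> 0 < k <= 1 -> `|b| <= C -> 0 <= e ->
  k / 2 * n%:R <= #|P|%:R -> k / 2 * n%:R <= #|~: P|%:R ->
  Sigmahat T x = (a / n%:R) *: (ones *m (signal P b d)^T) + E -> opnorm_le E e ->
  leading_right_singular_vector (Sigmahat T x) v ->
  8 * e <= a * d * k ->
  (2 * (C + 1) / (a * (d * k) ^+ 2) * e) ^+ 2 <= k / 16 ->
  misclassification_rate P (spectral_plus T x v) (spectral_minus T x v)
    <= (2 * (C + 1) / (a * (d * k) ^+ 2) * e) ^+ 2.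
Proof.
move=> /andP[a0 a1] /andP[d0 d1] k01 bC e0 hP hPc SE hE lead e_small e_small2.
have /andP[k0 k1] := k01.
set S := Sigmahat T x in SE lead; set K := (_ ^+ 2) in e_small2 *.
set h := signal P b d in SE.
have C0 : 0 <= C by apply: le_trans bC.
have sn : 0 < Num.sqrt n%:R :> R by rewrite sqrtr_gt0.
have sn2 : Num.sqrt n%:R ^+ 2 = n%:R :> R by rewrite sqr_sqrtr // ltW.
have hlo : d * k * Num.sqrt n%:R <= nrm h.
  by apply: nrm_signal_ge => //; [exact: ltW|rewrite k1 ltW].
have hhi : nrm h <= (C + 1) * Num.sqrt n%:R.
  by apply: nrm_signal_le => //; rewrite d1 ltW.
have dk : 0 < d * k by rewrite mulr_gt0.
have h0 : 0 < nrm h by apply: lt_le_trans hlo; rewrite mulr_gt0.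
have [s [u [[s0 u1 v1 e1 e2] s_ge]]] := leading_singular_value n0 lead.
have nu : nrm u = 1.
  by rewrite /nrm /dot -(sqrtr1 R) -u1; congr Num.sqrt; apply: eq_bigr => i _;
    rewrite expr2.
have nv : nrm v = 1.
  by rewrite /nrm /dot -(sqrtr1 R) -v1; congr Num.sqrt; apply: eq_bigr => i _;
    rewrite expr2.
(* The operator norm is tested on the signal [h] itself. *)
have s_lo : a * (d * k) - e <= s.
  have Sh : S *m h = (a / n%:R * nrm h ^+ 2) *: ones + E *m h.
    by rewrite SE mulmxDl -scalemxAl mulmx_outer scalerA nrm_sqr.
  have h1 : a / n%:R * nrm h ^+ 2 * Num.sqrt n%:R <= s * nrm h + e * nrm h.
    have -> : a / n%:R * nrm h ^+ 2 * Num.sqrt n%:R = nrm (S *m h - E *m h).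
      rewrite Sh addrK nrmZ nrm_ones ger0_norm //.
      by rewrite mulr_ge0 ?sqr_ge0 // divr_ge0 // ltW.
    by apply: le_trans (nrmB _ _) _; rewrite lerD // opnorm_le_nrm.
  have h2 : a * (d * k) * nrm h <= a / n%:R * nrm h ^+ 2 * Num.sqrt n%:R.
    have -> : a / n%:R * nrm h ^+ 2 * Num.sqrt n%:R =
       a * nrm h * (nrm h / Num.sqrt n%:R).
      by rewrite -[in n%:R^-1]sn2; field; rewrite gt_eqF.
    rewrite mulrAC ler_wpM2l ?mulr_ge0 ?(ltW a0) ?(ltW h0) //.
    by rewrite ler_pdivlMr.
  have := le_trans h2 h1; rewrite -mulrDl ler_pM2r //; lra.
have [g [r [svE nr]]] : exists g r, s *: v = g *: h + r /\ nrm r <= e.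
  exists (a / n%:R * dot ones u), (E^T *m u); split; last first.
    by apply: le_trans (opnorm_le_nrm _ e0 (opnorm_leT hE)) _; rewrite nu mulr1.
  by rewrite -e2 SE linearD linearZ /= trmx_mul trmxK mulmxDl -scalemxAl mulmx_outer
    scalerA.
have g_lo : a * (d * k) / 2 <= `|g| * ((C + 1) * Num.sqrt n%:R).
  have h1 : s <= `|g| * nrm h + e.
    have -> : s = nrm (s *: v) by rewrite nrmZ nv mulr1 ger0_norm.
    by rewrite svE (le_trans (nrmD _ _)) // nrmZ lerD2l.
  have h2 := ler_wpM2l (normr_ge0 g) hhi.
  have : 2 * e <= a * (d * k) / 2 by lra.
  lra.
have adk : 0 < a * (d * k) by rewrite mulr_gt0.
have g0 : 0 < `|g|.
  rewrite -(@pmulr_lgt0 _ ((C + 1) * Num.sqrt n%:R));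
    last by rewrite mulr_gt0 // ltr_wpDl.
  by apply: lt_le_trans g_lo; rewrite divr_gt0.
have s_gt0 : 0 < s by lra.
(* Used with t = 1 or -1 and with [P] or its complement, so that the coefficient of the sign vector
   is always the positive number |g| d. *)
have mis_le (Q : {set 'I_n}) (t : R) (r' : 'cV[R]_n) :
  #|Q|%:R >= k / 2 * n%:R -> #|~: Q|%:R >= k / 2 * n%:R ->
    nrm r' <= e -> (t *: v : 'cV[R]_n) = s^-1 *: ((`|g| * d) *: sgn_mx Q
      + const_mx (t * g * b) + r') ->
    (mis Q (above_mean (t *: v)))%:R <= K * n%:R.
  move=> hQ hQc nr' tv; rewrite tv above_meanZ ?invr_gt0 //.
  have gd : 0 < `|g| * d by rewrite mulr_gt0.
  have := mis_above_mean n0 gd (ltW k0) hQ hQc erefl.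
  move=> /(_ (t * g * b) r') hm.
  have rr : dot r' r' <= e ^+ 2.
    by rewrite -nrm_sqr ler_sqr ?nnegrE ?nrm_ge0.
  have := le_trans hm rr.
  have gdk : 0 < `|g| * d * k by rewrite mulr_gt0.
  rewrite -ler_pdivlMr ?exprn_gt0 // => hm2; apply: le_trans hm2 _.
  rewrite -expr_div_n -sn2 /K -exprMn ler_sqr ?nnegrE; last 2 first.
  - by rewrite divr_ge0 // ltW.
  - rewrite mulr_ge0 ?(ltW sn) // mulr_ge0 // divr_ge0 //.
      by rewrite mulr_ge0 // addr_ge0.
    by rewrite mulr_ge0 ?exprn_ge0 // ltW.
  have -> : 2 * (C + 1) / (a * (d * k) ^+ 2) * e * Num.sqrt n%:R
     = e * ((C + 1) * Num.sqrt n%:R / (a * (d * k) / 2 * (d * k))).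
    by field; rewrite !gt_eqF.
  rewrite ler_wpM2l // -[leLHS]mul1r ler_pdivrMr // mulrAC ler_pdivlMr; last first.
    by rewrite mulr_gt0 // divr_gt0.
  rewrite mul1r.
  have := ler_wpM2r (ltW dk) g_lo; lra.
have agE : sigma_ag T x = (a * d) *: sgn_mx P + const_mx (a * b) + E^T *m ones.
  rewrite /sigma_ag -/S SE linearD linearZ /= trmx_mul trmxK mulmxDl -scalemxAl.
  rewrite mulmx_outer scalerA -signalZ; congr (_ *: _ + _).
  by rewrite -nrm_sqr nrm_ones sn2 divfK // gt_eqF.
have agr : nrm (E^T *m ones) <= e * Num.sqrt n%:R.
  by rewrite -nrm_ones opnorm_le_nrm //; exact: opnorm_leT.
have ke : 4 * e / k < a * d.
  rewrite ltr_pdivrMr //; lra.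
have vE : v = s^-1 *: (g *: h + r) by rewrite -svE scalerA mulVf ?scale1r // gt_eqF.
have KN : K * n%:R <= k / 16 * n%:R by rewrite ler_wpM2r // ltW.
suff hmis : (mis P (spectral_plus T x v))%:R <= K * n%:R.
  by rewrite /misclassification_rate /spectral_minus -/(mis P _) ler_pdivrMl // mulrC.
rewrite /spectral_plus /sigma_sp.
have [gp|gn] := ltP 0 g.
  have h1 : (mis P (above_mean v))%:R <= K * n%:R.
    rewrite -[v]scale1r; apply: (mis_le _ _ r) => //.
    by rewrite scale1r vE signalZ gtr0_norm // mul1r.
  rewrite ifT //; apply: ltW.
  exact: (average_sign n0 k01 e0 ke hP hPc (le_trans h1 KN) agr agE).
(* In this case [v] recovers the complement of [P]; the sign test must fail, and - v is used. *)
have gneg : `|g| = - g by rewrite ler0_norm.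
have h1 : (mis (~: P) (above_mean v))%:R <= K * n%:R.
  rewrite -[v]scale1r; apply: (mis_le _ _ r) => //; first by rewrite finset.setCK.
  rewrite scale1r {1}vE signalZ gneg mul1r sgn_mx_setC.
  by congr (_ *: (_ + _ + _)); rewrite scalerN -scaleNr mulNr opprK.
rewrite ifF; last first.
  apply/negbTE; rewrite -ltNge.
  have h2 : (mis P (~: above_mean v))%:R <= k / 16 * n%:R.
    by rewrite -mis_setC finset.setCK (le_trans h1).
  by have := average_sign n0 k01 e0 ke hP hPc h2 agr agE; rewrite finset.setCK.
rewrite -scaleN1r; apply: (mis_le _ _ (- r)) => //; first by rewrite nrmN.
rewrite scaleN1r {1}vE -scalerN opprD; congr (_ *: (_ - _)).
by rewrite -scaleNr signalZ gneg mulN1r.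
Qed.

End Recovery.

(** * Time averages and the linear recursion *)

Section TimeAverage.
Context {R : realType} (T : nat).
Hypothesis T0 : (0 < T)%N.
Let TR : 0 < T%:R :> R. Proof. by rewrite ltr0n. Qed.

Definition tavg {V : lmodType R} (f : nat -> V) : V :=
  T%:R^-1 *: \sum_(1 <= t < T.+1) f t.

Definition tmean (f : nat -> R) : R := T%:R^-1 * \sum_(1 <= t < T.+1) f t.

Lemma eq_tavg (V : lmodType R) (f g : nat -> V) : f =1 g -> tavg f = tavg g.
Proof. by move=> fg; congr (_ *: _); apply: eq_bigr => t _; rewrite fg. Qed.

Lemma tavgD (V : lmodType R) (f g : nat -> V) :
  tavg (fun t => f t + g t) = tavg f + tavg g.
Proof. by rewrite /tavg big_split scalerDr. Qed.

Lemma tavgN (V : lmodType R) (f : nat -> V) : tavg (fun t => - f t) = - tavg f.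
Proof. by rewrite /tavg sumrN scalerN. Qed.

Lemma tavgB (V : lmodType R) (f g : nat -> V) :
  tavg (fun t => f t - g t) = tavg f - tavg g.
Proof. by rewrite tavgD tavgN. Qed.

Lemma tavg_const (V : lmodType R) (c : V) : tavg (fun=> c) = c.
Proof.
rewrite /tavg sumr_const_nat subSS subn0 -[c *+ T]scaler_nat scalerA mulVf ?scale1r //.
by rewrite gt_eqF.
Qed.

Lemma tavg_shift (V : lmodType R) (f : nat -> V) :
  tavg (fun t => f t.+1) = tavg f + T%:R^-1 *: (f T.+1 - f 1).
Proof.
rewrite /tavg -scalerDr -(telescope_sumr f (leqW T0 : (1 <= T.+1)%N)) sumrB.
by rewrite addrC subrK.
Qed.

Lemma ler_tmean (f g : nat -> R) : (forall t, f t <= g t) -> tmean f <= tmean g.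
Proof. by move=> fg; rewrite ler_wpM2l ?invr_ge0 ?(ltW TR) // ler_sum. Qed.

Lemma tmeanD (f g : nat -> R) : tmean (fun t => f t + g t) = tmean f + tmean g.
Proof. by rewrite /tmean big_split mulrDr. Qed.

Lemma tmeanZ (a : R) (f : nat -> R) : tmean (fun t => a * f t) = a * tmean f.
Proof. by rewrite /tmean -mulr_sumr mulrCA. Qed.

Lemma tmean_const (c : R) : tmean (fun=> c) = c.
Proof.
rewrite /tmean sumr_const_nat subSS subn0 -[c *+ T]mulr_natl mulrA mulVf ?mul1r //.
by rewrite gt_eqF.
Qed.

Lemma tmean_sqr_le (f : nat -> R) : tmean f ^+ 2 <= tmean (fun t => f t ^+ 2).
Proof.
have : tmean (fun=> 0) <= tmean (fun t => (f t - tmean f) ^+ 2).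
  by apply: ler_tmean => t; exact: sqr_ge0.
have -> : (fun t => (f t - tmean f) ^+ 2)
   = (fun t => f t ^+ 2 + (- (2 * tmean f) * f t + tmean f ^+ 2)).
  by apply: funext => t; ring.
rewrite !tmeanD tmeanZ !tmean_const; lra.
Qed.

Lemma tmean_sum (I : finType) (F : I -> nat -> R) :
  \sum_i tmean (F i) = tmean (fun t => \sum_i F i t).
Proof. by rewrite /tmean exchange_big /= mulr_sumr. Qed.

Variable n : nat.
Implicit Types (M A : 'M[R]_n).

Lemma dot_tavg y (f : nat -> 'cV[R]_n) :
  dot y (tavg f) = tmean (fun t => dot y (f t)).
Proof. by rewrite /tavg dotZr dot_sumr. Qed.

Lemma tavg_mulmxr (j k l : nat) (B : 'M[R]_(k, l)) (f : nat -> 'M[R]_(j, k)) :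
  tavg f *m B = tavg (fun t => f t *m B).
Proof. by rewrite /tavg -scalemxAl mulmx_suml. Qed.

Lemma tavg_mulmxl (j k l : nat) (B : 'M[R]_(j, k)) (f : nat -> 'M[R]_(k, l)) :
  B *m tavg f = tavg (fun t => B *m f t).
Proof. by rewrite /tavg -scalemxAr mulmx_sumr. Qed.

Lemma tavg_trmx (j k : nat) (f : nat -> 'M[R]_(j, k)) :
  (tavg f)^T = tavg (fun t => (f t)^T).
Proof. by rewrite /tavg linearZ linear_sum. Qed.

Lemma dot_tavg_outer x y (f g : nat -> 'cV[R]_n) :
  dot x (tavg (fun t => f t *m (g t)^T) *m y)
  = tmean (fun t => dot x (f t) * dot y (g t)).
Proof.
rewrite tavg_mulmxr dot_tavg; congr (_ * _); apply: eq_bigr => t _.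
by rewrite mulmx_outer dotZr mulrC (dotC (g t)).
Qed.

End TimeAverage.

Lemma outerE (R : realType) (n : nat) (u v : 'cV[R]_n) i j :
  (u *m v^T) i j = u i 0 * v j 0.
Proof. by rewrite mxE big_ord1 !mxE. Qed.

Lemma addmxE (R : realType) (k l : nat) (M N : 'M[R]_(k, l)) i j :
  (M + N) i j = M i j + N i j.
Proof. by rewrite mxE. Qed.

Lemma oppmxE (R : realType) (k l : nat) (M : 'M[R]_(k, l)) i j :
  (- M) i j = - M i j.
Proof. by rewrite mxE. Qed.

Section Dynamics.
Context {R : realType} (T n : nat).
Hypothesis T0 : (0 < T)%N.
Variables (x : nat -> 'cV[R]_n) (A : 'M[R]_n) (b z0 : 'cV[R]_n).

Local Notation avg := (tavg (R := R) T).
Local Notation m := (mhat T x).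

Definition innov t : 'cV[R]_n := x t.+1 - (b + A *m x t).
Local Notation xi := innov.
Definition shifted t : 'cV[R]_n := x t - z0.
Local Notation Z := shifted.
Definition centered t : 'cV[R]_n := x t - m.
Local Notation W := centered.
(** The defect of the empirical mean as a fixed point: the constant forcing term of the recursion
    once it is centred at [mhat]. *)
Definition drift : 'cV[R]_n := b + A *m m - m.
Local Notation c := drift.
Definition xibar : 'cV[R]_n := avg xi.
Definition cov0 : 'M[R]_n := avg (fun t => W t *m (W t)^T).
Definition cov_shifted : 'M[R]_n := avg (fun t => Z t *m (Z t)^T).
Definition cross : 'M[R]_n := avg (fun t => xi t *m (W t)^T).
Definition cross_shifted : 'M[R]_n := avg (fun t => xi t *m (Z t)^T).
Definition cov_innov : 'M[R]_n := avg (fun t => xi t *m (xi t)^T).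
Local Notation zbar := (m - z0).

Lemma avg_W : avg W = 0.
Proof. by rewrite /W tavgB tavg_const // subrr. Qed.

Lemma avg_Z : avg Z = zbar.
Proof. by rewrite /Z tavgB tavg_const. Qed.

Lemma W_step t : W t.+1 = A *m W t + xi t + c.
Proof.
rewrite /W /xi /c /drift /innov mulmxBr.
move: (A *m x t) (A *m m) m (x t) (x t.+1) => u v m0 x0 x1.
by apply/colP => i; rewrite !mxE; ring.
Qed.

(** Averaging [W_step] over time: the mean of [W] vanishes and the mean of the shifted [W] is a
    telescoping boundary term. *)
Lemma drift_eq : c = T%:R^-1 *: (x T.+1 - x 1%N) - xibar.
Proof.
have : avg (fun t => W t.+1) = xibar + c.
  by rewrite (eq_tavg _ W_step) 2!tavgD tavg_const // -tavg_mulmxl avg_W mulmx0 add0r.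
rewrite (tavg_shift T0 W) avg_W add0r => h.
have -> : x T.+1 - x 1%N = W T.+1 - W 1%N by rewrite /W opprB addrA subrK.
by rewrite h addrC addKr.
Qed.

Lemma cov_shifted_eq : cov0 = cov_shifted - zbar *m zbar^T.
Proof.
have e t : W t *m (W t)^T = Z t *m (Z t)^T - Z t *m zbar^T - zbar *m (Z t)^T + zbar
  *m zbar^T.
  have -> : W t = Z t - zbar by rewrite /W /Z opprB addrA subrK.
  move: (Z t) zbar => u v.
  by apply/matrixP => i j; rewrite !(outerE, addmxE, oppmxE); ring.
rewrite /cov0 (eq_tavg _ e) tavgD 2!tavgB tavg_const //.
rewrite -tavg_mulmxr avg_Z.
have -> : avg (fun t => zbar *m (Z t)^T) = zbar *m zbar^T.
  by rewrite -tavg_mulmxl -tavg_trmx avg_Z.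
by rewrite subrK.
Qed.

Lemma cross_eq : cross = cross_shifted - xibar *m zbar^T.
Proof.
have e t : xi t *m (W t)^T = xi t *m (Z t)^T - xi t *m zbar^T.
  have -> : W t = Z t - zbar by rewrite /W /Z opprB addrA subrK.
  by rewrite linearB /= mulmxBr.
by rewrite /cross (eq_tavg _ e) tavgB -tavg_mulmxr.
Qed.

Lemma Sigmahat_eq : Sigmahat T x = A *m cov0 + cross.
Proof.
have e t : W t.+1 *m (W t)^T = A *m (W t *m (W t)^T) + xi t *m (W t)^T + c *m (W t)^T.
  by rewrite W_step 2!mulmxDl mulmxA.
rewrite [LHS](eq_tavg _ e) 2!tavgD -tavg_mulmxl -tavg_mulmxl -tavg_trmx avg_W.
by rewrite trmx0 mulmx0 addr0.
Qed.

(** Empirical discrete Lyapunov equation. Products of [A *m W t] with the constant drift average to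
    zero because the mean of [W] is zero. *)
Lemma cov0_eq : cov0 + T%:R^-1 *: (W T.+1 *m (W T.+1)^T - W 1%N *m (W 1%N)^T) =
  A *m cov0 *m A^T + cov_innov + c *m c^T + A *m cross^T + cross *m A^T
  + c *m xibar^T + xibar *m c^T.
Proof.
rewrite {1}/cov0 -(tavg_shift T0 (fun t => W t *m (W t)^T)).
have e t : W t.+1 *m (W t.+1)^T =
   (A *m W t) *m (A *m W t)^T + xi t *m (xi t)^T + c *m c^T
   + (A *m W t) *m (xi t)^T + xi t *m (A *m W t)^T + c *m (xi t)^T + xi t *m c^T
   + (A *m W t) *m c^T + c *m (A *m W t)^T.
  rewrite W_step; move: (A *m W t) (xi t) c => u v w.
  by apply/matrixP => i j; rewrite !(outerE, addmxE, oppmxE); ring.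
rewrite (eq_tavg _ e) 8!tavgD tavg_const //.
have -> : avg (fun t => (A *m W t) *m (A *m W t)^T) = A *m cov0 *m A^T.
  rewrite /cov0 tavg_mulmxl tavg_mulmxr; apply: eq_tavg => t.
  by rewrite trmx_mul !mulmxA.
have -> : avg (fun t => (A *m W t) *m (xi t)^T) = A *m cross^T.
  rewrite /cross tavg_trmx tavg_mulmxl; apply: eq_tavg => t.
  by rewrite trmx_mul trmxK mulmxA.
have -> : avg (fun t => xi t *m (A *m W t)^T) = cross *m A^T.
  rewrite /cross tavg_mulmxr; apply: eq_tavg => t.
  by rewrite trmx_mul mulmxA.
have -> : avg (fun t => c *m (xi t)^T) = c *m xibar^T.
  by rewrite /xibar tavg_trmx tavg_mulmxl.
have -> : avg (fun t => xi t *m c^T) = xibar *m c^T.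
  by rewrite /xibar tavg_mulmxr.
have -> : avg (fun t => (A *m W t) *m c^T) = 0.
  by rewrite -tavg_mulmxr -tavg_mulmxl avg_W mulmx0 mul0mx.
have -> : avg (fun t => c *m (A *m W t)^T) = 0.
  by rewrite -tavg_mulmxl -tavg_trmx -tavg_mulmxl avg_W mulmx0 trmx0 mulmx0.
by rewrite !addr0.
Qed.

Lemma cov0_sym : cov0^T = cov0.
Proof.
by rewrite /cov0 tavg_trmx; apply: eq_tavg => t; rewrite trmx_mul trmxK.
Qed.

End Dynamics.

(* Fixed point of [S |-> q S + 2 (B^2 + B + 1) / (1 - q) + 1], the inequality that
   one step of the recursion yields for the supremum of the quadratic form
   [y |-> tmean (y . Z)^2] on the unit ball. *)
Definition cov_bound (R : realType) (q B : R) : R :=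
  (2 * (B ^+ 2 + B + 1) / (1 - q) + 1) / (1 - q).

(** * Deterministic bound on the error matrix *)

Section ErrorBound.
Context {R : realType} (T n : nat).
Hypotheses (T0 : (0 < T)%N) (n0 : (0 < n)%N) (nT : (n <= T)%N).
Let TR : 0 < T%:R :> R. Proof. by rewrite ltr0n. Qed.
Let nR : 0 < n%:R :> R. Proof. by rewrite ltr0n. Qed.
Variables (x : nat -> 'cV[R]_n) (A : 'M[R]_n) (b : 'cV[R]_n) (mb q B : R).
Local Notation eps := (Num.sqrt (n%:R / T%:R) : R).
Local Notation z0 := (mb *: ones).
Local Notation p t := (b + A *m x t).
Local Notation rho := (b + A *m z0 - z0).
Local Notation xi := (innov x A b).
Local Notation Z := (shifted x z0).
Local Notation g := (cov_bound q B).

(** Conditional variances of the Bernoulli coordinates given the past; their diagonal matrix is the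
    compensator of the outer product of the noise with itself. *)
Definition innov_var t : 'rV[R]_n := \row_i (p t i 0 * (1 - p t i 0)).
Definition mean_var : 'M[R]_n := tavg T (fun t => diag_mx (innov_var t)).

Hypotheses (q01 : 0 < q < 1) (B1 : 1 <= B) (mb01 : 0 <= mb <= 1).
Hypothesis x01 : forall t i, 0 <= x t i 0 <= 1.
Hypothesis p01 : forall t i, 0 <= p t i 0 <= 1.
Hypothesis hA : opnorm_le A q.
Hypothesis h_rho : nrm rho <= B.
Hypothesis h_var : opnorm_le (cov_innov T x A b - mean_var) (B * eps).

Lemma eps_ge0 : 0 <= eps. Proof. exact: sqrtr_ge0. Qed.

Lemma eps_sqr : eps ^+ 2 = n%:R / T%:R.
Proof. by rewrite sqr_sqrtr // divr_ge0 // ltW. Qed.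

Lemma eps_le1 : eps <= 1.
Proof.
by rewrite -[leRHS](sqrtr1 R) ler_wsqrtr // ler_pdivrMr // mul1r ler_nat.
Qed.

Lemma cov_bound_ge1 : 1 <= g.
Proof.
have /andP[q0 q1] := q01.
rewrite /cov_bound ler_pdivlMr ?subr_gt0 // mul1r.
have : 0 <= 2 * (B ^+ 2 + B + 1) / (1 - q); last lra.
rewrite divr_ge0 //; first by have := sqr_ge0 B; have := B1; lra.
by rewrite subr_ge0 ltW.
Qed.

Lemma innov_var01 t i : 0 <= innov_var t 0 i <= 1.
Proof. by rewrite mxE; have := p01 t i; nra. Qed.

Lemma opnorm_le_tavg (F : nat -> 'M[R]_n) (c : R) :
  (forall t, opnorm_le (F t) c) -> opnorm_le (tavg T F) c.
Proof.
move=> hF y z; rewrite tavg_mulmxr dot_tavg -(tmean_const T0 (c * _)).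
by apply: ler_tmean => // t; exact: hF.
Qed.

Lemma opnorm_le_mean_var : opnorm_le mean_var 1.
Proof.
apply: opnorm_le_tavg => t; apply: opnorm_le_diag => // i.
by have /andP[v0 v1] := innov_var01 t i; rewrite ger0_norm.
Qed.

Lemma tmean_xi_le y : tmean T (fun t => dot y (xi t) ^+ 2) <= (B + 1) * dot y y.
Proof.
have -> : tmean T (fun t => dot y (xi t) ^+ 2) = dot y (cov_innov T x A b *m y).
  by rewrite dot_tavg_outer; congr (_ * _); apply: eq_bigr => t _; rewrite expr2.
have := opnorm_leD h_var opnorm_le_mean_var; rewrite subrK => /(_ y y);
  rewrite -expr2 nrm_sqr => h.
apply: le_trans h _; rewrite ler_wpM2r ?dot_ge0 // lerD2r ler_piMr ?eps_le1 //.
exact: le_trans B1.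
Qed.

Lemma Z_step t : Z t.+1 = A *m Z t + rho + xi t.
Proof.
rewrite /shifted /innov mulmxBr; move: (A *m x t) (A *m z0) z0 => u v w.
by apply/colP => i; rewrite !mxE; ring.
Qed.

Lemma Z_nrm t : nrm (Z t) <= Num.sqrt n%:R.
Proof.
rewrite /nrm ler_wsqrtr // /dot.
have -> : n%:R = \sum_(i < n) 1 :> R by rewrite sumr_const card_ord.
apply: ler_sum => i _; rewrite /shifted colBE colZE [ones i 0]mxE.
by have := x01 t i; have := mb01; nra.
Qed.

(** Weighted so that the factor q^2 gained from the contraction is reduced to q, which is still
    below 1. *)
Lemma convex_sqr (u w : R) : (u + w) ^+ 2 <= q^-1 * u ^+ 2 + (1 - q)^-1 * w ^+ 2.
Proof.
have /andP[q0 q1] := q01; have q2 : 0 < 1 - q by rewrite subr_gt0.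
have -> : q^-1 * u ^+ 2 + (1 - q)^-1 * w ^+ 2 =
  (u + w) ^+ 2 + ((1 - q) * u - q * w) ^+ 2 / (q * (1 - q)).
  by field; rewrite !gt_eqF.
by rewrite lerDl divr_ge0 ?sqr_ge0 // mulr_ge0 // ltW.
Qed.

(** A bound free of the dimension, obtained from the self-improving inequality: one step of the
    recursion sends a bound S on the unit ball to q S plus a constant. *)
Lemma tmean_Z_le y : tmean T (fun t => dot y (Z t) ^+ 2) <= g * dot y y.
Proof.
have /andP[q0 q1] := q01; have q2 : 0 < 1 - q by rewrite subr_gt0.
pose f (y : 'cV[R]_n) := tmean T (fun t => dot y (Z t) ^+ 2).
have fZ (c : R) z : f (c *: z) = c ^+ 2 * f z.
  rewrite /f -tmeanZ; congr (_ * _); apply: eq_bigr => t _.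
  by rewrite dotZl exprMn.
have f_ball S z : (forall z, dot z z <= 1 -> f z <= S) -> f z <= S * dot z z.
  move=> fS; have [/nrm_eq0 ->|z_neq0] := eqVneq (nrm z) 0.
    by rewrite -(scale0r (0 : 'cV[R]_n)) fZ dotZl expr0n /= !mul0r mulr0.
  have := fS ((nrm z)^-1 *: z); rewrite fZ dotZl dotZr -nrm_sqr mulrA -expr2.
  rewrite -exprMn mulVf // expr1n lexx => /(_ isT).
  rewrite exprVn mulrC ler_pdivrMr //.
  by rewrite exprn_gt0 // lt_neqAle eq_sym z_neq0 nrm_ge0.
suff f1 : forall z, dot z z <= 1 -> f z <= g by exact: f_ball.
rewrite /cov_bound; apply: (self_improving_bound (D := fun z => dot z z <= 1) q1).
  (* The a priori bound is n, from |Z_t|^2 <= n. *)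
  move=> z z1; have : f z <= tmean T (fun=> n%:R); last exact.
  apply: ler_tmean => // t; apply: le_trans (dot_sqr_le _ _) _.
  rewrite -[leRHS]mul1r ler_pM ?dot_ge0 // -nrm_sqr.
  have : 0 <= nrm (Z t) <= Num.sqrt n%:R by rewrite nrm_ge0 Z_nrm.
  have := @sqr_sqrtr R n%:R (ltW nR); nra.
move=> S fS z z1.
have S0 : 0 <= S.
  have := fS 0; rewrite dot0l ler01 => /(_ isT); apply: le_trans.
  by rewrite -(scale0r (0 : 'cV[R]_n)) fZ expr0n mul0r.
(* Moving the window by one time unit costs at most n / T <= 1. *)
have shift : f z <= tmean T (fun t => dot z (Z t.+1) ^+ 2) + 1.
  have : f z + T%:R^-1 * (dot z (Z T.+1) ^+ 2 - dot z (Z 1%N) ^+ 2)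
     = tmean T (fun t => dot z (Z t.+1) ^+ 2).
    exact/esym/(@tavg_shift R T T0 R^o (fun t => dot z (Z t) ^+ 2)).
  move=> <-; rewrite mulrBr -addrA lerDl.
  have h1 : T%:R^-1 * dot z (Z 1%N) ^+ 2 <= 1.
    rewrite mulrC ler_pdivrMr // mul1r.
    apply: (@le_trans _ _ n%:R); last by rewrite ler_nat.
    apply: le_trans (dot_sqr_le _ _) _.
    rewrite -[leRHS]mul1r ler_pM ?dot_ge0 // -nrm_sqr.
    have : 0 <= nrm (Z 1%N) <= Num.sqrt n%:R by rewrite nrm_ge0 Z_nrm.
    have := @sqr_sqrtr R n%:R (ltW nR); nra.
  have h2 : 0 <= T%:R^-1 * dot z (Z T.+1) ^+ 2.
    by rewrite mulr_ge0 ?sqr_ge0 // invr_ge0 ltW.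
  lra.
have rz : dot z rho ^+ 2 <= B ^+ 2.
  apply: le_trans (dot_sqr_le _ _) _; rewrite -[leRHS]mul1r ler_pM ?dot_ge0 //.
  rewrite -nrm_sqr; have := nrm_ge0 rho; have := h_rho; nra.
have step t : dot z (Z t.+1) ^+ 2 <= q^-1 * dot (A^T *m z) (Z t) ^+ 2
    + (1 - q)^-1 * (2 * B ^+ 2 + 2 * dot z (xi t) ^+ 2).
  have -> : dot z (Z t.+1) = dot (A^T *m z) (Z t) + (dot z rho + dot z (xi t)).
    by rewrite Z_step 2!dotDr dot_mulmx addrA.
  apply: le_trans (convex_sqr _ _) _; rewrite lerD2l ler_wpM2l ?invr_ge0 ?(ltW q2) //.
  have := sqr_ge0 (dot z rho - dot z (xi t)); move: rz; lra.
have fA : f (A^T *m z) <= S * q ^+ 2.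
  apply: le_trans (f_ball _ _ fS) _; rewrite ler_wpM2l // -nrm_sqr.
  have h1 := opnorm_le_nrm z (ltW q0) (opnorm_leT hA).
  have h2 : nrm z <= 1 by apply: nrm_le; rewrite // expr1n.
  have h3 : nrm (A^T *m z) <= q by apply: le_trans h1 _; rewrite ler_piMr // ltW.
  by rewrite ler_sqr // nnegrE ?nrm_ge0 // ltW.
apply: le_trans shift _.
have h5 := ler_tmean T0 step.
rewrite tmeanD tmeanZ tmeanZ tmeanD tmean_const // tmeanZ -/(f _) in h5.
have h6 := tmean_xi_le z.
have h7 : q^-1 * f (A^T *m z) <= q * S.
  rewrite mulrC ler_pdivrMr //; lra.
have h8 : (1 - q)^-1 * (2 * B ^+ 2 + 2 * tmean T (fun t => dot z (xi t) ^+ 2))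
   <= 2 * (B ^+ 2 + B + 1) / (1 - q).
  rewrite mulrC ler_wpM2r ?invr_ge0 ?(ltW q2) //.
  have := dot_ge0 z; have := B1; nra.
lra.
Qed.

Lemma opnorm_le_cov_shifted : opnorm_le (cov_shifted T x z0) g.
Proof.
apply: opnorm_le_ball => y z y1 z1; rewrite dot_tavg_outer.
apply: (@le_trans _ _ (tmean T (fun t => 2^-1 * dot y (Z t) ^+ 2
  + 2^-1 * dot z (Z t) ^+ 2))).
  by apply: ler_tmean => // t; have := sqr_ge0 (dot y (Z t) - dot z (Z t)); lra.
rewrite tmeanD !tmeanZ.
have := tmean_Z_le y; have := tmean_Z_le z; have := cov_bound_ge1; nra.
Qed.


Variables (a B4 : R) (P : {set 'I_n}) (A' : 'M[R]_n).
Local Notation eta := ((Num.sqrt n%:R)^-1 : R).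
Local Notation d := (mb * (1 - mb)).
Local Notation c := (drift T x A b).
Local Notation W := (centered T x).
Local Notation m := (mhat T x).
Local Notation sg := (sgn_mx P).
Local Notation Sig := (cov0 T x).
Local Notation xb := (xibar T x A b).
Local Notation Cr := (cross T x A b).
Hypotheses (a01 : 0 < a <= 1) (B4_ge0 : 0 <= B4).
Hypothesis AE : A = (a / n%:R) *: (ones *m sg^T) + A'.
Hypothesis hA' : opnorm_le A' (B * eta).
Hypothesis hA_frob : \sum_i dot (row i A)^T (row i A)^T <= 1.
Hypothesis h_cross : opnorm_le (cross_shifted T x A b z0) (B4 * eps).
Hypothesis h_xibar : nrm xb <= B * eps.

Local Opaque cov_bound.

Let q0 : 0 <= q. Proof. by have /andP[/ltW] := q01. Qed.
Let q1 : q <= 1. Proof. by have /andP[_ /ltW] := q01. Qed.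
Let B0 : 0 <= B. Proof. exact: le_trans B1. Qed.
Let g1 : 1 <= g. Proof. exact: cov_bound_ge1. Qed.
Let g0 : 0 <= g. Proof. exact: le_trans g1. Qed.
Let e0 : 0 <= eps. Proof. exact: eps_ge0. Qed.
Let e1 : eps <= 1. Proof. exact: eps_le1. Qed.
Let sn : 0 < Num.sqrt n%:R :> R. Proof. by rewrite sqrtr_gt0. Qed.
Let s2 : Num.sqrt n%:R * Num.sqrt n%:R = n%:R :> R.
Proof. by rewrite -expr2 sqr_sqrtr // ltW. Qed.
Let eta0 : 0 <= eta. Proof. by rewrite invr_ge0 ltW. Qed.

(** With z the time mean of [Z], Jensen and [tmean_Z_le] in the direction z give |z|^4 <= g |z|^2;
    then |z|^2 <= g <= g^2. *)
Lemma zbar_le : nrm (m - z0) <= g.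
Proof.
set z := m - z0.
have h1 : dot z z ^+ 2 <= g * dot z z.
  have -> : dot z z = tmean T (fun t => dot z (Z t)).
    by rewrite -dot_tavg avg_Z.
  by apply: le_trans (tmean_sqr_le T0 _) _; have := tmean_Z_le z; rewrite -dot_tavg avg_Z.
have := dot_ge0 z; rewrite -nrm_sqr => h0.
apply: nrm_le => //; have [->|z1] := eqVneq (dot z z) 0; first exact: sqr_ge0.
have z2 : 0 < dot z z by rewrite lt_neqAle eq_sym z1 dot_ge0.
move: h1; rewrite expr2 ler_pM2r // => h1.
by apply: le_trans h1 _; rewrite expr2 ler_peMl.
Qed.

Lemma small_step : T%:R^-1 * Num.sqrt n%:R <= eps.
Proof.
have TT : 1 <= T%:R :> R by rewrite ler1n.
rewrite -ler_sqr ?nnegrE ?mulr_ge0 ?invr_ge0 ?(ltW TR) ?(ltW sn) //.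
rewrite exprMn eps_sqr sqr_sqrtr ?(ltW nR) // mulrC ler_wpM2l ?(ltW nR) //.
by rewrite expr2 ler_piMl ?invr_ge0 ?(ltW TR) // invf_le1.
Qed.

Lemma drift_le : nrm c <= (1 + B) * eps.
Proof.
rewrite drift_eq // mulrDl mul1r; apply: le_trans (nrmB _ _) _.
rewrite lerD // nrmZ ger0_norm ?invr_ge0 ?(ltW TR) //.
apply: le_trans small_step; rewrite ler_wpM2l ?invr_ge0 ?(ltW TR) //.
rewrite /nrm ler_wsqrtr // /dot.
have -> : n%:R = \sum_(i < n) 1 :> R by rewrite sumr_const card_ord.
apply: ler_sum => i _; rewrite colBE.
by have := x01 T.+1 i; have := x01 1%N i; nra.
Qed.

Lemma W_nrm t : nrm (W t) <= Num.sqrt n%:R.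
Proof.
rewrite /nrm ler_wsqrtr // /dot.
have -> : n%:R = \sum_(i < n) 1 :> R by rewrite sumr_const card_ord.
apply: ler_sum => i _; rewrite /centered colBE.
have m01 : 0 <= m i 0 <= 1.
  have -> : m i 0 = tmean T (fun t => x t i 0).
    by rewrite -dot_delta dot_tavg; congr (_ * _); apply: eq_bigr => k _;
      rewrite dot_delta.
  apply/andP; split; [rewrite -(tmean_const T0 0)|rewrite -(tmean_const T0 1)];
    by apply: ler_tmean => // k; have /andP[] := x01 k i.
by have := x01 t i; move: m01; nra.
Qed.

Lemma cross_le : opnorm_le Cr ((B4 + B * g) * eps).
Proof.
rewrite (cross_eq T x A b z0); have -> : (B4 + B * g) * eps = B4 * eps + B * eps * g
  by ring.
by apply: opnorm_leB => //; apply: opnorm_le_outer => //; exact: zbar_le.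
Qed.

Lemma cov0_le : opnorm_le Sig (g + g * g).
Proof.
rewrite (cov_shifted_eq T0 x z0); apply: opnorm_leB; first exact: opnorm_le_cov_shifted.
by apply: opnorm_le_outer; exact: zbar_le.
Qed.

(** The bound is of order 1, not sqrt n. Since u (1 - u) - m (1 - m) = (u - m)(1 - u - m), each
    coordinate is controlled by the deviation of its spiking probability from the mean-field value,
    which is A Z + rho. The Frobenius bound on A lets [tmean_Z_le] be applied row by row and
    summed. *)
Lemma var_sgn_le : nrm (mean_var *m sg - d *: sg) <= 2 * g + 2 * B ^+ 2 + 1.
Proof.
have c0 : 0 <= 2 * g + 2 * B ^+ 2 by have := sqr_ge0 B; have := g0; lra.
apply: nrm_le; first lra.
apply: (@le_trans _ _ (2 * g + 2 * B ^+ 2)); last by nra.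
have pE t : p t - z0 = A *m Z t + rho.
  rewrite /shifted mulmxBr; move: (A *m x t) (A *m z0) z0 => u v w.
  by apply/colP => i; rewrite !mxE; ring.
have yE i : (mean_var *m sg - d *: sg) i 0
  = tmean T (fun t => innov_var t 0 i - d) * sg i 0.
  rewrite colBE colZE -(dot_delta i (mean_var *m sg)) /mean_var tavg_mulmxr dot_tavg.
  have -> : tmean T (fun t => innov_var t 0 i - d)
    = tmean T (fun t => innov_var t 0 i) - d.
    by rewrite tmeanD tmean_const.
  rewrite mulrBl; congr (_ - _); rewrite mulrC -tmeanZ; congr (_ * _).
  by apply: eq_bigr => t _; rewrite dot_delta mul_diag_mx mxE mulrC [(\row__ _) _ _]mxE.
have y_le i : (mean_var *m sg - d *: sg) i 0 ^+ 2
    <= tmean T (fun t => (p t - z0) i 0 ^+ 2).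
  rewrite yE exprMn [sg i 0]mxE sqrr_sign mulr1.
  apply: le_trans (tmean_sqr_le T0 _) _; apply: ler_tmean => // t.
  rewrite mxE colBE colZE [ones i 0]mxE mulr1.
  have := p01 t i; move: (p t i 0) => u u01.
  have -> : u * (1 - u) - d = (u - mb) * (1 - u - mb) by ring.
  rewrite exprMn ler_piMr ?sqr_ge0 //.
  by have := mb01; move: u01; nra.
apply: (@le_trans _ _ (\sum_i tmean T (fun t => (p t - z0) i 0 ^+ 2))).
  by apply: ler_sum => i _; rewrite -expr2.
rewrite tmean_sum.
apply: (@le_trans _ _ (tmean T (fun t => 2 * dot (A *m Z t) (A *m Z t) + 2 * B ^+ 2))).
  apply: ler_tmean => // t.
  have -> : \sum_i (p t - z0) i 0 ^+ 2 = nrm (A *m Z t + rho) ^+ 2.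
    by rewrite nrm_sqr -pE; apply: eq_bigr => i _; rewrite expr2.
  have h1 := nrmD (A *m Z t) rho; rewrite -nrm_sqr.
  have := nrm_ge0 (A *m Z t + rho); have := nrm_ge0 rho; have := h_rho.
  have := nrm_ge0 (A *m Z t); move: h1.
  move: (nrm (_ + _)) (nrm rho) (nrm (A *m _)) => u v w h1 w0 vB v0 u0.
  have h2 : u ^+ 2 <= (w + v) ^+ 2 by rewrite ler_sqr ?nnegrE ?addr_ge0.
  have h3 : v ^+ 2 <= B ^+ 2 by rewrite ler_sqr ?nnegrE.
  have := sqr_ge0 (w - v); lra.
rewrite tmeanD tmean_const // lerD2r tmeanZ ler_wpM2l //.
have -> : tmean T (fun t => dot (A *m Z t) (A *m Z t)) =
   \sum_i tmean T (fun t => dot (row i A)^T (Z t) ^+ 2).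
  rewrite tmean_sum; congr (_ * _); apply: eq_bigr => t _.
  by apply: eq_bigr => i _; rewrite !dot_row expr2.
apply: (@le_trans _ _ (\sum_i g * dot (row i A)^T (row i A)^T)).
  by apply: ler_sum => i _; exact: tmean_Z_le.
by rewrite -mulr_sumr ler_piMr.
Qed.

(** The coefficient of the all-ones vector when the rank-one part of [A] acts on
    [Sig *m A^T *m sg]. *)
Definition beta : R := a / n%:R * dot sg (Sig *m (A^T *m sg)).

Lemma beta_le : `|beta| <= g + g * g.
Proof.
have /andP[a0 a1] := a01.
have an : 0 <= a / n%:R by rewrite divr_ge0 // ltW.
rewrite /beta normrM (ger0_norm an).
have gg : 0 <= g + g * g by rewrite addr_ge0 // mulr_ge0.
have h : `|dot sg (Sig *m (A^T *m sg))| <= (g + g * g) * n%:R.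
  apply: le_trans (dot_abs _ _) _; rewrite nrm_sgn.
  have h1 : nrm (Sig *m (A^T *m sg)) <= (g + g * g) * Num.sqrt n%:R.
    apply: le_trans (opnorm_le_nrm _ gg cov0_le) _; rewrite ler_wpM2l //.
    apply: le_trans (opnorm_le_nrm _ q0 (opnorm_leT hA)) _.
    by rewrite nrm_sgn ler_piMl // ltW.
  apply: le_trans (ler_wpM2l (ltW sn) h1) _.
  by rewrite mulrCA s2.
apply: le_trans (ler_wpM2l an h) _.
rewrite mulrCA divfK ?gt_eqF // ler_piMr //.
Qed.

(** One summand for each kind of term of the matrix [M] below, in the same order, followed by the
    bound of [var_sgn_le]. *)
Definition remainder_const : R :=
  B * (g + g * g) + B + (1 + B) * (1 + B) + 2 * (B4 + B * g) + 2 * ((1 + B) * B) + 2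
  + (2 * g + 2 * B ^+ 2 + 1).

(** In the Lyapunov equation applied to the sign vector, the rank-one part of the left factor [A]
    yields exactly [beta *: ones], and the mean variance yields d times the sign vector up to
    [var_sgn_le]. All other terms are small in operator norm and are collected in [M]. *)
Lemma remainder_le :
  nrm (Sig *m sg - signal P beta d) <= remainder_const * (eps + eta) * Num.sqrt n%:R.
Proof.
have /andP[a0 a1] := a01.
pose M := A' *m Sig *m A^T + (cov_innov T x A b - mean_var) + c *m c^T
  + A *m Cr^T + Cr *m A^T + c *m xb^T + xb *m c^T
  - T%:R^-1 *: (W T.+1 *m (W T.+1)^T - W 1%N *m (W 1%N)^T).
have RE : Sig *m sg - signal P beta d = M *m sg + (mean_var *m sg - d *: sg).
  have SE : Sig = (A *m Sig *m A^T - A' *m Sig *m A^T) + mean_var + M.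
    have := cov0_eq T0 x A b; rewrite /M.
    set U := _ *: (_ - _) => h.
    move/(canRL (addrK _)): h => h; rewrite [LHS]h {h};
      move: (A *m Sig *m A^T) (A' *m Sig *m A^T) (cov_innov _ _ _ _) mean_var U.
    move: (c *m c^T) (A *m Cr^T) (Cr *m A^T) (c *m xb^T) (xb
      *m c^T) => ? ? ? ? ? ? ? ? ? ?.
    by apply/matrixP => i j; rewrite !(addmxE, oppmxE); ring.
  have bE : (A *m Sig *m A^T - A' *m Sig *m A^T) *m sg = beta *: ones.
    rewrite -2!mulmxA -mulmxBl -2!mulmxA {1}AE addrK -scalemxAl mulmx_outer scalerA.
    by [].
  rewrite {1}SE 2!mulmxDl bE /signal.
  move: (M *m sg) (mean_var *m sg) => u v.
  by apply/colP => i; rewrite !mxE; ring.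
have ee : 0 <= eta by [].
have gg : 0 <= g + g * g by rewrite addr_ge0 // mulr_ge0.
have C4 : 0 <= (B4 + B * g) * eps by rewrite mulr_ge0 // addr_ge0 // mulr_ge0.
have hM : opnorm_le M (B * eta * (g + g * g) * q + B * eps
   + (1 + B) * eps * ((1 + B) * eps) + q * ((B4 + B * g) * eps)
   + (B4 + B * g) * eps * q + (1 + B) * eps * (B * eps) + B * eps * ((1 + B) * eps)
   + T%:R^-1 * (Num.sqrt n%:R * Num.sqrt n%:R + Num.sqrt n%:R * Num.sqrt n%:R)).
  apply: opnorm_leB; last first.
    apply: opnorm_leZ; first by rewrite invr_ge0 ltW.
    by apply: opnorm_leB; apply: opnorm_le_outer; exact: W_nrm.
  apply: opnorm_leD; last by apply: opnorm_le_outer => //; exact: drift_le.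
  apply: opnorm_leD; last by apply: opnorm_le_outer => //; exact: drift_le.
  apply: opnorm_leD; last by apply: opnorm_leM => //; [exact: cross_le|exact: opnorm_leT].
  apply: opnorm_leD; last by apply: opnorm_leM => //; apply: opnorm_leT; exact: cross_le.
  apply: opnorm_leD; last by apply: opnorm_le_outer => //; exact: drift_le.
  apply: opnorm_leD => //.
  apply: opnorm_leM => //; [by rewrite !mulr_ge0| |exact: opnorm_leT].
  by apply: opnorm_leM => //; [by rewrite mulr_ge0|exact: cov0_le].
have [K hK K_le] : exists2 K, opnorm_le M K &
    0 <= K <= (remainder_const - (2 * g + 2 * B ^+ 2 + 1)) * (eps + eta).
  exists (B * eta * (g + g * g) * 1 + B * eps
   + (1 + B) * eps * ((1 + B) * 1) + 1 * ((B4 + B * g) * eps)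
   + (B4 + B * g) * eps * 1 + (1 + B) * eps * (B * 1) + B * eps * ((1 + B) * 1)
   + (eps + eps)).
    apply: opnorm_leW hM.
    have n2 : T%:R^-1 * (Num.sqrt n%:R * Num.sqrt n%:R) <= eps.
      by rewrite s2 mulrC -[leLHS]eps_sqr expr2 ler_piMl.
    have B1' : 0 <= 1 + B by rewrite addr_ge0.
    apply: lerD; last by rewrite mulrDr lerD.
    by do !apply: lerD; rewrite ?ler_wpM2l ?ler_wpM2r ?mulr_ge0 // addr_ge0 // mulr_ge0.
  have h1 : 0 <= B * (g + g * g) * eta by rewrite !mulr_ge0.
  have h2 : 0 <= B * (g + g * g) * eps by rewrite !mulr_ge0.
  have h3 (r : R) : 0 <= r -> 0 <= r * eps /\ 0 <= r * eta.
    by move=> r0; rewrite !mulr_ge0.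
  have BB : 0 <= (1 + B) * (1 + B) by rewrite mulr_ge0 ?addr_ge0.
  have BB2 : 0 <= (1 + B) * B by rewrite mulr_ge0 ?addr_ge0.
  have BB3 : 0 <= B4 + B * g by rewrite addr_ge0 // mulr_ge0.
  have [? ?] := h3 _ BB; have [? ?] := h3 _ BB2; have [? ?] := h3 _ BB3.
  have [? ?] := h3 _ B0.
  rewrite /remainder_const; apply/andP; split; first by have := e0; lra.
  have := e0; have := eta0; lra.
rewrite RE; apply: le_trans (nrmD _ _) _.
have /andP[K0 K1] := K_le.
have h1 : nrm (M *m sg) <= (remainder_const - (2 * g + 2 * B ^+ 2 + 1)) * (eps
  + eta) * Num.sqrt n%:R.
  by apply: le_trans (opnorm_le_nrm _ K0 hK) _; rewrite nrm_sgn ler_wpM2r // ltW.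
(* A vector error of order 1 is charged to eta, since eta sqrt n = 1. *)
have h2 : 2 * g + 2 * B ^+ 2 + 1 <= (2 * g + 2 * B ^+ 2 + 1) * (eps
  + eta) * Num.sqrt n%:R.
  rewrite -mulrA ler_peMr //.
    by have := g0; have := sqr_ge0 B; lra.
  by rewrite mulrDl mulVf ?gt_eqF // lerDr mulr_ge0 // ltW.
have := var_sgn_le; lra.
Qed.

Definition error_const : R := B * (g + g * g) + (B4 + B * g) + remainder_const.

(** In [A *m Sig + cross] the rank-one part of [A] gives 1 (Sig sg)^T by symmetry of [Sig], and
    [remainder_le] replaces Sig sg by the signal. *)
Lemma spectral_error :
  exists2 E, Sigmahat T x = (a / n%:R) *: (ones *m (signal P beta d)^T) + E
    & opnorm_le E (error_const * (eps + eta)).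
Proof.
have /andP[a0 a1] := a01.
pose r := Sig *m sg - signal P beta d.
exists (A' *m Sig + Cr + (a / n%:R) *: (ones *m r^T)).
  rewrite (Sigmahat_eq T0 x A b); have -> : A *m Sig = (a / n%:R) *: (ones *m (Sig
    *m sg)^T) + A' *m Sig.
    by rewrite {1}AE mulmxDl -scalemxAl -mulmxA trmx_mul cov0_sym.
  have -> : Sig *m sg = signal P beta d + r by rewrite /r addrC subrK.
  rewrite linearD /= mulmxDr scalerDr.
  move: (_ *: _) (_ *: _) (A' *m _) Cr => ? ? ? ?.
  by apply/matrixP => i j; rewrite !(addmxE, oppmxE); ring.
have gg : 0 <= g + g * g by rewrite addr_ge0 // mulr_ge0.
have h1 : opnorm_le (A' *m Sig) (B * eta * (g + g * g)).
  by apply: opnorm_leM => //; [by rewrite mulr_ge0|exact: cov0_le].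
have h2 := opnorm_le_outer (lexx (nrm ones)) remainder_le.
have h3 := opnorm_leZ (divr_ge0 (ltW a0) (ltW nR)) h2.
apply: opnorm_leW (opnorm_leD (opnorm_leD h1 cross_le) h3).
rewrite nrm_ones.
have -> : a / n%:R * (Num.sqrt n%:R * (remainder_const * (eps + eta) * Num.sqrt n%:R))
   = a * (remainder_const * (eps + eta)).
  rewrite -[in n%:R^-1]s2; field; by rewrite gt_eqF.
have rc : 0 <= remainder_const.
  rewrite /remainder_const; have := g0; have := B0; have := B4_ge0; have := g1; nra.
have h4 : a * (remainder_const * (eps + eta)) <= remainder_const * (eps + eta).
  by rewrite ler_piMl // mulr_ge0 // addr_ge0.
have h5 : 0 <= B * (g + g * g) * eps by rewrite !mulr_ge0.
have h6 : 0 <= (B4 + B * g) * eta by rewrite mulr_ge0 // addr_ge0 // mulr_ge0.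
rewrite /error_const; lra.
Qed.

End ErrorBound.

(** * Exponential moments of Bernoulli noise *)

Section ExpBounds.
Context {R : realType}.
Implicit Types u s q : R.

Lemma expR_le_quadratic u : u <= 2^-1 -> expR u <= 1 + u + 2 * u ^+ 2.
Proof.
move=> u2; have u1 : 0 < 1 - u by lra.
have h : expR u * (1 - u) <= 1.
  have := @expR_ge1Dx R (- u); have := expR_gt0 u; have := expRxMexpNx_1 u; nra.
rewrite -ler_pdivlMr // in h; apply: le_trans h _.
rewrite ler_pdivrMr // ; have := sqr_ge0 u; nra.
Qed.

Lemma expR_le_taylor2 u : expR u <= 1 + u + 4 * (u ^+ 2 * expR `|u|).
Proof.
have e1 : 1 <= expR `|u| by rewrite -expR0 ler_expR.
have [h|h] := leP u 2^-1.
  apply: le_trans (expR_le_quadratic h) _; rewrite lerD2l.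
  by have := sqr_ge0 u; nra.
have -> : expR u = expR `|u| by rewrite ger0_norm //; lra.
have : 1 <= 4 * u ^+ 2 by nra.
nra.
Qed.

Lemma sqr_le_expR u : 0 <= u -> u ^+ 2 <= 4 * expR u.
Proof.
move=> u0; have -> : expR u = expR (u / 2) ^+ 2 by rewrite -expRM_natl; congr expR; field.
have := @expR_ge1Dx R (u / 2); nra.
Qed.

Lemma expR_half_le2 : expR 2^-1 <= 2 :> R.
Proof. by have := @expR_le_quadratic 2^-1 (lexx _); lra. Qed.

(** For |s| <= 1/2 the linear terms of the quadratic expansion cancel; for larger |s| both exponents
    are at most |s| <= 2 s^2. *)
Lemma bernoulli_mgf q s : 0 <= q <= 1 ->
  q * expR (s * (1 - q)) + (1 - q) * expR (s * (0 - q)) <= expR (2 * s ^+ 2).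
Proof.
move=> /andP[q0 q1]; have [s2|s2] := leP `|s| 2^-1.
  have /andP[s3 s4] : - 2^-1 <= s <= 2^-1 by rewrite -ler_norml.
  have h1 : expR (s * (1 - q)) <= 1 + s * (1 - q) + 2 * (s * (1 - q)) ^+ 2.
    by apply: expR_le_quadratic; nra.
  have h2 : expR (s * (0 - q)) <= 1 + s * (0 - q) + 2 * (s * (0 - q)) ^+ 2.
    by apply: expR_le_quadratic; nra.
  apply: le_trans (@expR_ge1Dx R (2 * s ^+ 2)).
  have := ler_wpM2l q0 h1.
  have q1' : 0 <= 1 - q by rewrite subr_ge0.
  have := ler_wpM2l q1' h2.
  have h3 : s ^+ 2 * (q * (1 - q)) <= s ^+ 2.
    by rewrite ler_piMr ?sqr_ge0 //; nra.
  have -> : 1 + 2 * s ^+ 2 = 1 + 2 * (s ^+ 2 * (q * (1 - q)))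
    + 2 * (s ^+ 2 - s ^+ 2 * (q * (1 - q))) by ring.
  have e : q * (1 + s * (1 - q) + 2 * (s * (1 - q)) ^+ 2) +
      (1 - q) * (1 + s * (0 - q) + 2 * (s * (0 - q)) ^+ 2) =
      1 + 2 * (s ^+ 2 * (q * (1 - q))) by ring.
  lra.
have hs : `|s| <= 2 * s ^+ 2.
  by rewrite -real_normK ?num_real //; nra.
have h1 : expR (s * (1 - q)) <= expR (2 * s ^+ 2).
  rewrite ler_expR; apply: le_trans hs; apply: le_trans (ler_norm _) _.
  by rewrite normrM ler_piMr // ger0_norm; lra.
have h2 : expR (s * (0 - q)) <= expR (2 * s ^+ 2).
  rewrite ler_expR; apply: le_trans hs; apply: le_trans (ler_norm _) _.
  by rewrite normrM ler_piMr // ler0_norm; lra.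
nra.
Qed.

(* The term of index [floor |u|] alone dominates; the sum turns the square in the
   exponent into exponentials of linear functions of [u]. *)
Lemma expR_sqr_le_sum (N : nat) u : `|u| < N%:R ->
  expR (u ^+ 2 / 64) <= \sum_(k < N) expR ((k.+1%:R) ^+ 2 / 64 - (k%:R) ^+ 2 / 4) *
     (expR (k%:R / 4 * u) + expR (k%:R / 4 * - u)).
Proof.
move=> uN; have u0 := normr_ge0 u.
have /andP[k1 k2] := truncn_itv u0; set k := Num.truncn _ in k1 k2.
have kN : (k < N)%N by rewrite -(ltr_nat R); exact: le_lt_trans uN.
rewrite (bigD1 (Ordinal kN)) //=.
apply: (@le_trans _ _ (expR ((k.+1%:R) ^+ 2 / 64 - (k%:R) ^+ 2 / 4) * expR (k%:R / 4 *
  `|u|))).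
  rewrite -expRD ler_expR -[in leLHS]real_normK ?num_real //.
  have h1 : `|u| ^+ 2 <= (k.+1%:R) ^+ 2 by rewrite ler_sqr ?nnegrE // ltW.
  have h2 : k%:R * k%:R <= k%:R * `|u| by rewrite ler_wpM2l.
  lra.
apply: ler_wpDr; first by apply: sumr_ge0 => i _; rewrite mulr_ge0 ?addr_ge0 ?expR_ge0.
rewrite ler_wpM2l ?expR_ge0 //.
by case: (ler0P u) => _; rewrite ?lerDl ?lerDr expR_ge0.
Qed.

End ExpBounds.

(** * Products of independent Bernoulli variables *)

Section BernoulliProduct.
Context {R : realType} {J : finType}.
Variable q : J -> R.
Hypothesis q01 : forall j, 0 <= q j <= 1.
Implicit Types (y : {ffun J -> bool}) (s : J -> R).

Definition bern_weight y : R := \prod_j bernoulli_pmf (q j) (y j).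
Definition bern_exp (f : {ffun J -> bool} -> R) : R := \sum_y bern_weight y * f y.
Definition noise s y : R := \sum_j s j * ((y j : nat)%:R - q j).

Lemma bern_weight_ge0 y : 0 <= bern_weight y.
Proof. by apply: prodr_ge0 => j _; exact: bernoulli_pmf_ge0. Qed.

Lemma bern_exp_prod (f : J -> bool -> R) :
  bern_exp (fun y => \prod_j f j (y j)) = \prod_j (q j * f j true
    + (1 - q j) * f j false).
Proof.
transitivity (\prod_j \sum_b bernoulli_pmf (q j) b * f j b); last first.
  by apply: eq_bigr => j _; rewrite big_bool.
rewrite bigA_distr_bigA; apply: eq_bigr => y _.
by rewrite /bern_weight -big_split.
Qed.

Lemma eq_bern_exp f g : f =1 g -> bern_exp f = bern_exp g.
Proof. by move=> fg; apply: eq_bigr => y _; rewrite fg. Qed.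

Lemma ler_bern_exp f g : (forall y, f y <= g y) -> bern_exp f <= bern_exp g.
Proof. by move=> fg; apply: ler_sum => y _; rewrite ler_wpM2l ?bern_weight_ge0. Qed.

Lemma bern_expD f g : bern_exp (fun y => f y + g y) = bern_exp f + bern_exp g.
Proof. by rewrite /bern_exp -big_split; apply: eq_bigr => y _; rewrite mulrDr. Qed.

Lemma bern_expZ (c : R) f : bern_exp (fun y => c * f y) = c * bern_exp f.
Proof. by rewrite /bern_exp mulr_sumr; apply: eq_bigr => y _; rewrite mulrCA. Qed.

Lemma bern_exp_sum (I : Type) (r : seq I) (F : I -> {ffun J -> bool} -> R) :
  bern_exp (fun y => \sum_(i <- r) F i y) = \sum_(i <- r) bern_exp (F i).
Proof.
rewrite /bern_exp exchange_big; apply: eq_bigr => y _.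
by rewrite mulr_sumr.
Qed.

Lemma bern_exp_const (c : R) : bern_exp (fun=> c) = c.
Proof.
have h := bern_exp_prod (fun _ _ => 1).
rewrite [RHS]big1 /= in h; last by move=> j _; ring.
transitivity (bern_exp (fun y => c * \prod_(j : J) 1)).
  by apply: eq_bern_exp => y; rewrite big1 // mulr1.
by rewrite bern_expZ h mulr1.
Qed.

Lemma bern_cov i j : bern_exp (fun y => ((y i : nat)%:R - q i) * ((y j : nat)%:R - q j))
  = if i == j then q i * (1 - q i) else 0.
Proof.
pose f k b := (if k == i then (b : nat)%:R - q i else 1) * (if k == j then (b :
  nat)%:R - q j else 1).
have fE y : ((y i : nat)%:R - q i) * ((y j : nat)%:R - q j) = \prod_k f k (y k).
  rewrite big_split /= (bigD1 i) //= eqxx big1 => [|k /negPf ->//].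
  by rewrite (bigD1 j) //= eqxx big1 => [|k /negPf ->//]; rewrite !mulr1.
rewrite (eq_bern_exp fE) (bern_exp_prod f) (bigD1 i) //=.
have [ij|ij] := eqVneq i j.
  rewrite big1 => [|k ki]; last by rewrite /f -ij (negPf ki); ring.
  by rewrite /f -ij eqxx /=; ring.
by rewrite /f eqxx (negPf ij) /=; ring.
Qed.

Lemma noiseZ (c : R) s y : noise (fun j => c * s j) y = c * noise s y.
Proof. by rewrite /noise mulr_sumr; apply: eq_bigr => j _; rewrite mulrA. Qed.

Lemma noise_mgf s : bern_exp (fun y => expR (noise s y)) <= expR (2 * \sum_j s j ^+ 2).
Proof.
have e y : expR (noise s y) = \prod_j expR (s j * ((y j : nat)%:R - q j)).
  by rewrite expR_sum.
rewrite (eq_bern_exp e) (bern_exp_prod (fun j b => expR (s j * ((b : nat)%:R - q j)))).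
rewrite mulr_sumr expR_sum; apply: ler_prod => j _.
rewrite addr_ge0 ?mulr_ge0 ?expR_ge0 ?subr_ge0 //=; try by have /andP[] := q01 j.
exact: bernoulli_mgf.
Qed.

(** Each linear exponential produced by [expR_sqr_le_sum] is bounded by [noise_mgf]. The resulting
    series is dominated by a geometric one with sum at most 4 / (1 - 32/35) < 47. *)
Lemma noise_sqr_mgf s : \sum_j s j ^+ 2 <= 1 ->
  bern_exp (fun y => expR (noise s y ^+ 2 / 64)) <= 47.
Proof.
move=> s1.
(* Any integer above all values of |noise| would do; the final bound is free of it. *)
pose N := #|J|.+1.
have sj j : `|s j| <= 1.
  rewrite -(@expr_le1 _ 2) // real_normK ?num_real //; apply: le_trans s1.
  by rewrite (bigD1 j) //= lerDl sumr_ge0 // => k _; rewrite sqr_ge0.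
have noise_lt y : `|noise s y| < N%:R.
  apply: (@le_lt_trans _ _ #|J|%:R); last by rewrite ltr_nat.
  apply: le_trans (ler_norm_sum _ _ _) _.
  rewrite -sum1_card natr_sum; apply: ler_sum => j _.
  rewrite normrM mulr_ile1 // ler_norml; have := q01 j.
  by case: (y j) => /=; lra.
pose c k : R := expR ((k.+1%:R) ^+ 2 / 64 - (k%:R) ^+ 2 / 4).
apply: (@le_trans _ _ (\sum_(k < N) c k * (2 * expR (k%:R ^+ 2 / 8)))).
  have h y := expR_sqr_le_sum (noise_lt y).
  apply: le_trans (ler_bern_exp h) _.
  rewrite bern_exp_sum; apply: ler_sum => k _.
  rewrite bern_expZ; apply: ler_wpM2l; first exact: expR_ge0.
  rewrite bern_expD.
  have mgf (t : R) : t ^+ 2 = (k%:R / 4) ^+ 2 ->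
      bern_exp (fun y => expR (t * noise s y)) <= expR (k%:R ^+ 2 / 8).
    move=> t2; have e y : expR (t * noise s y) = expR (noise (fun j => t * s j) y).
      by rewrite noiseZ.
    rewrite (eq_bern_exp e); apply: le_trans (noise_mgf _) _; rewrite ler_expR.
    have -> : \sum_j (t * s j) ^+ 2 = t ^+ 2 * \sum_j s j ^+ 2.
      by rewrite mulr_sumr; apply: eq_bigr => j _; rewrite exprMn.
    rewrite t2; have := sqr_ge0 (k%:R / 4 : R).
    have -> : k%:R ^+ 2 / 8 = 2 * (k%:R / 4) ^+ 2 :> R by field.
    nra.
  have e y : expR (k%:R / 4 * - noise s y) = expR (- (k%:R / 4) * noise s y).
    by rewrite mulrN mulNr.
  have h1 := mgf _ erefl; have := mgf (- (k%:R / 4)); rewrite sqrrN => /(_ erefl).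
  rewrite (eq_bern_exp e) mulrDl mul1r => h2; exact: lerD.
(* The ratio comes from (k + 1)^2 / 64 - k^2 / 4 + k^2 / 8 <= 1/2 - 3 k / 32. *)
pose r : R := expR (- (3 / 32)).
have r0 : 0 <= r by exact: expR_ge0.
have r1 : r <= 32 / 35.
  have h := @expR_ge1Dx R (3 / 32).
  have e0 := expR_gt0 (3 / 32 : R).
  rewrite /r expRN -(ler_pM2r e0) mulVf ?gt_eqF //; lra.
have term k : c k * (2 * expR (k%:R ^+ 2 / 8)) <= 4 * r ^+ k.
  rewrite /r -expRM_natl /c mulrCA -expRD.
  apply: (@le_trans _ _ (2 * (2 * expR (k%:R * - (3 / 32))))); last by lra.
  apply: ler_wpM2l => //; apply: le_trans _ (ler_wpM2r (expR_ge0 _) expR_half_le2).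
  rewrite -expRD ler_expR -natr1.
  have k2 : k%:R <= k%:R ^+ 2 :> R.
    by rewrite -natrX ler_nat -mulnn; case: k => // k; rewrite leq_pmulr.
  have := sqr_ge0 (k%:R - 1 : R); lra.
apply: (@le_trans _ _ (\sum_(k < N) 4 * r ^+ k)); first exact: ler_sum.
rewrite -mulr_sumr.
have := subrX1 r N; have := exprn_ge0 N r0.
set S := \sum_(k < N) _; nra.
Qed.

(** The first 4 is the factor of [expR_le_taylor2], 4 * 128^2 is the price for absorbing w^2 into
    exp(w / 128), and 94 is twice the 47 of [noise_sqr_mgf]. *)
Definition bilinear_mgf_const : R := 4 * (4 * 128 ^+ 2 * 94).

(** Subexponential bound for a centred product of two linear forms: the first-order term has mean
    zero, and the restriction on u keeps the second-order remainder below exponentials of squares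
    with finite moments. *)
Lemma noise_bilinear_mgf (s t : J -> R) (u : R) :
  \sum_j s j ^+ 2 <= 1 -> \sum_j t j ^+ 2 <= 1 -> `|u| <= 128^-1 ->
  bern_exp (fun y => expR (u * (noise s y * noise t y
                                - \sum_j s j * t j * (q j * (1 - q j)))))
    <= expR (bilinear_mgf_const * u ^+ 2).
Proof.
move=> s1 t1 u1; set v := \sum_j _.
(* By independence only the diagonal terms of the product survive. *)
have EQ : bern_exp (fun y => noise s y * noise t y) = v.
  have e y : noise s y * noise t y =
      \sum_i \sum_j s i * t j * (((y i : nat)%:R - q i) * ((y j : nat)%:R - q j)).
    rewrite /noise mulr_suml; apply: eq_bigr => i _.
    by rewrite mulr_sumr; apply: eq_bigr => j _; ring.
  rewrite (eq_bern_exp e) bern_exp_sum; apply: eq_bigr => i _.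
  rewrite bern_exp_sum (bigD1 i) //= bern_expZ bern_cov eqxx big1 ?addr0 // => j ji.
  by rewrite bern_expZ bern_cov eq_sym (negPf ji) mulr0.
have v1 : `|v| <= 1.
  apply: le_trans (ler_norm_sum _ _ _) _.
  apply: (@le_trans _ _ (\sum_j (2^-1 * s j ^+ 2 + 2^-1 * t j ^+ 2))); last first.
    by rewrite big_split -!mulr_sumr /=; lra.
  apply: ler_sum => j _; rewrite normrM.
  have h1 : `|q j * (1 - q j)| <= 1 by rewrite ler_norml; have := q01 j; nra.
  apply: (@le_trans _ _ `|s j * t j|); first by rewrite ler_piMr.
  rewrite ler_norml; have := sqr_ge0 (s j - t j); have := sqr_ge0 (s j + t j); lra.
pose Q y := noise s y * noise t y - v.
have pointwise y : expR (u * Q y) <= 1 + u * Q y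
    + 4 * (4 * 128 ^+ 2) * u ^+ 2 * (expR (noise s y ^+ 2 / 64)
      + expR (noise t y ^+ 2 / 64)).
  apply: le_trans (expR_le_taylor2 _) _; rewrite lerD2l.
  have -> : 4 * (4 * 128 ^+ 2) * u ^+ 2 * (expR (noise s y ^+ 2 / 64)
    + expR (noise t y ^+ 2 / 64))
     = 4 * (u ^+ 2 * (128 ^+ 2 * 4 * (expR (noise s y ^+ 2 / 64)
       + expR (noise t y ^+ 2 / 64)))) by ring.
  apply: ler_wpM2l => //.
  set w := `|Q y|; have w0 : 0 <= w by exact: normr_ge0.
  rewrite exprMn normrM -/w -[Q y ^+ 2]real_normK ?num_real // -/w.
  have h1 : expR (`|u| * w) <= expR (w / 128).
    by rewrite ler_expR mulrC ler_wpM2l.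
  have h2 : w ^+ 2 <= 128 ^+ 2 * (4 * expR (w / 128)).
    have h := @sqr_le_expR R (w / 128) (divr_ge0 w0 (ler0n _ _)).
    have -> : w ^+ 2 = 128 ^+ 2 * (w / 128) ^+ 2 by field.
    by rewrite ler_wpM2l.
  have h3 : expR (w / 128) * expR (w / 128) <= expR (noise s y ^+ 2 / 64)
    + expR (noise t y ^+ 2 / 64).
    rewrite -expRD.
    have hw : w <= noise s y ^+ 2 / 2 + noise t y ^+ 2 / 2 + 1.
      rewrite /w /Q; apply: le_trans (ler_normB _ _) _; rewrite lerD //.
      rewrite ler_norml; have := sqr_ge0 (noise s y - noise t y).
      have := sqr_ge0 (noise s y + noise t y); lra.
    apply: (@le_trans _ _ (expR 2^-1 * (expR (noise s y ^+ 2 / 128) * expR (noise t y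
      ^+ 2 / 128)))).
      by rewrite -!expRD ler_expR; lra.
    have amgm (a b : R) : a * b <= (a ^+ 2 + b ^+ 2) / 2 by have := sqr_ge0 (a - b); lra.
    have sq (a : R) : expR (a / 128) ^+ 2 = expR (a / 64).
      by rewrite -expRM_natl; congr expR; field.
    have := amgm (expR (noise s y ^+ 2 / 128)) (expR (noise t y ^+ 2 / 128)).
    rewrite !sq => h; have hp : 0 <= (expR (noise s y ^+ 2 / 64)
      + expR (noise t y ^+ 2 / 64)) / 2.
      by rewrite divr_ge0 // addr_ge0 ?expR_ge0.
    apply: le_trans (ler_wpM2l (expR_ge0 _) h) _.
    by apply: le_trans (ler_wpM2r hp expR_half_le2) _; lra.
  rewrite -[leLHS]mulrA; apply: ler_wpM2l; first exact: sqr_ge0.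
  apply: le_trans (ler_pM (sqr_ge0 _) (expR_ge0 _) h2 h1) _.
  have -> : 128 ^+ 2 * (4 * expR (w / 128)) * expR (w / 128) =
      128 ^+ 2 * 4 * (expR (w / 128) * expR (w / 128)) by ring.
  by apply: ler_wpM2l.
apply: le_trans (ler_bern_exp pointwise) _.
have EQ0 : bern_exp Q = 0 by rewrite /Q bern_expD bern_exp_const EQ subrr.
rewrite bern_expD (bern_expD (fun=> 1) (fun y => u * Q y)) bern_exp_const.
rewrite (bern_expZ u Q) EQ0 mulr0 addr0 bern_expZ bern_expD;
  apply: le_trans (@expR_ge1Dx R _); rewrite lerD2l.
have -> : bilinear_mgf_const * u ^+ 2 = 4 * (4 * 128 ^+ 2) * u ^+ 2 * 94.
  by rewrite /bilinear_mgf_const; ring.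
apply: ler_wpM2l; first by rewrite mulr_ge0 ?sqr_ge0 // mulr_ge0.
by have := noise_sqr_mgf s1; have := noise_sqr_mgf t1; lra.
Qed.

End BernoulliProduct.

(** * Path probabilities *)

Section FiniteValued.
Context {d : measure_display} {Omega : measurableType d}.

(** Measurability of the fibres, so that no sigma-algebra has to be chosen on the types of graphs,
    paths and vertex sets. *)
Definition fin_measurable (I : Type) (g : Omega -> I) : Prop :=
  forall i, measurable (g @^-1` [set i]).

Lemma fin_measurable_preimage (I : finType) (g : Omega -> I) (B : set I) :
  fin_measurable g -> measurable (g @^-1` B).
Proof.
move=> mg; have -> : g @^-1` B = \bigcup_(i in B) (g @^-1` [set i]).
  by apply/seteqP; split => [w Bw|w [i Bi /= gw]]; [exists (g w)|rewrite /= gw].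
by apply: fin_bigcup_measurable => // i _; exact: mg.
Qed.

Lemma fin_measurable_comp (I : finType) (J : Type) (g : Omega -> I) (h : I -> J) :
  fin_measurable g -> fin_measurable (h \o g).
Proof. by move=> mg j; exact: (fin_measurable_preimage (h @^-1` [set j]) mg). Qed.

Lemma fin_measurable_pair (I J : Type) (g : Omega -> I) (h : Omega -> J) :
  fin_measurable g -> fin_measurable h -> fin_measurable (fun w => (g w, h w)).
Proof.
move=> mg mh [i j].
have -> : (fun w => (g w, h w)) @^-1` [set (i, j)] = g @^-1` [set i] `&` h @^-1` [set j].
  by apply/seteqP; split => w /= [-> ->].
by apply: measurableI; [exact: mg|exact: mh].
Qed.

Lemma fin_measurable_ffun (K : finType) (I : Type) (g : K -> Omega -> I) :
  (forall k, fin_measurable (g k)) -> fin_measurable (fun w => [ffun k => g k w]).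
Proof.
move=> mg f.
have -> : (fun w => [ffun k => g k w]) @^-1` [set f]
  = \bigcap_(k in [set: K]) (g k @^-1` [set f k]).
  apply/seteqP; split => [w /= <- k _ /=|w h]; first by rewrite ffunE.
  by apply/ffunP => k; rewrite ffunE; exact: h.
by apply: fin_bigcap_measurable => // k _; exact: mg.
Qed.

Lemma fin_measurable_bool (f : Omega -> bool) :
  measurable_fun setT f -> fin_measurable f.
Proof. by move=> mf b; rewrite -[X in measurable X]setTI; exact: mf. Qed.

Lemma measure_fin_partition (R : realType) (P : {measure set Omega -> \bar R})
    (I : finType) (g : Omega -> I) (E : set Omega) :
  fin_measurable g -> measurable E ->
  P E = (\sum_i P (E `&` g @^-1` [set i]))%E.
Proof.
move=> mg mE.
have {1}-> : E = \bigcup_(i in [set: I]) (E `&` g @^-1` [set i]).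
  by apply/seteqP; split => [w Ew|w [i _ []]//]; exists (g w).
rewrite measure_fin_bigcup; first last.
- by move=> i _; apply: measurableI => //; exact: mg.
- by move=> i j _ _ [w [[_ /= <-] [_ /= <-]]].
- exact: finite_finset.
- rewrite (fsbig_seq _ _ (index_enum_uniq I)).
  rewrite (_ : [set` index_enum I] = [set: I]) //.
  by apply/seteqP; split => // i _ /=; exact: mem_index_enum.
Qed.

End FiniteValued.

Section Paths.
Context {R : realType} {C : finType}.

Lemma sum_tuple_rcons (n : nat) (G : n.+1.-tuple C -> R) :
  \sum_s G s = \sum_(s : n.-tuple C) \sum_y G [tuple of rcons s y].
Proof.
rewrite pair_big /= (reindex (fun p : n.-tuple C * C => [tuple of rcons p.1 p.2])) //=.
apply: onW_bij; apply: inj_card_bij.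
  by move=> [s y] [t z] /(congr1 val) /= /rcons_inj [/val_inj -> ->].
by rewrite card_prod !card_tuple expnSr.
Qed.

End Paths.

Section Chain.
Context {R : realType} (lambda mu p : R) (N : nat) (Pp : {set 'I_N}).
Context {d : measure_display} {Omega : measurableType d}
  {P : probability Omega R}.
Variables (theta : 'I_N -> 'I_N -> {RV P >-> bool})
  (X : int -> 'I_N -> {RV P >-> bool}).
Hypothesis chain : community_chain lambda mu p Pp theta X.
Local Notation C := {ffun 'I_N -> bool}.
Local Notation trans := (trans_prob lambda mu Pp).
Implicit Type A : 'M[bool]_N.

Definition c0 : C := [ffun=> false].

(** The path starts at time 1, as the sample does: n = T covers X_1, ..., X_(T+1). *)
Definition path_weight A (n : nat) (s : n.+1.-tuple C) : R :=
  fine (P (path_event theta X A 1 n (nth c0 s))).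

Definition trace (n : nat) (w : Omega) : n.+1.-tuple C :=
  [tuple config X (1 + (k : nat)%:Z) w | k < n.+1].

Lemma fin_measurable_RV (f : {RV P >-> bool}) : fin_measurable f.
Proof. exact/fin_measurable_bool/measurable_funP. Qed.

Lemma fin_measurable_graph : fin_measurable (graph theta).
Proof.
pose h (f : {ffun 'I_N -> {ffun 'I_N -> bool}}) : 'M[bool]_N := \matrix_(i, j) f i j.
have -> : graph theta = h \o (fun w => [ffun i => [ffun j => theta i j w]]).
  by apply: funext => w; apply/matrixP => i j; rewrite !mxE !ffunE.
apply: fin_measurable_comp; apply: fin_measurable_ffun => i.
by apply: fin_measurable_ffun => j; exact: fin_measurable_RV.
Qed.

Lemma fin_measurable_config t : fin_measurable (config X t).
Proof. by apply: fin_measurable_ffun => i; exact: fin_measurable_RV. Qed.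

Lemma fin_measurable_trace n : fin_measurable (trace n).
Proof.
pose h (f : {ffun 'I_n.+1 -> C}) := [tuple f k | k < n.+1].
have -> : trace n = h \o (fun w => [ffun k : 'I_n.+1 => config X (1 + (k : nat)%:Z) w]).
  by apply: funext => w; apply: eq_from_tnth => k; rewrite !tnth_mktuple ffunE.
apply: fin_measurable_comp; apply: fin_measurable_ffun => k.
exact: fin_measurable_config.
Qed.

Lemma path_event_fiber A n (s : n.+1.-tuple C) :
  path_event theta X A 1 n (nth c0 s)
    = (fun w => (graph theta w, trace n w)) @^-1` [set (A, s)].
Proof.
apply/seteqP; split => w /=.
  move=> [-> h]; congr pair; apply: eq_from_tnth => k.
  by rewrite tnth_mktuple h ?(tnth_nth c0) // -ltnS.
move=> [gA <-]; split => // k kn.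
have kn' : (k < n.+1)%N by rewrite ltnS.
by rewrite -(tnth_nth c0 (trace n w) (Ordinal kn')) tnth_mktuple.
Qed.

Lemma path_weight_ge0 A n (s : n.+1.-tuple C) : 0 <= path_weight A s.
Proof. by apply: fine_ge0; exact: measure_ge0. Qed.

Lemma measurable_fiber n : fin_measurable (fun w => (graph theta w, trace n w)).
Proof.
by apply: fin_measurable_pair; [exact: fin_measurable_graph|exact: fin_measurable_trace].
Qed.

Lemma path_weightE A n (s : n.+1.-tuple C) :
  (path_weight A s)%:E = P (path_event theta X A 1 n (nth c0 s)).
Proof.
rewrite /path_weight fineK // path_event_fiber; apply: fin_num_measure.
exact: measurable_fiber.
Qed.

Lemma path_weight_rcons A n (s : n.+1.-tuple C) y :
  path_weight A [tuple of rcons s y] = path_weight A s * trans A (nth c0 s n) y.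
Proof.
apply: EFin_inj; rewrite EFinM !path_weightE (chain_markov chain) /=.
have h k : (k <= n)%N -> nth c0 (rcons s y) k = nth c0 s k.
  by move=> kn; rewrite nth_rcons size_tuple ltnS kn.
congr (_ * _)%E.
  congr (P _); apply/seteqP; split => w [gA hw]; split => // k kn;
  by rewrite hw // h.
by rewrite h // nth_rcons size_tuple ltnn eqxx.
Qed.

Definition graph_weight A : R := \prod_(i < N) \prod_(j < N) bernoulli_pmf p (A i j).

Lemma sum_path_weight0 A : \sum_(s : 1.-tuple C) path_weight A s = graph_weight A.
Proof.
apply: EFin_inj; rewrite -sumEFin /graph_weight -(graph_iid_bernoulli chain).
rewrite (measure_fin_partition P (@fin_measurable_trace 0%N)).
  apply: eq_bigr => s _; rewrite path_weightE path_event_fiber; congr (P _).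
  by apply/seteqP; split => w /= [-> ->].
exact: fin_measurable_graph.
Qed.

(** Induction on the length: by the Markov property, summing out the last state costs one factor c.
    For c = 1 this is the supermartingale bound. *)
Lemma sum_path_prod A n (F : C -> C -> R) (c : R) :
  0 <= c -> (forall x y, 0 <= F x y) ->
  (forall x, \sum_y trans A x y * F x y <= c) ->
  \sum_(s : n.+1.-tuple C) path_weight A s * \prod_(k < n) F (nth c0 s k) (nth c0 s k.+1)
    <= graph_weight A * c ^+ n.
Proof.
move=> c_ge0 F0 Fc; elim: n => [|n IH].
  rewrite expr0 mulr1 -sum_path_weight0.
  by apply: ler_sum => s _; rewrite big_ord0 mulr1.
rewrite sum_tuple_rcons.
apply: (@le_trans _ _ (c * \sum_(s : n.+1.-tuple C)
    path_weight A s * \prod_(k < n) F (nth c0 s k) (nth c0 s k.+1))); last first.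
  by rewrite exprS mulrCA ler_wpM2l.
rewrite mulr_sumr; apply: ler_sum => s _.
have e y : path_weight A [tuple of rcons s y] *
     \prod_(k < n.+1) F (nth c0 [tuple of rcons s y] k) (nth c0 [tuple of rcons s y]
       k.+1) =
   (path_weight A s * \prod_(k < n) F (nth c0 s k) (nth c0 s k.+1)) *
   (trans A (nth c0 s n) y * F (nth c0 s n) y).
  rewrite path_weight_rcons big_ord_recr /=.
  have h k : (k <= n)%N -> nth c0 (rcons s y) k = nth c0 s k.
    by move=> kn; rewrite nth_rcons size_tuple ltnS kn.
  rewrite h // nth_rcons size_tuple ltnn eqxx.
  rewrite (eq_bigr (fun k : 'I_n => F (nth c0 s k) (nth c0 s k.+1))); first by ring.
  by move=> k _; rewrite !h // ltnW.
under eq_bigr do rewrite e.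
rewrite -mulr_sumr [leRHS]mulrC; apply: ler_wpM2l; last exact: Fc.
by rewrite mulr_ge0 ?path_weight_ge0 // prodr_ge0.
Qed.

(** Transfers the question from the probability space to a finite sum over graphs and paths, where
    the union and Chernoff bounds take place. *)
Lemma probability_le_sum n (E : set Omega) (bad : pred ('M[bool]_N * n.+1.-tuple C)) :
  measurable E ->
  (forall w, E w -> bad (graph theta w, trace n w)) ->
  (P E <= (\sum_(i | bad i) path_weight i.1 i.2)%:E)%E.
Proof.
move=> mE Ebad.
rewrite (measure_fin_partition P (@measurable_fiber n) mE) -sumEFin big_mkcond
  [leRHS]big_mkcond /=.
apply: lee_sum => -[A s] _; case: ifPn => h.
  rewrite path_weightE path_event_fiber; apply: le_measure; rewrite ?inE.
  - by apply: measurableI => //; exact: measurable_fiber.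
  - exact: measurable_fiber.
  - exact: subIsetr.
rewrite (_ : _ `&` _ = set0) ?measure0 //.
by apply/seteqP; split => w // [/Ebad + /= e]; rewrite e (negPf h).
Qed.

End Chain.

(** * The community model *)

Section Model.
Context {R : realType} (lambda mu p : R) (N : nat) (Pp : {set 'I_N}).
Hypotheses (lambda01 : 0 < lambda < 1) (mu01 : 0 < mu <= lambda) (p01 : 0 < p <= 1).
Hypothesis N0 : (0 < N)%N.
Local Notation C := {ffun 'I_N -> bool}.
Implicit Types (A : 'M[bool]_N) (c : C).
Let NR : 0 < N%:R :> R. Proof. by rewrite ltr0n. Qed.

Definition adjacency A : 'M[R]_N := \matrix_(i, j) (A i j : nat)%:R.
Definition interaction A : 'M[R]_N :=
  \matrix_(i, j) ((1 - lambda) / N%:R * (A i j : nat)%:R * sgn_mx Pp j 0).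
(** The inhibitory terms 1 - x_j split into a constant, collected here, and - x_j, which gives the
    negative columns of [interaction]. *)
Definition baseline A : 'cV[R]_N :=
  \col_i (mu + (1 - lambda) / N%:R * \sum_(j in ~: Pp) (A i j : nat)%:R).
Definition conf_vec c : 'cV[R]_N := \col_i (c i : nat)%:R.

Lemma act_probE A c i :
  act_prob lambda mu Pp A c i = (baseline A + interaction A *m conf_vec c) i 0.
Proof.
rewrite colDE [baseline A i 0]mxE [(_ *m _) i 0]mxE /act_prob.
have -> : \sum_j interaction A i j * conf_vec c j 0 = (1 - lambda) / N%:R *
   (\sum_(j in Pp) (A i j : nat)%:R * (c j : nat)%:R
    - \sum_(j in ~: Pp) (A i j : nat)%:R * (c j : nat)%:R).
  rewrite (bigID (mem Pp)) mulrBr !mulr_sumr -sumrN; congr (_ + _).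
    apply: eq_bigr => j jP; rewrite [interaction A i j]mxE (sgn_mx_in jP).
    by rewrite [conf_vec c j 0]mxE; ring.
  apply: eq_big => [j|j jP]; first by rewrite finset.in_setC.
  by rewrite [interaction A i j]mxE (sgn_mx_out jP) [conf_vec c j 0]mxE; ring.
have -> : \sum_(j in ~: Pp) (A i j : nat)%:R * (1 - (c j : nat)%:R) =
   \sum_(j in ~: Pp) (A i j : nat)%:R - \sum_(j in ~: Pp) (A i j : nat)%:R * (c j :
     nat)%:R :> R.
  by rewrite -sumrB; apply: eq_bigr => j _; ring.
ring.
Qed.

Lemma act_prob01 A c i : 0 <= act_prob lambda mu Pp A c i <= 1.
Proof.
have /andP[l0 l1] := lambda01; have /andP[m0 m1] := mu01.
rewrite /act_prob -mulrDr.
set S := (_ + _ in X in _ * X).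
have S01 : 0 <= S <= N%:R.
  have -> : N%:R = \sum_(j in Pp) 1 + \sum_(j in ~: Pp) 1 :> R.
    by rewrite !sumr_const -mulrnDr cardsC card_ord.
  apply/andP; split; first by
    rewrite addr_ge0 // sumr_ge0 // => j _; rewrite mulr_ge0 //; case: (c j);
      rewrite /=; lra.
  by rewrite lerD // ler_sum // => j _; case: (A i j); case: (c j); rewrite /=; lra.
have h : 0 <= N%:R^-1 * S <= 1.
  by rewrite mulr_ge0 ?invr_ge0 ?(ltW NR) //= ?ler_pdivrMl ?mulr1 //; case/andP: S01.
move: h; nra.
Qed.

Lemma interaction_entry A i j : `|interaction A i j| <= (1 - lambda) / N%:R.
Proof.
have /andP[l0 l1] := lambda01.
have h : 0 <= (1 - lambda) / N%:R by rewrite divr_ge0 // subr_ge0 ltW.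
rewrite mxE [sgn_mx _ _ _]mxE normrM normr_sign mulr1 normrM ger0_norm //.
by rewrite ler_piMr //; case: (A i j); rewrite /= ?normr1 ?normr0.
Qed.

Lemma opnorm_le_interaction A : opnorm_le (interaction A) (1 - lambda).
Proof. by apply: opnorm_le_entries => i j; exact: interaction_entry. Qed.

Lemma interaction_frob A :
  \sum_i dot (row i (interaction A))^T (row i (interaction A))^T <= 1.
Proof.
have /andP[l0 l1] := lambda01.
apply: (@le_trans _ _ (\sum_(i < N) \sum_(j < N) (N%:R^-1) ^+ 2)).
  apply: ler_sum => i _; apply: ler_sum => j _.
  rewrite [(row i _)^T j 0]mxE [row i _ 0 j]mxE -expr2 -real_normK ?num_real //.
  rewrite ler_sqr ?nnegrE ?invr_ge0 ?(ltW NR) //.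
  apply: le_trans (interaction_entry _ _ _) _.
  by rewrite ler_piMl ?invr_ge0 ?(ltW NR) //; lra.
rewrite !sumr_const !card_ord -[X in X *+ N]mulr_natr -[leLHS]mulr_natr expr2.
by rewrite mulfVK ?mulVf // gt_eqF.
Qed.

Lemma interaction_split A : interaction A = ((1 - lambda) * p / N%:R) *: (ones
  *m (sgn_mx Pp)^T)
  + ((1 - lambda) / N%:R) *: ((adjacency A - const_mx p) *m diag_mx (sgn_mx Pp)^T).
Proof.
apply/matrixP => i j.
have e : ((adjacency A - const_mx p) *m diag_mx (sgn_mx Pp)^T) i j
    = ((A i j : nat)%:R - p) * sgn_mx Pp j 0 :> R.
  rewrite mul_mx_diag [LHS]mxE addmxE oppmxE [adjacency A i j]mxE [const_mx p i j]mxE.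
  by rewrite [(sgn_mx Pp)^T 0 j]mxE.
have scaleE (a : R) (M : 'M[R]_N) : (a *: M) i j = a * M i j by rewrite mxE.
rewrite addmxE !scaleE e outerE [interaction A i j]mxE [ones i 0]mxE; ring.
Qed.

Definition noise_part A : 'M[R]_N :=
  ((1 - lambda) / N%:R) *: ((adjacency A - const_mx p) *m diag_mx (sgn_mx Pp)^T).

Lemma opnorm_le_noise_part A (B : R) : 0 <= B ->
  opnorm_le (adjacency A - const_mx p) (B * Num.sqrt N%:R) ->
  opnorm_le (noise_part A) (B * (Num.sqrt N%:R)^-1).
Proof.
move=> B0 hB; have /andP[l0 l1] := lambda01.
have sN : 0 < Num.sqrt N%:R :> R by rewrite sqrtr_gt0.
have s2 : Num.sqrt N%:R ^+ 2 = N%:R :> R by rewrite sqr_sqrtr // ltW.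
have hd : opnorm_le (diag_mx (sgn_mx Pp)^T : 'M[R]_N) 1.
  by apply: opnorm_le_diag => // i; rewrite !mxE normr_sign.
have h0 : 0 <= (1 - lambda) / N%:R by rewrite divr_ge0 // subr_ge0 ltW.
have h1 : 0 <= B * Num.sqrt N%:R by rewrite mulr_ge0 // ltW.
apply: opnorm_leW (opnorm_leZ h0 (opnorm_leM h1 ler01 hB hd)).
rewrite mulr1 mulrCA ler_wpM2l //.
have -> : (1 - lambda) / N%:R * Num.sqrt N%:R = (1 - lambda) * (Num.sqrt N%:R)^-1.
  by rewrite -[in N%:R^-1]s2; field; rewrite gt_eqF.
by rewrite ler_piMl ?invr_ge0 ?(ltW sN) //; lra.
Qed.

(* fixed point of the mean-field equation m = mu + (1 - lambda) p (r_+ m + r_- (1 - m)) *)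
Definition mean_field : R :=
  (mu + (1 - lambda) * p * (#|~: Pp|%:R / N%:R)) /
  (1 - (1 - lambda) * p * (#|Pp|%:R / N%:R - #|~: Pp|%:R / N%:R)).

Let rP : R := #|Pp|%:R / N%:R.
Let rM : R := #|~: Pp|%:R / N%:R.
Let a : R := (1 - lambda) * p.

Let r1 : rP + rM = 1.
Proof. by rewrite /rP /rM card_setCR // mulrBl addrC subrK divff // gt_eqF. Qed.
Let rP0 : 0 <= rP. Proof. by rewrite divr_ge0. Qed.
Let rM0 : 0 <= rM. Proof. by rewrite divr_ge0. Qed.
Let a0 : 0 <= a.
Proof. by have /andP[? /ltW ?] := lambda01; have /andP[/ltW ? _] := p01;
  rewrite mulr_ge0 // subr_ge0. Qed.
Let a1 : a <= 1 - lambda.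
Proof. by have /andP[_ /ltW ?] := lambda01; have /andP[_ ?] := p01;
  rewrite ler_piMr // subr_ge0. Qed.

Let den : R := 1 - a * (rP - rM).
Let den_gt0 : 0 < den.
Proof. by have /andP[l0 l1] := lambda01; rewrite /den; move: a0 a1 r1 rP0 rM0; nra. Qed.
Let den_le2 : den <= 2.
Proof. by have /andP[l0 l1] := lambda01; rewrite /den; move: a0 a1 r1 rP0 rM0; nra. Qed.

Lemma mean_field_fixpoint :
  mean_field = mu + a * (rP * mean_field + rM * (1 - mean_field)).
Proof.
have h : mean_field * den = mu + a * rM by rewrite /mean_field divfK // gt_eqF.
by move: h; rewrite /den; lra.
Qed.

(** The positive term mu is dropped, which makes the bound uniform in mu. *)
Lemma mean_field_ge : a * rM / 2 <= mean_field.
Proof.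
have /andP[m0 _] := mu01.
rewrite /mean_field -/den ler_pdivlMr //; apply: (@le_trans _ _ (a * rM)).
  by have := mulr_ge0 a0 rM0; move: den_le2; nra.
by rewrite lerDr ltW.
Qed.

(** Multiplied by the denominator, 1 - m becomes 1 - mu - a r_+; with mu <= lambda and a <= 1 -
    lambda this is at least (1 - lambda) r_-. *)
Lemma mean_field_le : (1 - lambda) * rM / 2 <= 1 - mean_field.
Proof.
have /andP[m0 m1] := mu01; have /andP[l0 l1] := lambda01.
have h : (1 - mean_field) * den = den - mu - a * rM.
  by rewrite mulrBl mul1r /mean_field -/den divfK ?gt_eqF // opprD addrA.
rewrite -(ler_pM2r den_gt0) h.
have h2 : (1 - lambda) * rM <= den - mu - a * rM.
  have h3 : den - a * rM = 1 - a * rP by rewrite /den; ring.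
  have rME : rM = 1 - rP by move: r1; lra.
  have e : (1 - lambda) * rM = (1 - lambda) - (1 - lambda) * rP by rewrite rME; ring.
  have := ler_wpM2r rP0 a1; lra.
apply: le_trans h2; have h4 : 0 <= (1 - lambda) * rM by rewrite mulr_ge0 // subr_ge0 ltW.
by have := ler_wpM2l h4 den_le2; lra.
Qed.

Lemma mean_field01 : 0 <= mean_field <= 1.
Proof.
have /andP[l0 l1] := lambda01.
have h : 0 <= 1 - lambda by rewrite subr_ge0 ltW.
apply/andP; split.
  by apply: le_trans mean_field_ge; rewrite divr_ge0 // mulr_ge0.
by rewrite -subr_ge0; apply: le_trans mean_field_le; rewrite divr_ge0 // mulr_ge0.
Qed.

Lemma mean_field_var_ge (k : R) : 0 <= k -> k / 2 <= rM ->
  a * (1 - lambda) * k ^+ 2 / 16 <= mean_field * (1 - mean_field).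
Proof.
move=> k0 kr; have /andP[l0 l1] := lambda01.
have h : 0 <= 1 - lambda by rewrite subr_ge0 ltW.
have -> : a * (1 - lambda) * k ^+ 2 / 16
  = (a * (k / 2) / 2) * ((1 - lambda) * (k / 2) / 2).
  by field.
have k2 : 0 <= k / 2 by rewrite divr_ge0.
apply: ler_pM.
- by rewrite divr_ge0 // mulr_ge0.
- by rewrite divr_ge0 // mulr_ge0.
- by apply: le_trans mean_field_ge; rewrite ler_pM2r // ler_wpM2l.
- by apply: le_trans mean_field_le; rewrite ler_pM2r // ler_wpM2l.
Qed.

(** By the fixed-point equation the average part of the graph cancels. What remains is (1 - lambda)
    / N times theta - p applied to a vector of norm at most sqrt N, hence of order 1. *)
Lemma mean_field_residual A (B : R) : 0 <= B ->
  opnorm_le (adjacency A - const_mx p) (B * Num.sqrt N%:R) ->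
  nrm (baseline A + interaction A *m (mean_field *: ones) - mean_field *: ones) <= B.
Proof.
move=> B0 hB; have /andP[l0 l1] := lambda01.
pose w : 'cV[R]_N := \col_j (if j \in Pp then mean_field else 1 - mean_field).
have sN : 0 < Num.sqrt N%:R :> R by rewrite sqrtr_gt0.
have s2 : Num.sqrt N%:R * Num.sqrt N%:R = N%:R :> R by rewrite -expr2 sqr_sqrtr // ltW.
have w_le : nrm w <= Num.sqrt N%:R.
  rewrite /nrm ler_wsqrtr // /dot.
  have -> : N%:R = \sum_(i < N) 1 :> R by rewrite sumr_const card_ord.
  apply: ler_sum => i _; rewrite mxE; have := mean_field01.
  by case: ifP => _; nra.
have -> : baseline A + interaction A *m (mean_field *: ones) - mean_field *: ones
    = ((1 - lambda) / N%:R) *: ((adjacency A - const_mx p) *m w).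
  apply/colP => i; rewrite colBE colDE !colZE [ones i 0]mxE mulr1.
  have -> : ((adjacency A - const_mx p) *m w) i 0 =
     \sum_(j in Pp) ((A i j : nat)%:R - p) * mean_field
     + \sum_(j in ~: Pp) ((A i j : nat)%:R - p) * (1 - mean_field).
    rewrite mxE (bigID (mem Pp)) /=; congr (_ + _).
      by apply: eq_bigr => j jP; rewrite !mxE jP.
    apply: eq_big => [j|j /negPf jP]; first by rewrite finset.in_setC.
    by rewrite !mxE jP.
  have -> : (interaction A *m (mean_field *: ones)) i 0 = (1 - lambda) / N%:R *
     (\sum_(j in Pp) (A i j : nat)%:R - \sum_(j in ~: Pp) (A i j : nat)%:R) * mean_field.
    rewrite mxE (bigID (mem Pp)) /= mulrBr mulrBl !mulr_sumr !mulr_suml -sumrN.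
    congr (_ + _).
      apply: eq_bigr => j jP; rewrite [interaction A i j]mxE (sgn_mx_in jP).
      by rewrite colZE [ones j 0]mxE; ring.
    apply: eq_big => [j|j jP]; first by rewrite finset.in_setC.
    by rewrite [interaction A i j]mxE (sgn_mx_out jP) colZE [ones j 0]mxE; ring.
  rewrite -!mulr_suml !sumrB !sumr_const -[_ *+ #|Pp|]mulr_natr -[_ *+ #|~: Pp|]mulr_natr.
  rewrite [baseline A i 0]mxE.
  have e1 : #|Pp|%:R = N%:R * rP :> R by rewrite /rP mulrCA divff ?mulr1 // gt_eqF.
  have e2 : #|~: Pp|%:R = N%:R * rM :> R by rewrite /rM mulrCA divff ?mulr1 // gt_eqF.
  rewrite e1 e2.
  have := mean_field_fixpoint; rewrite /a; move: mean_field => m hm.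
  rewrite [X in _ - X]hm.
  by field; rewrite gt_eqF.
rewrite nrmZ ger0_norm; last by rewrite divr_ge0 // subr_ge0 ltW.
have h1 : nrm ((adjacency A - const_mx p) *m w) <= B * N%:R.
  have b0 : 0 <= B * Num.sqrt N%:R by rewrite mulr_ge0 // ltW.
  apply: le_trans (opnorm_le_nrm _ b0 hB) _.
  have -> : B * N%:R = B * Num.sqrt N%:R * Num.sqrt N%:R by rewrite -mulrA s2.
  by apply: ler_wpM2l.
have h0 : 0 <= (1 - lambda) / N%:R by rewrite divr_ge0 // subr_ge0 ltW.
apply: le_trans (ler_wpM2l h0 h1) _.
rewrite mulrCA mulfVK ?gt_eqF //; rewrite ler_piMr //; lra.
Qed.

End Model.

(** * Tail bounds *)

Section Tails.
Context {R : realType} (lambda mu p : R) (N T : nat) (Pp : {set 'I_N}).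
Hypotheses (lambda01 : 0 < lambda < 1) (mu01 : 0 < mu <= lambda) (p01 : 0 < p <= 1).
Hypotheses (N0 : (0 < N)%N) (T0 : (0 < T)%N).
Context {d : measure_display} {Omega : measurableType d}
  {P : probability Omega R}.
Variables (theta : 'I_N -> 'I_N -> {RV P >-> bool})
  (X : int -> 'I_N -> {RV P >-> bool}).
Hypothesis chain : community_chain lambda mu p Pp theta X.
Local Notation C := {ffun 'I_N -> bool}.
Local Notation trans := (trans_prob lambda mu Pp).
Local Notation act := (act_prob lambda mu Pp).
Local Notation outcome := ('M[bool]_N * T.+1.-tuple C)%type.
Local Notation weight := (fun i : outcome => path_weight theta X i.1 i.2).
Local Notation eps := (Num.sqrt (N%:R / T%:R) : R).
Implicit Types (A : 'M[bool]_N) (c : C) (s : T.+1.-tuple C).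

Let NR : 0 < N%:R :> R. Proof. by rewrite ltr0n. Qed.
Let TR : 0 < T%:R :> R. Proof. by rewrite ltr0n. Qed.
Let sN : 0 < Num.sqrt N%:R :> R. Proof. by rewrite sqrtr_gt0. Qed.
Let sT : 0 < Num.sqrt T%:R :> R. Proof. by rewrite sqrtr_gt0. Qed.
Let epsE : eps = Num.sqrt N%:R / Num.sqrt T%:R.
Proof. by rewrite sqrtrM ?(ltW NR) // sqrtrV // ltW. Qed.
Let eps0 : 0 <= eps. Proof. exact: sqrtr_ge0. Qed.
Let eps2 : eps ^+ 2 * T%:R = N%:R.
Proof. by rewrite sqr_sqrtr ?divfK ?gt_eqF // divr_ge0 // ltW. Qed.

(** The predecessor aligns times, which start at 1, with tuple positions, which start at 0. *)
Definition path_vec s (t : nat) : 'cV[R]_N := conf_vec (nth (c0 N) s t.-1).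

Local Notation inn A s := (innov (path_vec s) (interaction lambda Pp A) (baseline
  lambda mu Pp A)).

Lemma graph_weightE A : graph_weight p A =
  bern_weight (fun=> p) [ffun ij : 'I_N * 'I_N => A ij.1 ij.2] :> R.
Proof.
rewrite /graph_weight pair_big /bern_weight; apply: eq_bigr => -[i j] _.
by rewrite ffunE.
Qed.

Lemma sum_graph_weight (f : {ffun 'I_N * 'I_N -> bool} -> R) :
  \sum_(A : 'M[bool]_N) graph_weight p A * f [ffun ij => A ij.1 ij.2]
    = bern_exp (fun=> p) f.
Proof.
rewrite /bern_exp (reindex (fun A : 'M[bool]_N => [ffun ij :
  'I_N * 'I_N => A ij.1 ij.2])) /=.
  by apply: eq_bigr => A _; rewrite graph_weightE.
exists (fun y : {ffun 'I_N * 'I_N -> bool} => \matrix_(i, j) y (i, j)) => y _.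
  by apply/matrixP => i j; rewrite mxE ffunE.
by apply/ffunP => -[i j]; rewrite ffunE mxE.
Qed.

Lemma sum_graph_weight1 : \sum_(A : 'M[bool]_N) graph_weight p A = 1 :> R.
Proof.
have := sum_graph_weight (fun=> 1); rewrite bern_exp_const => <-.
by apply: eq_bigr => A _; rewrite mulr1.
Qed.

Lemma sum_outcome (f : 'M[bool]_N -> T.+1.-tuple C -> R) :
  \sum_(i : outcome) f i.1 i.2 = \sum_(A : 'M[bool]_N) \sum_s f A s.
Proof. by rewrite pair_big. Qed.

Lemma chain_chernoff (F : 'M[bool]_N -> C -> C -> R) (K : R) :
  0 <= K -> (forall A x y, 0 <= F A x y) ->
  (forall A x, \sum_y trans A x y * F A x y <= K) ->
  \sum_(i : outcome) weight i * \prod_(k < T) F i.1 (nth (c0 N) i.2 k) (nth (c0 N) i.2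
    k.+1)
    <= K ^+ T.
Proof.
move=> K0 F0 FK.
rewrite (sum_outcome (fun A s => path_weight theta X A s *
  \prod_(k < T) F A (nth (c0 N) s k) (nth (c0 N) s k.+1))).
apply: (@le_trans _ _ (\sum_(A : 'M[bool]_N) graph_weight p A * K ^+ T)).
  by apply: ler_sum => A _; apply: (sum_path_prod chain).
by rewrite -mulr_suml sum_graph_weight1 mul1r.
Qed.

Lemma trans_exp A x (f : C -> R) : \sum_y trans A x y * f y = bern_exp (act A x) f.
Proof. by []. Qed.

Lemma sum_weight_graph (f : 'M[bool]_N -> R) : (forall A, 0 <= f A) ->
  \sum_(i : outcome) weight i * f i.1 <= \sum_(A : 'M[bool]_N) graph_weight p A * f A.
Proof.
move=> f0; rewrite (sum_outcome (fun A s => path_weight theta X A s * f A)).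
apply: ler_sum => A _; rewrite -mulr_suml; apply: ler_wpM2r => //.
have := sum_path_prod (A := A) (F := fun _ _ => 1) (c :=
  1) chain T ler01 (fun _ _ => ler01).
rewrite expr1n mulr1 => h; apply: le_trans (h _).
  by apply: ler_sum => s _; rewrite big1 // mulr1.
by move=> x; rewrite (trans_exp A x (fun=> 1)) bern_exp_const.
Qed.

Lemma weight_ge0 (i : outcome) : 0 <= weight i.
Proof. exact: path_weight_ge0. Qed.

Lemma act01 A x j : 0 <= act A x j <= 1.
Proof. exact: act_prob01. Qed.

Lemma dot_innov A s (y : 'cV[R]_N) (k : nat) :
  dot y (inn A s k.+1) = noise (act A (nth (c0 N) s k)) (fun j => y j 0) (nth (c0 N) s
    k.+1).
Proof.
apply: eq_bigr => j _; congr (_ * _).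
by rewrite /innov colBE act_probE /path_vec /= [conf_vec _ j 0]mxE.
Qed.

Lemma sum_nat_ord (f : nat -> R) : \sum_(1 <= t < T.+1) f t = \sum_(k < T) f k.+1.
Proof. by rewrite big_add1 /= big_mkord. Qed.

Lemma dot_sqr_sum (y : 'cV[R]_N) : \sum_j y j 0 ^+ 2 = dot y y.
Proof. by apply: eq_bigr => j _; rewrite expr2. Qed.

(** The net bound is used with K = 2, the constant of [noise_mgf]: for x and y in the unit ball the
    coefficients sqrt N x_i y_j have square sum at most N. *)
Lemma adjacency_tail :
  \sum_(i : outcome | ~~ `[< opnorm_le (adjacency i.1 - const_mx p :
    'M[R]_N) (78 * Num.sqrt N%:R) >]) weight i
    <= expR (- N%:R).
Proof.
have -> : 78 * Num.sqrt N%:R = 2 * ((2 + 37) * Num.sqrt N%:R) :> R by ring.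
apply: (net_union_bound (I := outcome) (G := predT) N0 weight_ge0) => x y x1 y1.
have := sum_weight_graph (fun A => expR_ge0 (Num.sqrt N%:R * dot x ((adjacency A -
  const_mx p) *m y))).
move=> h; apply: le_trans h _.
pose s (ij : 'I_N * 'I_N) := Num.sqrt N%:R * (x ij.1 0 * y ij.2 0).
have e A : expR (Num.sqrt N%:R * dot x ((adjacency A - const_mx p) *m y)) =
   expR (noise (fun=> p) s [ffun ij => A ij.1 ij.2]).
  congr expR; transitivity (\sum_i \sum_j s (i, j) * ((A i j : nat)%:R - p)).
    rewrite /dot mulr_sumr; apply: eq_bigr => i _; rewrite mxE !mulr_sumr.
    by apply: eq_bigr => j _; rewrite !mxE /s /=; ring.
  by rewrite pair_big /=; apply: eq_bigr => -[i j] _; rewrite ffunE.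
under eq_bigr do rewrite e.
rewrite (sum_graph_weight (fun y => expR (noise (fun=> p) s y))).
have p01' (ij : 'I_N * 'I_N) : 0 <= p <= 1 by have /andP[/ltW -> ->] := p01.
apply: le_trans (noise_mgf p01' s) _; rewrite ler_expR ler_pM2l //.
have -> : \sum_ij s ij ^+ 2 = N%:R * (dot x x * dot y y).
  rewrite -[N%:R]sqr_sqrtr ?(ltW NR) //.
  transitivity (\sum_i \sum_j s (i, j) ^+ 2).
    by rewrite pair_big /=; apply: eq_bigr => -[i j] _.
  rewrite -!dot_sqr_sum mulr_suml mulr_sumr; apply: eq_bigr => i _.
  by rewrite !mulr_sumr; apply: eq_bigr => j _; rewrite /s /=; ring.
by rewrite ler_piMr ?(ltW NR) // mulr_ile1 ?dot_ge0.
Qed.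

(** Time averages fluctuate on the scale 1 / sqrt T, so the net bound is applied to sqrt T times
    [D]; the tilt of the sum over time becomes eps. *)
Lemma scaled_net_bound (D : outcome -> 'M[R]_N) (G : pred outcome) (K : R) :
  (forall x y : 'cV[R]_N, dot x x <= 1 -> dot y y <= 1 ->
    \sum_(i | G i) weight i * expR (eps * (T%:R * dot x (D i *m y)))
      <= expR (K * N%:R)) ->
  \sum_(i | G i && ~~ `[< opnorm_le (D i) (2 * (K + 37) * eps) >]) weight i
    <= expR (- N%:R).
Proof.
move=> h.
have sTT : Num.sqrt T%:R * Num.sqrt T%:R = T%:R :> R by rewrite -expr2 sqr_sqrtr // ltW.
have := net_union_bound (I := outcome) (w := weight) (M := fun i => Num.sqrt T%:R *: D i)
  (G := G) (K := K) N0 weight_ge0.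
have e i x y : Num.sqrt N%:R * dot x ((Num.sqrt T%:R *: D i) *m y)
    = eps * (T%:R * dot x (D i *m y)).
  rewrite -scalemxAl dotZr.
  transitivity (Num.sqrt N%:R / Num.sqrt T%:R * (Num.sqrt T%:R * Num.sqrt T%:R) * dot x
    (D i *m y)).
    by field; rewrite gt_eqF.
  by rewrite sTT epsE mulrA.
move=> net; apply: le_trans (net _) => [|x y x1 y1]; last first.
  by under eq_bigr do rewrite e; exact: h.
rewrite [leLHS]big_mkcond [leRHS]big_mkcond; apply: ler_sum => i _ /=.
case: (G i) => //=; case: ifPn => [bad|_]; last by case: ifP => // _; exact: weight_ge0.
rewrite ifT //; apply: contra bad => /asboolP hD; apply/asboolP.
have sTn : Num.sqrt T%:R != 0 :> R by rewrite gt_eqF.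
rewrite -[D i](scalerK sTn).
have -> : 2 * (K + 37) * eps = (Num.sqrt T%:R)^-1 * (2 * ((K + 37) * Num.sqrt N%:R)).
  by rewrite epsE; ring.
by apply: opnorm_leZ => //; rewrite invr_ge0 ltW.
Qed.

Lemma T_tmean (f : nat -> R) : T%:R * tmean T f = \sum_(k < T) f k.+1.
Proof. by rewrite /tmean mulrA mulfV ?gt_eqF // mul1r sum_nat_ord. Qed.

(** The hypothesis says eps <= 1 / 128, the range of [noise_bilinear_mgf]. The T transitions
    together contribute exp(K eps^2 T) = exp(K N). *)
Lemma variance_tail : 128 ^+ 2 * N%:R <= T%:R :> R ->
  \sum_(i : outcome | ~~ `[< opnorm_le (cov_innov T (path_vec i.2) (interaction lambda
    Pp i.1) (baseline lambda mu Pp i.1)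
      - mean_var T (path_vec i.2) (interaction lambda Pp i.1) (baseline lambda mu Pp i.1))
     (2 * (bilinear_mgf_const + 37) * eps) >]) weight i
    <= expR (- N%:R).
Proof.
move=> TN.
have eps_le : eps <= 128^-1.
  rewrite -ler_sqr ?nnegrE ?invr_ge0 // -(ler_pM2r TR) eps2 exprVn.
  by rewrite -(@ler_pM2l _ (128 ^+ 2)) // mulrA mulfV // mul1r.
apply: (scaled_net_bound (G := predT)) => x y x1 y1.
pose F A (u v : C) := expR (eps * (noise (act A u) (fun j => x j 0) v * noise (act A u)
  (fun j => y j 0) v
   - \sum_j x j 0 * y j 0 * (act A u j * (1 - act A u j)))).
have h := @chain_chernoff F (expR (bilinear_mgf_const * eps ^+ 2)) (expR_ge0 _) (fun _
  _ _ => expR_ge0 _).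
apply: (@le_trans _ _ (\sum_(i : outcome) weight i *
   \prod_(k < T) F i.1 (nth (c0 N) i.2 k) (nth (c0 N) i.2 k.+1))).
  apply: ler_sum => -[A s] _ /=; apply: ler_wpM2l; first exact: path_weight_ge0.
  rewrite -expR_sum ler_expR -mulr_sumr; apply: ler_wpM2l => //.
  rewrite mulmxBl dotBr dot_tavg_outer /mean_var tavg_mulmxr dot_tavg.
  rewrite mulrBr !T_tmean -sumrB; apply: ler_sum => k _.
  rewrite !dot_innov lerD2l lerN2 le_eqVlt; apply/orP; left; apply/eqP.
  apply: eq_bigr => j _; rewrite mul_diag_mx mxE /innov_var [(\row__ _) _ _]mxE act_probE.
  by rewrite /path_vec /=; ring.
apply: le_trans (h _) _.
  move=> A u; rewrite trans_exp; apply: noise_bilinear_mgf.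
  - exact: act01.
  - by rewrite dot_sqr_sum.
  - by rewrite dot_sqr_sum.
  - by rewrite ger0_norm.
by rewrite -expRM_natl ler_expR mulrCA [T%:R * _]mulrC eps2.
Qed.

(* Exponential supermartingale with predictable variance: the quadratic variation
   of the sum in the direction [(x, y)] is controlled by the first condition. *)
Lemma cross_tail (zeta : C -> 'cV[R]_N) (g : R) :
  \sum_(i : outcome | (`[< forall y, dot y y <= 1 ->
        \sum_(k < T) dot y (zeta (nth (c0 N) i.2 k)) ^+ 2 <= g * T%:R >]) &&
     ~~ `[< opnorm_le (tavg T (fun t => inn i.1 i.2 t *m (zeta (nth (c0 N) i.2 t.-1))^T))
     (2 * (2 * g + 37) * eps) >]) weight i
    <= expR (- N%:R).
Proof.
pose G (i : outcome) := `[< forall y, dot y y <= 1 ->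
        \sum_(k < T) dot y (zeta (nth (c0 N) i.2 k)) ^+ 2 <= g * T%:R >].
apply: (scaled_net_bound (G := G)) => x y x1 y1.
pose F A (u v : C) := expR (eps * dot y (zeta u) * noise (act A u) (fun j => x j 0) v
   - 2 * eps ^+ 2 * dot y (zeta u) ^+ 2).
have h := @chain_chernoff F 1 ler01 (fun _ _ _ => expR_ge0 _).
(* On [G] the compensator 2 eps^2 times the quadratic variation is at most 2 g N, which is the
   prefactor. *)
apply: (@le_trans _ _ (\sum_(i : outcome) expR (2 * g * N%:R) * (weight i *
   \prod_(k < T) F i.1 (nth (c0 N) i.2 k) (nth (c0 N) i.2 k.+1)))); last first.
  rewrite -mulr_sumr -[leRHS]mulr1; apply: ler_wpM2l; first exact: expR_ge0.
  rewrite expr1n in h; apply: h => A u; rewrite trans_exp.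
  have e v : F A u v = expR (- (2 * eps ^+ 2 * dot y (zeta u) ^+ 2)) *
     expR (noise (act A u) (fun j => eps * dot y (zeta u) * x j 0) v).
    by rewrite /F addrC expRD (noiseZ (act A u) _ (fun j => x j 0)).
  rewrite (eq_bern_exp _ e) bern_expZ.
  apply: le_trans (ler_wpM2l (expR_ge0 _) (noise_mgf (act01 A u) _)) _.
  rewrite -expRD -[leRHS]expR0 ler_expR.
  have -> : \sum_j (eps * dot y (zeta u) * x j 0) ^+ 2
    = (eps * dot y (zeta u)) ^+ 2 * dot x x.
    by rewrite -dot_sqr_sum mulr_sumr; apply: eq_bigr => j _; rewrite exprMn.
  have := ler_piMr (sqr_ge0 (eps * dot y (zeta u))) x1; rewrite exprMn; lra.
rewrite [leLHS]big_mkcond; apply: ler_sum => -[A s] _ /=.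
case: ifPn => [/asboolP Gs|_]; last first.
  rewrite mulr_ge0 ?expR_ge0 // mulr_ge0 ?path_weight_ge0 // prodr_ge0 // => k _.
  exact: expR_ge0.
rewrite [leRHS]mulrCA; apply: ler_wpM2l; first exact: path_weight_ge0.
rewrite -expR_sum -expRD ler_expR sumrB -mulr_sumr.
have := Gs y y1 => /= hG.
have hG2 : 2 * eps ^+ 2 * \sum_(k < T) dot y (zeta (nth (c0 N) s k)) ^+ 2 <= 2 * g * N%:R.
  have e2 : 0 <= 2 * eps ^+ 2 by rewrite mulr_ge0 // sqr_ge0.
  apply: le_trans (ler_wpM2l e2 hG) _.
  have -> : 2 * eps ^+ 2 * (g * T%:R) = 2 * g * (eps ^+ 2 * T%:R) by ring.
  by rewrite eps2.
have -> : eps * (T%:R * dot x (tavg T (fun t => inn A s t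
  *m (zeta (nth (c0 N) s t.-1))^T) *m y)) =
    \sum_(k < T) eps * dot y (zeta (nth (c0 N) s k)) *
      noise (act A (nth (c0 N) s k)) (fun j => x j 0) (nth (c0 N) s k.+1).
  rewrite dot_tavg_outer T_tmean mulr_sumr; apply: eq_bigr => k _.
  by rewrite dot_innov /=; ring.
lra.
Qed.

End Tails.

Lemma error_const_ge0 (R : realType) (q B B4 : R) :
  0 < q < 1 -> 1 <= B -> 0 <= B4 -> 0 <= error_const q B B4.
Proof.
move=> q01 B1 B40; have g1 := cov_bound_ge1 q01 B1.
rewrite /error_const /remainder_const; move: (cov_bound q B) g1 => g g1; nra.
Qed.

(** * Outcomes on which the spectral method succeeds *)

Section GoodOutcome.
Context {R : realType} (lambda mu p k : R) (N T : nat) (Pp : {set 'I_N}).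
Hypotheses (lambda01 : 0 < lambda < 1) (mu01 : 0 < mu <= lambda) (p01 : 0 < p <= 1).
Hypotheses (N0 : (0 < N)%N) (T0 : (0 < T)%N) (NT : (N <= T)%N) (k01 : 0 < k <= 1).
Hypotheses (hP : k / 2 * N%:R <= #|Pp|%:R) (hPc : k / 2 * N%:R <= #|~: Pp|%:R).
Local Notation C := {ffun 'I_N -> bool}.
Local Notation eps := (Num.sqrt (N%:R / T%:R) : R).
Local Notation eta := ((Num.sqrt N%:R)^-1 : R).
Local Notation mb := (mean_field lambda mu p Pp).

(** The level of the variance event. It exceeds 78 = 2 * (2 + 37), so it also serves for the graph
    and for the mean noise. *)
Definition noise_const : R := 2 * (bilinear_mgf_const + 37).
Definition cov_const : R := cov_bound (1 - lambda) noise_const.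
Definition cross_const : R := 2 * (2 * cov_const + 37).
Definition total_const : R := error_const (1 - lambda) noise_const cross_const.
Definition var_const : R := (1 - lambda) * p * (1 - lambda) * k ^+ 2 / 16.
(** The constant of [spectral_recovery] with the bound of [beta_le] for C and with m (1 - m)
    replaced by its lower bound [var_const], which is free of mu. *)
Definition rate_const : R := 2 * (cov_const + cov_const * cov_const + 1)
  / ((1 - lambda) * p * (var_const * k) ^+ 2).

Let l01 : 0 < 1 - lambda < 1.
Proof. by have /andP[? ?] := lambda01; apply/andP; split; lra. Qed.

Lemma noise_const_ge78 : 78 <= noise_const.
Proof. by rewrite /noise_const /bilinear_mgf_const; lra. Qed.

Let B1 : 1 <= noise_const. Proof. by have := noise_const_ge78; lra. Qed.
Let B0 : 0 <= noise_const. Proof. exact: le_trans B1. Qed.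

Lemma cov_const_ge1 : 1 <= cov_const.
Proof. exact: cov_bound_ge1. Qed.

Lemma cross_const_ge0 : 0 <= cross_const.
Proof. by rewrite /cross_const; have := cov_const_ge1; lra. Qed.

Lemma total_const_ge0 : 0 <= total_const.
Proof. by apply: error_const_ge0 => //; exact: cross_const_ge0. Qed.

Lemma var_const_gt0 : 0 < var_const.
Proof.
have /andP[l0 l1] := l01; have /andP[p0 _] := p01; have /andP[k0 _] := k01.
by rewrite /var_const divr_gt0 // !mulr_gt0 // exprn_gt0.
Qed.

Lemma rate_const_gt0 : 0 < rate_const.
Proof.
have /andP[l0 l1] := l01; have /andP[p0 _] := p01; have /andP[k0 _] := k01.
have := cov_const_ge1; have := var_const_gt0 => v0 c1.
rewrite /rate_const divr_gt0 //; first by nra.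
by rewrite !mulr_gt0 // exprn_gt0 // mulr_gt0.
Qed.

Local Notation zeta := (fun c : C => conf_vec c - mb *: ones : 'cV[R]_N).
Local Notation zeta1 := (fun c : C => eta *: ones : 'cV[R]_N).
Local Notation intA A := (interaction lambda Pp A).
Local Notation basA A := (baseline lambda mu Pp A).

Definition bad_adjacency (i : 'M[bool]_N * T.+1.-tuple C) : bool :=
  ~~ `[< opnorm_le (adjacency i.1 - const_mx p : 'M[R]_N) (78 * Num.sqrt N%:R) >].
Definition bad_variance (i : 'M[bool]_N * T.+1.-tuple C) : bool :=
  ~~ `[< opnorm_le (cov_innov T (path_vec i.2) (intA i.1) (basA i.1)
      - mean_var T (path_vec i.2) (intA i.1) (basA i.1)) (noise_const * eps) >].
(** The covariance bound is part of the event: the tail estimate holds only under it, and on good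
    outcomes it is verified deterministically. *)
Definition bad_cross (z : C -> 'cV[R]_N) (g : R) (i : 'M[bool]_N * T.+1.-tuple C) :
  bool :=
  `[< forall y, dot y y <= 1 ->
        \sum_(k < T) dot y (z (nth (c0 N) i.2 k)) ^+ 2 <= g * T%:R >] &&
  ~~ `[< opnorm_le (tavg T (fun t => innov (path_vec i.2) (intA i.1) (basA i.1) t
          *m (z (nth (c0 N) i.2 t.-1))^T)) (2 * (2 * g + 37) * eps) >].

(* The constant direction [zeta1] turns the cross-covariance bound into a bound on
   the mean noise. *)
Definition bad_outcome i : bool :=
  [|| bad_adjacency i, bad_variance i, bad_cross zeta cov_const i | bad_cross zeta1 1 i].

Lemma good_outcome_rate A (s : T.+1.-tuple C) (v : 'cV[R]_N) :
  ~~ bad_outcome (A, s) ->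
  8 * (total_const * (eps + eta)) <= (1 - lambda) * p * var_const * k ->
  rate_const * (total_const * (eps + eta)) <= k / 4 ->
  leading_right_singular_vector (Sigmahat T (path_vec s)) v ->
  misclassification_rate Pp (spectral_plus T (path_vec s) v) (spectral_minus T
    (path_vec s) v)
    <= (rate_const * (total_const * (eps + eta))) ^+ 2.
Proof.
rewrite !negb_or => /and4P[/negPn/asboolP hadj /negPn/asboolP hvar hcr hcr1] small1
  small2 lead.
have NR : 0 < N%:R :> R by rewrite ltr0n.
have TR : 0 < T%:R :> R by rewrite ltr0n.
have sN : 0 < Num.sqrt N%:R :> R by rewrite sqrtr_gt0.
have s2 : Num.sqrt N%:R ^+ 2 = N%:R :> R by rewrite sqr_sqrtr // ltW.
have e0 : 0 <= eps by exact: sqrtr_ge0.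
have eta0 : 0 <= eta by rewrite invr_ge0 ltW.
have /andP[l0 l1] := l01; have /andP[p0 p1] := p01; have /andP[k0 k1] := k01.
have hadj' : opnorm_le (adjacency A - const_mx p : 'M[R]_N) (noise_const * Num.sqrt N%:R).
  apply: opnorm_leW hadj; apply: ler_wpM2r; [exact: ltW|exact: noise_const_ge78].
have x01 t i : 0 <= path_vec (R := R) s t i 0 <= 1.
  by rewrite /path_vec mxE ler0n lern1 leq_b1.
have p01' t i : 0 <= (basA A + intA A *m path_vec s t) i 0 <= 1.
  by rewrite -act_probE; exact: act_prob01.
have hint : opnorm_le (intA A) (1 - lambda) by exact: opnorm_le_interaction.
have mb01 := mean_field01 Pp lambda01 mu01 p01 N0.
have hrho := mean_field_residual Pp lambda01 mu01 p01 N0 B0 hadj'.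
have a01 : 0 < (1 - lambda) * p <= 1.
  by rewrite mulr_gt0 // mulr_ile1 // ltW.
have hnoise := opnorm_le_noise_part Pp lambda01 N0 B0 hadj'.
have hcross : opnorm_le (cross_shifted T (path_vec s) (intA A) (basA A) (mb *: ones))
  (cross_const * eps).
  move: hcr; rewrite /bad_cross negb_and negbK => /orP[/asboolPn h|/asboolP //].
  (* The good variance event supplies the quadratic variation bound required by the cross covariance
     event. *)
  exfalso; apply: h => y y1; have h := tmean_Z_le T0 N0 NT l01 B1 mb01 x01 p01' hint
    hrho hvar y.
  rewrite -(T_tmean T0 (fun t => dot y (shifted (path_vec s) (mb *: ones) t) ^+ 2)) mulrC.
  apply: ler_wpM2r; first exact: ltW.
  apply: le_trans h _; rewrite ler_piMr //; apply: le_trans ler01 _; exact: cov_const_ge1.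
have hxi : nrm (xibar T (path_vec s) (intA A) (basA A)) <= noise_const * eps.
  have o1 : dot (eta *: ones : 'cV[R]_N) (eta *: ones) = 1.
    by rewrite -nrm_sqr nrmZ nrm_ones ger0_norm // mulVf ?expr1n // gt_eqF.
  have sum1 (y : 'cV[R]_N) : dot y y <= 1 -> \sum_(j < T) dot y (eta *: ones) ^+ 2
    <= 1 * T%:R.
    move=> y1; rewrite sumr_const card_ord mul1r -[_ *+ T]mulr_natl ler_piMr ?(ltW TR) //.
    apply: le_trans (dot_sqr_le _ _) _; rewrite -[leRHS]mulr1 ler_pM ?dot_ge0 //.
    by rewrite o1.
  move: hcr1; rewrite /bad_cross negb_and negbK => /orP[/asboolPn h|/asboolP h];
    first by exfalso; apply: h.
  (* For a unit vector z, xibar = (xibar z^T) z, so an operator norm bound controls the norm of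
     xibar. *)
  have xE : xibar T (path_vec s) (intA A) (basA A) =
     tavg T (fun t => innov (path_vec s) (intA A) (basA A) t *m (eta *: ones :
       'cV[R]_N)^T) *m (eta *: ones : 'cV[R]_N).
    have -> : tavg T (fun t => innov (path_vec s) (intA A) (basA A) t *m (eta *: ones :
      'cV[R]_N)^T)
        = xibar T (path_vec s) (intA A) (basA A) *m (eta *: ones : 'cV[R]_N)^T.
      by rewrite /xibar tavg_mulmxr.
    by rewrite mulmx_outer o1 scale1r.
  have b78 : 0 <= 2 * (2 * 1 + 37) * eps by rewrite mulr_ge0.
  rewrite xE; apply: le_trans (opnorm_le_nrm _ b78 h) _.
  rewrite nrmZ nrm_ones ger0_norm // mulVf ?gt_eqF // [leLHS]mulr1;
    apply: ler_wpM2r => //.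
  by have := noise_const_ge78; lra.
have [E SE hE] := spectral_error T0 N0 NT l01 B1 mb01 x01 p01' hint hrho hvar a01
  cross_const_ge0 (interaction_split lambda p Pp A) hnoise (interaction_frob Pp
    lambda01 N0 A) hcross hxi.
have hbeta := beta_le T0 N0 NT l01 B1 mb01 x01 p01' hint hrho hvar Pp a01.
have hd := mean_field_var_ge lambda01 mu01 p01 N0 (ltW k0) (_ :
  k / 2 <= #|~: Pp|%:R / N%:R).
have {}hd : var_const <= mb * (1 - mb) by apply: hd; rewrite ler_pdivlMr.
have v0 := var_const_gt0.
have d01 : 0 < mb * (1 - mb) <= 1.
  by rewrite (lt_le_trans v0 hd) /=; move: mb01; nra.
have t0 : 0 <= total_const * (eps + eta) by rewrite mulr_ge0 ?total_const_ge0 // addr_ge0.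
have small1' : 8 * (total_const * (eps + eta)) <= (1 - lambda) * p * (mb * (1 - mb)) * k.
  apply: le_trans small1 _; apply: ler_wpM2r; first exact: ltW.
  by apply: ler_wpM2l => //; rewrite mulr_ge0 // ltW.
have g1 := cov_const_ge1.
have rate_le : 2 * (cov_const + cov_const * cov_const + 1)
    / ((1 - lambda) * p * (mb * (1 - mb) * k) ^+ 2) * (total_const * (eps + eta))
    <= rate_const * (total_const * (eps + eta)).
  apply: ler_wpM2r => //; apply: ler_wpM2l; first by nra.
  have dk : 0 < var_const * k by rewrite mulr_gt0.
  have dk2 : var_const * k <= mb * (1 - mb) * k by apply: ler_wpM2r => //; exact: ltW.
  have dk3 := lt_le_trans dk dk2.
  have pos (r : R) : 0 < r -> 0 < (1 - lambda) * p * r ^+ 2.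
    by move=> r0; rewrite mulr_gt0 ?mulr_gt0 // exprn_gt0.
  rewrite lef_pV2 ?posrE; [|exact: pos|exact: pos].
  apply: ler_wpM2l; first by rewrite mulr_ge0 // ltW.
  by rewrite ler_sqr // nnegrE ltW.
have rate0 : 0 <= 2 * (cov_const + cov_const * cov_const + 1)
    / ((1 - lambda) * p * (mb * (1 - mb) * k) ^+ 2) * (total_const * (eps + eta)).
  rewrite mulr_ge0 // divr_ge0 //; first by nra.
  by rewrite mulr_ge0 ?sqr_ge0 // mulr_ge0 // ltW.
have h := spectral_recovery N0 a01 d01 k01 hbeta t0 hP hPc SE hE lead small1'.
have rr := le_trans rate_le small2.
apply: le_trans (h _) _.
  (* Since k <= 1, the square of k / 4 is at most the k / 16 that [spectral_recovery] requires. *)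
  apply: (@le_trans _ _ ((k / 4) ^+ 2)).
    by rewrite ler_sqr // nnegrE divr_ge0 // ltW.
  by rewrite expr_div_n; have := ler_piMr (ltW k0) k1; rewrite expr2; lra.
by rewrite ler_sqr // nnegrE; exact: le_trans rate_le.
Qed.

End GoodOutcome.

Lemma sumr_orb_le (R : realType) (I : finType) (a b : pred I) (w : I -> R) :
  (forall i, 0 <= w i) ->
  \sum_(i | a i || b i) w i <= \sum_(i | a i) w i + \sum_(i | b i) w i.
Proof.
move=> w0; rewrite big_mkcond [X in _ <= X + _]big_mkcond [X in _ <= _ + X]big_mkcond.
rewrite -big_split; apply: ler_sum => i _ /=.
by case: (a i); case: (b i); rewrite /= ?addr0 ?add0r ?lerDl.
Qed.

Lemma eq_Sigmahat (R : realType) (N T : nat) (x y : nat -> 'cV[R]_N) :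
  (forall t, (1 <= t <= T.+1)%N -> x t = y t) -> Sigmahat T x = Sigmahat T y.
Proof.
move=> xy; have m : mhat T x = mhat T y.
  congr (_ *: _); apply: eq_big_nat => t /andP[t1 tT].
  by apply: xy; rewrite t1 ltnW.
congr (_ *: _); apply: eq_big_nat => t /andP[t1 tT].
by rewrite m !xy // ?t1 // ltnW.
Qed.

(** * Measurability of the misclassification event *)

Section Event.
Context {R : realType} (N T : nat) (Pp : {set 'I_N}).
Context {d : measure_display} {Omega : measurableType d}
  {P : probability Omega R}.
Variables (X : int -> 'I_N -> {RV P >-> bool}) (v : 'I_N -> {RV P >-> R}).
Local Notation V w := (\col_i v i w).

Lemma sample_trace w t : (1 <= t <= T.+1)%N ->
  sample X w t = path_vec (trace X T w) t.
Proof.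
case: t => [//|t] /andP[_ tT].
apply/colP => i; rewrite !mxE /=.
rewrite -(tnth_nth (c0 N) (trace X T w) (Ordinal (tT : (t < T.+1)%N))) tnth_mktuple ffunE.
by [].
Qed.

Lemma Sigmahat_trace w : Sigmahat T (sample X w)
  = Sigmahat T (path_vec (trace X T w)) :> 'M[R]_N.
Proof. by apply: eq_Sigmahat => t; exact: sample_trace. Qed.

Lemma spectral_plus_trace w u :
  spectral_plus T (sample X w) u = spectral_plus T (path_vec (trace X T w)) u.
Proof. by rewrite /spectral_plus /sigma_ag Sigmahat_trace. Qed.

Lemma fin_measurable_above_mean (f : 'I_N -> Omega -> R) :
  (forall i, measurable_fun setT (f i)) ->
  fin_measurable (fun w => above_mean (\col_i f i w)).
Proof.
move=> mf.
pose h (b : {ffun 'I_N -> bool}) : {set 'I_N} := finset (fun i => b i).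
have -> : (fun w => above_mean (\col_i f i w)) =
    h \o (fun w => [ffun i => N%:R^-1 * (\sum_j f j w) <= f i w]).
  apply: funext => w; apply/setP => i; rewrite !inE ffunE !mxE.
  by under eq_bigr do rewrite mxE.
apply: fin_measurable_comp; apply: fin_measurable_ffun => i.
apply: fin_measurable_bool; apply: measurable_fun_ler => //.
by apply: measurable_funM => //; apply: measurable_sum.
Qed.

(** The real vector v enters the method only through the partitions of v and - v, so the event
    depends on finitely many values: the path and two vertex sets. *)
Lemma measurable_rate_event (K : R) :
  measurable [set w | K <= misclassification_rate Pp
     (spectral_plus T (sample X w) (V w)) (spectral_minus T (sample X w) (V w))].
Proof.
pose F w := (trace X T w, (above_mean (V w), above_mean (\col_i (- v i w)))).
have mF : fin_measurable F.
  apply: fin_measurable_pair; first exact: fin_measurable_trace.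
  apply: fin_measurable_pair; first by apply: fin_measurable_above_mean => i.
  by apply: fin_measurable_above_mean => i; exact: measurable_funN.
pose h (i : T.+1.-tuple {ffun 'I_N -> bool} * ({set 'I_N} * {set 'I_N})) : Prop :=
  let ag := sigma_ag T (path_vec (R := R) i.1) in
  let Q := if average (~: i.2.1)%SET ag <= average i.2.1 ag then i.2.1 else i.2.2 in
  K <= misclassification_rate Pp Q (~: Q)%SET.
have -> : [set w | K <= misclassification_rate Pp
     (spectral_plus T (sample X w) (V w)) (spectral_minus T (sample X w) (V w))]
       = F @^-1` [set i | h i].
  apply/seteqP; split => w /=; rewrite /h /spectral_minus !spectral_plus_trace
    /spectral_plus /sigma_sp /=;
    have -> : \col_i (- v i w) = - V w by [apply/colP => i; rewrite !mxE];
    by case: ifP.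
exact: fin_measurable_preimage.
Qed.

End Event.

Section Probability.
Context {R : realType} (lambda mu p k : R) (N T : nat) (Pp : {set 'I_N}).
Hypotheses (lambda01 : 0 < lambda < 1) (mu01 : 0 < mu <= lambda) (p01 : 0 < p <= 1).
Hypotheses (N0 : (0 < N)%N) (T0 : (0 < T)%N).
Context {d : measure_display} {Omega : measurableType d}
  {P : probability Omega R}.
Variables (theta : 'I_N -> 'I_N -> {RV P >-> bool})
  (X : int -> 'I_N -> {RV P >-> bool}).
Hypothesis chain : community_chain lambda mu p Pp theta X.

Lemma bad_outcome_probability (E : set Omega) : 128 ^+ 2 * N%:R <= T%:R :> R ->
  measurable E ->
  (forall w, E w -> bad_outcome lambda mu p Pp (graph theta w, trace X T w)) ->
  (P E <= (4 * expR (- N%:R))%:E)%E.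
Proof.
move=> TN mE bad; apply: le_trans (probability_le_sum mE bad) _.
rewrite lee_fin /bad_outcome.
have w0 (i : 'M[bool]_N * T.+1.-tuple {ffun 'I_N -> bool}) :
  0 <= path_weight theta X i.1 i.2.
  exact: path_weight_ge0.
apply: le_trans (sumr_orb_le _ _ w0) _.
have h1 := adjacency_tail T p01 N0 chain.
apply: le_trans (lerD h1 (sumr_orb_le _ _ w0)) _.
have h2 := variance_tail lambda01 mu01 N0 T0 chain TN.
apply: le_trans (lerD (lexx _) (lerD h2 (sumr_orb_le _ _ w0))) _.
have h3 := cross_tail lambda01 mu01 N0 T0 chain (fun c => conf_vec c - mean_field
  lambda mu p Pp *: ones)
  (cov_const lambda).
have h4 := cross_tail lambda01 mu01 N0 T0 chain (fun c => (Num.sqrt N%:R)^-1 *: ones) 1.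
apply: le_trans (lerD (lexx _) (lerD (lexx _) (lerD h3 h4))) _.
lra.
Qed.

End Probability.

(** * Numerical estimates for the final constants *)

Lemma ln2_ge_half (R : realType) : 2^-1 <= ln 2 :> R.
Proof.
rewrite -[leLHS]expRK ler_ln ?posrE ?expR_gt0 //; exact: expR_half_le2.
Qed.

Lemma ln_ge2 (R : realType) (x : R) : 16 <= x -> 2 <= ln x.
Proof.
move=> x16; rewrite -[leLHS]expRK ler_ln ?posrE ?expR_gt0 //; last by lra.
apply: le_trans x16.
have -> : expR 2 = (expR 2^-1 ^+ 2) ^+ 2 :> R.
  by rewrite -exprM -expRM_natl; congr expR; field.
have := expR_half_le2 (R := R); have := expR_gt0 (2^-1 : R); set e := expR _ => e0 e2.
have h : e ^+ 2 <= 4 by nra.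
have := sqr_ge0 e; nra.
Qed.

(** Makes the lower bound on T in the theorem imply T >= K3 N. With x >= 40 and ln t >= 1/2, the
    argument x ln t is at least 16 and its logarithm at least 2. *)
Lemma log_factor_ge1 (R : realType) (x t : R) : 40 <= x -> 2 <= t ->
  1 <= ln t * ln (x * ln t).
Proof.
move=> x40 t2; have lt : 2^-1 <= ln t.
  by apply: le_trans (ln2_ge_half R) _; rewrite ler_ln ?posrE //; lra.
have : 2 <= ln (x * ln t) by apply: ln_ge2; nra.
nra.
Qed.

Lemma community_size_ge (R : realType) (c x r K k : R) : 0 < x -> 0 < k -> k <= r ->
  2 * `|K| / k <= x -> `|c / x - r| <= K / x -> k / 2 * x <= c.
Proof.
move=> x0 k0 kr Kx cr; have Kk : K / x <= k / 2.
  rewrite ler_pdivrMr //; move: Kx; rewrite ler_pdivrMr //.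
  by have := ler_norm K; lra.
rewrite -ler_pdivlMr //; have := le_trans cr Kk.
by rewrite ler_norml => /andP[h _]; lra.
Qed.

(** The factor 2 is from the square of a sum; the added 1 makes the inequality strict, as needed
    against an event defined by a weak inequality. *)
Lemma rate_comparison (R : realType) (Q n t L l u w : R) : 0 <= Q -> 0 < n -> 0 < t ->
  1 <= L -> 1 <= l -> u ^+ 2 = n / t -> w ^+ 2 = n^-1 ->
  Q * (u + w) ^+ 2 < (2 * Q + 1) * (n * L / t + l / n).
Proof.
move=> Q0 n0 t0 L1 l1 u2 w2.
have i1 : 0 < n^-1 by rewrite invr_gt0.
have i2 : 0 < n / t by rewrite divr_gt0.
have b1 : n / t + n^-1 <= n * L / t + l / n.
  by rewrite mulrAC lerD ?ler_peMr ?ler_peMl // ltW.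
have e1 : Q * (u + w) ^+ 2 <= 2 * Q * (n / t + n^-1).
  have -> : 2 * Q * (n / t + n^-1) = Q * (2 * (n / t + n^-1)) by ring.
  by apply: ler_wpM2l => //; rewrite -u2 -w2; have := sqr_ge0 (u - w); lra.
apply: (le_lt_trans e1); apply: (@lt_le_trans _ _ ((2 * Q + 1) * (n / t + n^-1))).
  by rewrite ltr_pM2r ?addr_gt0 // ltrDl.
by apply: ler_wpM2l => //; rewrite addr_ge0 // mulr_ge0.
Qed.

Lemma small_error_threshold (R : realType) (t r c k : R) :
  0 <= t -> 0 < r -> 0 < c -> 0 < k ->
  exists2 delta, 0 < delta &
    forall S, 0 <= S -> S <= delta -> 8 * (t * S) <= c /\ r * (t * S) <= k / 4.
Proof.
move=> t0 r0 c0 k0; have t1 : 0 < t + 1 by rewrite ltr_wpDl.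
have r4 : 0 < 4 * r * (t + 1) by rewrite mulr_gt0 // mulr_gt0.
have t8 : 0 < 8 * (t + 1) by rewrite mulr_gt0.
(* t + 1 instead of t avoids a division by zero. *)
exists (Num.min (c / (8 * (t + 1))) (k / (4 * r * (t + 1)))).
  by rewrite lt_min; apply/andP; split; exact: divr_gt0.
move=> S S0; rewrite le_min => /andP[].
rewrite (ler_pdivlMr _ _ t8) (ler_pdivlMr _ _ r4) => h1 h2; split; first lra.
have := mulr_ge0 (ltW r0) S0; lra.
Qed.

Theorem theorem2p11 (R : realType) (K0 lambda p rp rm : R)
    (hlambda : 0 < lambda < 1) (hp : 0 < p <= 1)
    (hrp : 0 < rp < 1) (hrm : 0 < rm < 1) (hr : rp + rm = 1) :
  exists (N0 : nat) (K1 K2 K3 : R), [/\ 0 < K1, 0 < K2, 0 < K3 &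
    forall (mu : R) (N T : nat) (Pp : {set 'I_N})
      (d : measure_display) (Omega : measurableType d)
      (P : probability Omega R)
      (theta : 'I_N -> 'I_N -> {RV P >-> bool})
      (X : int -> 'I_N -> {RV P >-> bool})
      (v : 'I_N -> {RV P >-> R}),
    0 < mu <= lambda ->
    Num.max `|#|Pp|%:R / N%:R - rp| `|#|(~: Pp)%SET|%:R / N%:R - rm|
      <= K0 / N%:R ->
    community_chain lambda mu p Pp theta X ->
    (forall w, leading_right_singular_vector
                 (Sigmahat T (sample X w)) (\col_i v i w)) ->
    (N0 <= N)%N ->
    Num.max (K3 * N%:R * ln T%:R * ln (N%:R * ln T%:R)) 2 <= T%:R ->
    (P [set w | (K1 * (N%:R * ln T%:R * ln (N%:R * ln T%:R) / T%:R
                       + ln N%:R / N%:R)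
                 <= misclassification_rate Pp
                      (spectral_plus T (sample X w) (\col_i v i w))
                      (spectral_minus T (sample X w) (\col_i v i w)))%R]
     <= (K2 * (Num.sqrt (N%:R / T%:R) + N%:R^-1))%:E)%E].
Proof.
have /andP[l0 l1] := hlambda; have /andP[p0 p1] := hp.
have /andP[rp0 rp1] := hrp; have /andP[rm0 rm1] := hrm.
pose k := Num.min rp rm.
have k01 : 0 < k <= 1 by rewrite lt_min rp0 rm0 ge_min (ltW rp1).
have /andP[k0 k1] := k01.
have kp : k <= rp by rewrite ge_min lexx.
have km : k <= rm by rewrite ge_min lexx orbT.
have tc0 : 0 <= total_const lambda by exact: total_const_ge0.
have rc0 : 0 < rate_const lambda p k by exact: rate_const_gt0.
have vc0 : 0 < var_const lambda p k by exact: var_const_gt0.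
(* From here on only the signs of the constants matter; abstracting them keeps the arithmetic from
   unfolding them. *)
move: (total_const lambda) (rate_const lambda p k) (var_const lambda p k) tc0 rc0 vc0
  (fun mu => @good_outcome_rate R lambda mu p k) => tc rc vc tc0 rc0 vc0 good_rate.
have [delta delta0 small] : exists2 delta, 0 < delta & forall S, 0 <= S -> S <= delta ->
    8 * (tc * S) <= (1 - lambda) * p * vc * k /\ rc * (tc * S) <= k / 4.
  by apply: small_error_threshold => //; rewrite !mulr_gt0 // subr_gt0.
(* N >= D and T >= D N make eta and eps at most delta / 2 each. *)
pose D := (2 / delta) ^+ 2.
have D0 : 0 < D by rewrite exprn_gt0 // divr_gt0.
pose Q := (rc * tc) ^+ 2.
have Q0 : 0 <= Q by exact: sqr_ge0.
have M0 : 0 < 128 ^+ 2 :> R by rewrite exprn_gt0.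
move: (128 ^+ 2 : R) M0 (fun mu N T Pp hmu N0 T0 d Omega P theta X =>
  @bad_outcome_probability R lambda mu p N T Pp hlambda hmu hp N0 T0 d Omega P theta X)
  => M M0 bad_probability.
(* The three summands serve eta, the community sizes and the logarithms, respectively. *)
pose N0 := (Num.truncn D + Num.truncn (2 * `|K0| / k) + 40)%N.
(* 4 counts the bad events. In the last constant, M is for the variance event, D for eps, and 1 for
   N <= T. *)
exists N0, (2 * Q + 1), 4, (M + D + 1); split => //.
- by rewrite ltr_wpDl // mulr_ge0.
- by rewrite !addr_gt0.
move=> mu N T Pp d Omega P theta X v hmu hprop chain lead N0N hT.
have N_ge (x : R) (m : nat) : 0 <= x -> (Num.truncn x + m <= N)%N -> (0 < m)%N ->
  x <= N%:R.
  move=> x0 xN m0; have /andP[_ h] := truncn_itv x0; apply: (le_trans (ltW h)).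
  by rewrite ler_nat; apply: leq_trans xN; rewrite -addn1 leq_add2l.
have ND : D <= N%:R.
  by apply: (N_ge _ (Num.truncn (2 * `|K0| / k) + 40)%N);
    rewrite ?(ltW D0) // ?addnA // addn_gt0 orbT.
have NK : 2 * `|K0| / k <= N%:R.
  apply: (N_ge _ (Num.truncn D + 40)%N); rewrite ?addn_gt0 ?orbT //.
    by rewrite divr_ge0 ?mulr_ge0 // ltW.
  by rewrite addnCA addnA.
have N40 : (40 <= N)%N by apply: leq_trans N0N; rewrite leq_addl.
have Npos : (0 < N)%N by exact: leq_trans N40.
have NR : 0 < N%:R :> R by rewrite ltr0n.
have N40R : 40 <= N%:R :> R by rewrite (ler_nat R 40).
move: hT; rewrite ge_max => /andP[hT T2].
have Tpos : (0 < T)%N by rewrite -(ltr_nat R) (lt_le_trans _ T2).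
have TR : 0 < T%:R :> R by rewrite ltr0n.
pose L : R := ln T%:R * ln (N%:R * ln T%:R).
have L1 : 1 <= L by exact: log_factor_ge1.
have LE (c : R) : c * ln T%:R * ln (N%:R * ln T%:R) = c * L by rewrite /L mulrA.
have NT : (M + D + 1) * N%:R <= T%:R.
  rewrite LE in hT; apply: le_trans hT; rewrite ler_peMr // mulr_ge0 // ?(ltW NR) //.
  by rewrite !addr_ge0 // ltW.
have NT_ge (c : R) : 0 <= M + D + 1 - c -> c * N%:R <= T%:R.
  by move=> c0; apply: le_trans NT; rewrite ler_wpM2r ?(ltW NR) // -subr_ge0.
have NT1 : (N <= T)%N.
  by rewrite -(ler_nat R) -[leLHS]mul1r NT_ge // addrK addr_ge0 // ltW.
have NTM : M * N%:R <= T%:R.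
  by rewrite NT_ge // addrC -(addrA M) addKr addr_ge0 // ltW.
have NTD : D * N%:R <= T%:R.
  by rewrite NT_ge // addrAC addrK addr_ge0 // ltW.
pose eps : R := Num.sqrt (N%:R / T%:R).
pose eta : R := (Num.sqrt N%:R)^-1.
have eps2 : eps ^+ 2 = N%:R / T%:R by rewrite sqr_sqrtr // divr_ge0 // ltW.
have eta2 : eta ^+ 2 = N%:R^-1 by rewrite exprVn sqr_sqrtr // ltW.
have eps0 : 0 <= eps by exact: sqrtr_ge0.
have eta0 : 0 <= eta by rewrite invr_ge0 sqrtr_ge0.
have half (x : R) : 0 <= x -> x ^+ 2 <= D^-1 -> x <= delta / 2.
  move=> x0; rewrite /D -exprVn invf_div ler_sqr // nnegrE //.
  by rewrite divr_ge0 // ltW.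
have eps_le : eps <= delta / 2.
  by apply: half => //; rewrite eps2 ler_pdivrMr // ler_pdivlMl.
have eta_le : eta <= delta / 2.
  by apply: half => //; rewrite eta2 lef_pV2 ?posrE.
have sum_le : eps + eta <= delta by rewrite [leRHS]splitr lerD.
have [small1 small2] := small _ (addr_ge0 eps0 eta0) sum_le.
move: hprop; rewrite ge_max => /andP[hP1 hP2].
have hP := community_size_ge NR k0 kp NK hP1.
have hPc := community_size_ge NR k0 km NK hP2.
apply: (le_trans (bad_probability _ _ _ _ hmu Npos Tpos _ _ _ _ _ chain _ NTM _ _)).
- exact: measurable_rate_event.
- move=> w /= hw; apply: contraT => good.
  have := lead w; rewrite Sigmahat_trace => leadw.
  have h := good_rate _ _ _ _ hlambda hmu hp Npos Tpos NT1 k01 hP hPc _ _ _ good small1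
    small2 leadw.
  move: hw; rewrite /spectral_minus spectral_plus_trace -/(spectral_minus _ _ _) => hw.
  have := le_trans hw h; rewrite LE leNgt => /negP nlt; exfalso; apply: nlt.
  have -> : (rc * (tc * (eps + eta))) ^+ 2 = Q * (eps + eta) ^+ 2.
    by rewrite /Q -exprMn mulrA.
  apply: rate_comparison => //; apply: (@le_trans _ _ 2); rewrite ?ler1n //.
  by apply: ln_ge2; apply: le_trans N40R; rewrite ler_nat.
(* exp(-N) is at most 1 / N. *)
rewrite lee_fin ler_wpM2l // expRN.
apply: (@le_trans _ _ (N%:R^-1)); last by rewrite lerDr sqrtr_ge0.
rewrite lef_pV2 ?posrE ?expR_gt0 //; apply: le_trans (@expR_ge1Dx R _).
by rewrite lerDr.
Qed.
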